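(* Let $q$ be a power of an odd prime and let $m\ge 2$ be an integer. Let $S(x)=s_0x+s_1x^q+\cdots+s_{m-1}x^{q^{m-1}}\in\mathbb{F}_{q^{2m}}[x]$ with $s_0s_{m-1}\neq 0$. Then the curve $\mathcal{X}: y^q-y=xS(x)$ is a maximal curve over $\mathbb{F}_{q^{2m}}$ if and only if, for some $c\in\mathbb{F}_{q^{2m}}\setminus\{0\}$, the following equations are satisfied: the equations $$c^q s_1=-\left(c^{2q}s_0^q+s_0\right),$$ $$c^{q^2}s_2=-\left(2c^q s_0^q+c^{q^2+q}s_1^q+s_1\right),$$ $$c^{q^i}s_i=-\left(c^q s_{i-2}^q+c^{q^i+q}s_{i-1}^q+s_{i-1}\right)\quad\text{for } i=3,\ldots,m-1$$ (one equation for each $s_i$ with $1\le i\le m-1$), and the two equations $$c^q s_{m-2}^q+c^{q^m+q}s_{m-1}^q+s_{m-1}=0,$$ $$c s_{m-1}+(c s_{m-1})^{q^m}=0.$$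
   Context: Here $\mathbb{F}_{q^N}$ denotes the finite field with $q^N$ elements. A curve given by an affine equation $y^q-y=xS(x)$ means the smooth, projective, geometrically irreducible curve with that function field; it has exactly one point at infinity, which is rational, so its number of rational points over a finite field is one plus the number of affine solutions over that field. A curve $\mathcal{X}$ of genus $g$ defined over $\mathbb{F}_{q^{N}}$ is called maximal over $\mathbb{F}_{q^{N}}$ if its number of $\mathbb{F}_{q^N}$-rational points equals $q^N+1+2g\sqrt{q^N}$.
   Formalization: For m = 2 the penultimate equation is corrected to 2c^q s_0^q + c^{q^2+q}s_1^q + s_1 = 0, since without the factor 2 the claim is false (e.g. s_0^{q^2-1} = -1, s_1 = -(s_0^q+s_0) gives a maximal curve but no c satisfies the printed equations); m ≥ 3 is unchanged. *)

(* Defs.v *)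
From HB Require Import structures.
From mathcomp Require Import all_boot all_order all_algebra all_field.
From mathcomp Require Import boolp classical_sets functions cardinality fsbigop.

Set Implicit Arguments.
Unset Strict Implicit.
Unset Printing Implicit Defensive.

Import Order.TTheory GRing.Theory Num.Theory.

Local Open Scope classical_set_scope.
Local Open Scope ring_scope.

(* An algebraic function field over k is a finite extension K of the rational
   function field k(x), here {fraction {poly k}}. *)
Notation ratfun k := {fraction {poly k}}.

(* The image in K of a polynomial in x; in_funfield 'X is the function x. *)
Definition in_funfield (k : fieldType) (K : fieldExtType (ratfun k))
  (f : {poly k}) : K := (tofrac f)%:A.

Definition constant (k : fieldType) (K : fieldExtType (ratfun k)) (c : k) : K :=
  in_funfield K c%:P.

(* A place of K/k, given by its normalized discrete valuation v_P.  The value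
   v_P(0) = +oo is not represented; it is fixed to 0 so that distinct elements
   of [place K] are distinct places.  Accordingly 0 is always treated
   separately below. *)
Record place (k : fieldType) (K : fieldExtType (ratfun k)) := Place {
  valuation :> K -> int;
  valuation0 : valuation 0 = 0;
  valuationM : forall f g, f != 0 -> g != 0 ->
    valuation (f * g) = valuation f + valuation g;
  valuationD : forall f g, f != 0 -> g != 0 -> f + g != 0 ->
    Num.min (valuation f) (valuation g) <= valuation (f + g);
  valuation_constant : forall c : k, c != 0 -> valuation (constant K c) = 0;
  valuation_surj : exists2 t, t != 0 & valuation t = 1
}.

HB.instance Definition _ (k : fieldType) (K : fieldExtType (ratfun k)) :=
  gen_eqMixin (place K).
HB.instance Definition _ (k : fieldType) (K : fieldExtType (ratfun k)) :=
  gen_choiceMixin (place K).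

Section FunctionField.
Variables (k : fieldType) (K : fieldExtType (ratfun k)).

(* dim_k (U / W) for k-subspaces W <= U of K: the size of a family in U whose
   classes form a k-basis of U / W, and 0 if there is no such finite family
   (which does not happen in the two uses below). *)
Definition quotient_dim (U W : set K) : nat :=
  xget 0%N [set n | exists2 b : 'I_n -> K, (forall i, U (b i)) &
    forall u, U u -> exists! a : {ffun 'I_n -> k},
      W (u - \sum_(i < n) constant K (a i) * b i)].

Definition place_ring (P : place K) : set K := [set f | f = 0 \/ 0 <= P f].
Definition place_ideal (P : place K) : set K := [set f | f = 0 \/ 0 < P f].

Definition place_degree (P : place K) : nat :=
  quotient_dim (place_ring P) (place_ideal P).

Definition is_divisor (D : place K -> int) : Prop :=
  finite_set [set P | D P != 0].

Definition divisor_degree (D : place K -> int) : int :=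
  \sum_(P \in [set: place K]) D P *+ place_degree P.

Definition riemann_roch_space (D : place K -> int) : set K :=
  [set f | f = 0 \/ forall P : place K, - D P <= P f].

Definition ell (D : place K -> int) : nat :=
  quotient_dim (riemann_roch_space D) [set 0].

(* g = max { deg D - l(D) + 1 : D a divisor }. *)
Definition is_genus (g : nat) : Prop :=
  (forall D, is_divisor D -> divisor_degree D - (ell D)%:Z + 1 <= g%:Z) /\
  (exists2 D, is_divisor D & divisor_degree D - (ell D)%:Z + 1 = g%:Z).

End FunctionField.

(* A curve over the finite field k with function field K and N k-rational
   points is maximal over k. *)
Definition is_maximal (k : finFieldType) (K : fieldExtType (ratfun k))
    (N : nat) : Prop :=
  exists2 g : nat, is_genus K g &
    N%:R = #|k|%:R + 1 + 2%:R * g%:R * sqrtC #|k|%:R :> algC.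

(* K is the function field k(x, y) of the curve y^q - y = x S(x). *)
Definition is_curve_function_field (q : nat) (k : fieldType) (S : {poly k})
    (K : fieldExtType (ratfun k)) (y : K) : Prop :=
  <<1; y>>%VS = fullv /\ y ^+ q - y = in_funfield K ('X * S).

(* The affine solutions over k, and the single (rational) point at infinity. *)
Definition num_curve_points (q : nat) (k : finFieldType) (S : {poly k}) : nat :=
  (#|[pred P : k * k | P.2 ^+ q - P.2 == P.1 * S.[P.1]]|).+1.

(* Main.v *)
(* Genus.  Put F = x S(x) and d = deg F = q d1 + 1.  There is exactly one place
   at infinity, of degree 1, where x and y have poles of order q and d.  The
   elements of K regular at all other places are those of k[x, y], so that the space
   L(q N oo) has the basis x^i y^j with j < q and q i + d j <= q N, and for large
   N its dimension is q N + 1 - g with g = d1 q (q - 1) / 2.  Every divisor D is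
   bounded by some (f)_0 + q N oo with f in k[x], whose space is f^-1 times
   L(q (N + deg f) oo); since l(D') <= l(D) + deg (D' - D) for D <= D', the
   value deg D - l(D) + 1 never exceeds g.

   Points.  Let n = 2m and Q(x) = Tr (x S(x)), a quadratic form over F_q.  By
   Hilbert 90 the affine points number q times the zeros of Q, so maximality
   means that Q has q^(n-1) + (q - 1) q^(n-2) zeros.  The radical of Q has at
   most q^(n-2) elements, since it is the zero set of a q-polynomial.  If the
   number of zeros is the maximal one, then Cauchy-Schwarz for the sizes of the level sets of Q
   shows that the radical has exactly q^(n-2) elements, and then Q vanishes on
   an F_q-hyperplane, which contains the image of x^q + c x for some c <> 0.
   Conversely, if Q vanishes on the image of x^q + c x, then this image is a
   hyperplane not contained in the radical, and counting along a complementary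
   line gives the number of zeros.  Expanding Q(x^q + c x) as a trace of
   sum nu_j w^(1 + q^j), w = x^q, turns its vanishing into the equations. *)

From HB Require Import structures.
From mathcomp Require Import all_boot all_order all_algebra all_field.
From mathcomp Require Import boolp classical_sets functions cardinality fsbigop.
From mathcomp Require Import zify ring.
Require Import Defs.

Set Implicit Arguments.
Unset Strict Implicit.
Unset Printing Implicit Defensive.

Import Order.TTheory GRing.Theory Num.Theory.

Local Open Scope ring_scope.

(** * Places and valuations *)

(** [is_genus] quantifies over all divisors, so every place of K has to be controlled; two devices
    stand in for a theory of extensions of valuations. At infinity, y^q and F have the same weight,
    so the weight of a lift to k[x][Y] depends on the lift. The leading form of the relation is Y^q
    - lead F = (Y - sigma)^q, with [sigma] a q-th root of the leading coefficient. A lift whose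
    leading form is nonzero at Y = sigma is therefore no multiple of the relation and shows the true
    weight; lifts of degree < q in Y qualify, their leading form being c Y^j because deg F is 1
    modulo q. This gives both the irreducibility of the relation and the valuation. At the finite
    places, the relation has derivative -1 in Y, so nothing ramifies over k(x). In elementary form:
    modulo an irreducible g in k[x], some power map r -> r^E is the identity of k[x, y]; then 1 -
    r^(E - 1) is idempotent modulo g, and g is a uniformizer at each place above it. In the counting
    half, the oddness of q enters as 2 != 0: Q is recovered from its polar form, and (x, z) -> (x -
    z, x + z) is a bijection. *)

Section Places.
Variables (k : fieldType) (K : fieldExtType (ratfun k)).

HB.instance Definition _ := GRing.RMorphism.copy (in_funfield K)
  (GRing.in_alg K \o @FracField.tofrac {poly k}).
HB.instance Definition _ := GRing.RMorphism.copy (constant K)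
  (in_funfield K \o polyC).

Lemma in_funfieldD (f g : {poly k}) : in_funfield K (f + g) = in_funfield K f + in_funfield K g.
Proof. exact: rmorphD. Qed.

Lemma in_funfieldM (f g : {poly k}) : in_funfield K (f * g) = in_funfield K f * in_funfield K g.
Proof. exact: rmorphM. Qed.

Lemma in_funfieldXn (f : {poly k}) n : in_funfield K (f ^+ n) = in_funfield K f ^+ n.
Proof. exact: rmorphXn. Qed.

Lemma in_funfield_eq0 (f : {poly k}) : (in_funfield K f == 0) = (f == 0).
Proof.
by rewrite -[in_funfield K f]/(GRing.in_alg K (FracField.tofrac f)) fmorph_eq0 tofrac_eq0.
Qed.

Lemma place_ext (P P' : place K) :
  (forall z, z != 0 -> P z = P' z) -> P = P'.
Proof.
move=> eqP; have {eqP} : valuation P = valuation P'.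
  apply: funext => z; have [->|] := eqVneq z 0; last exact: eqP.
  by rewrite !valuation0.
case: P => v ? ? ? ? ?; case: P' => v' ? ? ? ? ? /= eqv.
by subst v'; congr Place; apply: Prop_irrelevance.
Qed.

Implicit Types (P : place K) (z w : K) (n : int).

Lemma valuation1 P : P 1 = 0.
Proof.
have e : P (1 * 1) = P 1 + P 1 by apply: valuationM; apply: oner_neq0.
suff -> : P 1 = P (1 * 1) - P 1 by rewrite mulr1 subrr.
by rewrite e addrK.
Qed.

Lemma valuationX P z j : z != 0 -> P (z ^+ j) = P z *+ j.
Proof.
move=> z0; elim: j => [|j IH]; first by rewrite valuation1.
by rewrite exprS mulrS valuationM ?expf_neq0 // IH.
Qed.

Lemma valuationV P z : z != 0 -> P z^-1 = - P z.
Proof.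
move=> z0; have := valuationM P z0 (invr_neq0 z0).
by rewrite divff // valuation1; lia.
Qed.

Lemma valuation_div P z w : z != 0 -> w != 0 -> P (z / w) = P z - P w.
Proof. by move=> z0 w0; rewrite valuationM ?invr_neq0 // valuationV. Qed.

Lemma valuationN P z : P (- z) = P z.
Proof.
have [->|z0] := eqVneq z 0; first by rewrite oppr0.
have N1 : (-1 : K) != 0 by rewrite oppr_eq0 oner_neq0.
have e : P (-1) + P (-1) = 0 by rewrite -valuationM // mulrNN mulr1 valuation1.
rewrite -mulN1r valuationM //; suff -> : P (-1) = 0 by rewrite add0r.
by move: (P (-1)) e => a; lia.
Qed.

(* [P z >= n], with the convention [P 0 = +oo]. *)
Definition vge P n z := z = 0 \/ n <= P z.

Lemma vgeE P n z : z != 0 -> vge P n z -> n <= P z.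
Proof. by move=> /eqP z0 [|//] /z0. Qed.

Lemma vge0 P n : vge P n 0. Proof. by left. Qed.

Lemma vgeW P n n' z : n' <= n -> vge P n z -> vge P n' z.
Proof. by move=> le_n [->|le_z]; [left | right; apply: le_trans le_z]. Qed.

Lemma vge_refl P z : vge P (P z) z. Proof. by right. Qed.

Lemma vgeN P n z : vge P n z -> vge P n (- z).
Proof. by move=> [->|le_z]; [left; rewrite oppr0 | right; rewrite valuationN]. Qed.

Lemma vgeD P n z w : vge P n z -> vge P n w -> vge P n (z + w).
Proof.
move=> [->|le_z]; first by rewrite add0r.
move=> [->|le_w]; first by rewrite addr0; right.
have [->|z0] := eqVneq z 0; first by rewrite add0r; right.
have [->|w0] := eqVneq w 0; first by rewrite addr0; right.
have [->|zw0] := eqVneq (z + w) 0; first by left.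
by right; apply: le_trans (valuationD P z0 w0 zw0); rewrite le_min le_z.
Qed.

Lemma vgeB P n z w : vge P n z -> vge P n w -> vge P n (z - w).
Proof. by move=> vz vw; apply: vgeD => //; apply: vgeN. Qed.

Lemma vge_sum P n (I : Type) (r : seq I) (Q : pred I) (f : I -> K) :
  (forall i, Q i -> vge P n (f i)) -> vge P n (\sum_(i <- r | Q i) f i).
Proof.
by move=> vf; apply: big_ind => //; [apply: vge0 | move=> *; apply: vgeD].
Qed.

Lemma vgeM P n n' z w : vge P n z -> vge P n' w -> vge P (n + n') (z * w).
Proof.
move=> [->|le_z]; first by left; rewrite mul0r.
move=> [->|le_w]; first by left; rewrite mulr0.
have [->|z0] := eqVneq z 0; first by left; rewrite mul0r.
have [->|w0] := eqVneq w 0; first by left; rewrite mulr0.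
by right; rewrite valuationM // lerD.
Qed.

Lemma vge_const P c : vge P 0 (constant K c).
Proof.
have [->|c0] := eqVneq c 0; first by left; rewrite rmorph0.
by right; rewrite valuation_constant.
Qed.

Lemma vgeZ P n c z : vge P n z -> vge P n (constant K c * z).
Proof. by move=> vz; rewrite -[n]add0r; apply: vgeM => //; apply: vge_const. Qed.

Lemma vgeX P z j : vge P 0 z -> vge P 0 (z ^+ j).
Proof.
move=> vz; elim: j => [|j IH]; first by right; rewrite valuation1.
by rewrite exprS -[0]addr0; apply: vgeM.
Qed.

Lemma vge_mulIf P n z w : w != 0 -> vge P n (z * w) -> vge P (n - P w) z.
Proof.
move=> w0; have [->|z0] := eqVneq z 0; first by left.
by move=> /(vgeE (mulf_neq0 z0 w0)); rewrite valuationM // => ?; right; lia.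
Qed.

(** The strict ultrametric inequality: a larger value of z + w would pass to z = (z + w) - w. It
    lets a leading term decide a valuation. *)
Lemma valuationD_lt P z w :
  z != 0 -> vge P (P z + 1) w -> z + w != 0 /\ P (z + w) = P z.
Proof.
move=> z0 vw; have zw0 : z + w != 0.
  apply/eqP => /eqP; rewrite addr_eq0 => /eqP zE.
  have w0 : w != 0 by rewrite -oppr_eq0 -zE.
  by have := vgeE w0 vw; rewrite zE valuationN; lia.
split=> //; apply/eqP; rewrite eq_le; apply/andP; split; last first.
  apply: vgeE zw0 _; apply: vgeD; first exact: vge_refl.
  by apply: vgeW vw; lia.
rewrite leNgt; apply/negP => lt_zw.
have : vge P (P z + 1) (z + w - w).
  by apply: vgeB vw; right; lia.
by rewrite addrK => /(vgeE z0); lia.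
Qed.

End Places.

(** * Dimensions of quotients *)

Section Dimension.
Variables (k : finFieldType) (K : fieldExtType (ratfun k)).
Implicit Types (U V W : set K) (u z : K) (n : nat).

Definition lincomb n (b : 'I_n -> K) (a : {ffun 'I_n -> k}) : K :=
  \sum_(i < n) constant K (a i) * b i.

(** The predicate under [xget] in [quotient_dim]; existence and uniqueness of n are proved for it,
    and [quotient_dimE] transfers them. *)
Definition has_quotient_dim U W n : Prop :=
  exists2 b : 'I_n -> K, (forall i, U (b i)) &
    forall u, U u -> exists! a : {ffun 'I_n -> k}, W (u - lincomb b a).

Definition subspace U : Prop :=
  [/\ U 0, forall z w, U z -> U w -> U (z + w) &
      forall c z, U z -> U (constant K c * z)].

Lemma subspaceN U z : subspace U -> U z -> U (- z).
Proof. by move=> [_ _ UZ] /(UZ (-1)); rewrite rmorphN1 mulN1r. Qed.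

Lemma subspaceB U z w : subspace U -> U z -> U w -> U (z - w).
Proof. by move=> sU Uz Uw; case: (sU) => _ UD _; apply: UD => //; apply: subspaceN. Qed.

Lemma subspace_lincomb U n (b : 'I_n -> K) a :
  subspace U -> (forall i, U (b i)) -> U (lincomb b a).
Proof.
by move=> [U0 UD UZ] Ub; apply: big_ind => // i _; apply: UZ.
Qed.

Lemma lincombB n (b : 'I_n -> K) a a' :
  lincomb b (a - a') = lincomb b a - lincomb b a'.
Proof.
rewrite /lincomb -sumrB; apply: eq_bigr => i _.
by rewrite !ffunE rmorphB mulrBl.
Qed.

Lemma lincomb0 n (b : 'I_n -> K) : lincomb b 0 = 0.
Proof. by rewrite -(subrr 0) lincombB subrr. Qed.

Definition independent W n (b : 'I_n -> K) : Prop :=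
  forall a, W (lincomb b a) -> a = 0.

Definition spans U W n (b : 'I_n -> K) : Prop :=
  forall u, U u -> exists a, W (u - lincomb b a).

Lemma has_quotient_dimI U W n (b : 'I_n -> K) : subspace W ->
  (forall i, U (b i)) -> spans U W b -> independent W b -> has_quotient_dim U W n.
Proof.
move=> sW Ub sb ib; exists b => // u /sb [a Wa]; exists a; split=> // a' Wa'.
apply/eqP; rewrite -subr_eq0; apply/eqP/ib; rewrite lincombB.
by have := subspaceB sW Wa' Wa; rewrite opprB addrC addrA subrK.
Qed.

Lemma has_quotient_dimP U W n : subspace U -> subspace W ->
  has_quotient_dim U W n <->
  exists b : 'I_n -> K, [/\ forall i, U (b i), spans U W b & independent W b].
Proof.
move=> sU sW; split=> [[b Ub uniqb]|[b []]]; last exact: has_quotient_dimI.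
exists b; split=> // [u /uniqb [a [Wa _]]|a Wa]; first by exists a.
have [a0 [_ uniqa]] := uniqb _ (subspace_lincomb a sU Ub).
rewrite -(uniqa 0); first by apply/esym/uniqa; rewrite subrr; case: sW.
by rewrite lincomb0 subr0.
Qed.

(** Counting replaces linear algebra, as k is finite: rewriting combinations of b modulo W as
    combinations of c is an injection from k^n into k^l. *)
Lemma independent_spans_leq U W n l (b : 'I_n -> K) (c : 'I_l -> K) :
  subspace U -> subspace W -> (forall i, U (b i)) ->
  independent W b -> spans U W c -> (n <= l)%N.
Proof.
move=> sU sW Ub ib sc.
have /choice [f Wf] a : exists a', W (lincomb b a - lincomb c a').
  by apply: sc; apply: subspace_lincomb.
have injf : injective f.
  move=> a a' eqf; apply/eqP; rewrite -subr_eq0; apply/eqP/ib; rewrite lincombB.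
  have := subspaceB sW (Wf a) (Wf a'); rewrite eqf.
  by rewrite opprB addrA subrK.
have := leq_card f injf; rewrite !card_ffun !card_ord leq_exp2l //.
exact: card_finRing_gt1.
Qed.

Lemma has_quotient_dim_uniq U W n l : subspace U -> subspace W ->
  has_quotient_dim U W n -> has_quotient_dim U W l -> n = l.
Proof.
move=> sU sW /(has_quotient_dimP _ sU sW)[b [Ub sb ib]].
move=> /(has_quotient_dimP _ sU sW)[c [Uc sc ic]].
apply/eqP; rewrite eqn_leq.
by rewrite (independent_spans_leq sU sW Ub ib sc) (independent_spans_leq sU sW Uc ic sb).
Qed.

Lemma quotient_dimE U W n : subspace U -> subspace W ->
  has_quotient_dim U W n -> quotient_dim U W = n.
Proof.
move=> sU sW hn; apply: xget_unique => [//|l hl].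
exact: has_quotient_dim_uniq hl hn.
Qed.

Lemma lincombS n (b : 'I_n.+1 -> K) a :
  lincomb b a = constant K (a ord0) * b ord0 +
    lincomb (fun i => b (lift ord0 i)) [ffun i => a (lift ord0 i)].
Proof.
by rewrite /lincomb big_ord_recl; congr (_ + _); apply: eq_bigr => i _; rewrite ffunE.
Qed.

(** A largest independent family spans, since a missed vector u would extend it; the bound B ensures
    that a largest one exists. *)
Lemma has_quotient_dim_bounded U W B : subspace U -> subspace W ->
  (forall n (b : 'I_n -> K), (forall i, U (b i)) -> independent W b -> (n <= B)%N) ->
  exists2 n, (n <= B)%N & has_quotient_dim U W n.
Proof.
move=> sU sW leB.
pose ex n := `[< exists2 b : 'I_n -> K, forall i, U (b i) & independent W b >].
have ex0 : exists n, ex n.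
  exists 0%N; apply/asboolP; exists (fun=> 0) => [[]//|a _].
  by apply/ffunP => -[].
have exB n : ex n -> (n <= B)%N by move=> /asboolP [b]; apply: leB.
case: (ex_maxnP ex0 exB) => n /asboolP [b Ub ib] maxn.
exists n; first exact: leB ib.
apply: (has_quotient_dimI (b := b)) => // u Uu; apply: contrapT => nspan.
pose b' (i : 'I_n.+1) := if unlift ord0 i is Some j then b j else u.
suff /maxn : ex n.+1 by rewrite ltnn.
apply/asboolP; exists b'; first by move=> i; rewrite /b'; case: unliftP.
move=> a; rewrite lincombS {1}/b' unlift_none.
set a' := [ffun i => _].
have -> : (fun i => b' (lift ord0 i)) = b by apply: funext => i; rewrite /b' liftK.
move=> Wa.
(* A zero coefficient of u leaves a relation among the b i; a nonzero one expresses u by them,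
   against the choice of u. *)
have [a0|a0] := eqVneq (a ord0) 0.
  move: Wa; rewrite a0 rmorph0 mul0r add0r => /ib a'0.
  apply/ffunP => i; rewrite ffunE; case: (unliftP ord0 i) => [j ->|-> //].
  by have /ffunP/(_ j) := a'0; rewrite !ffunE.
case: nspan; exists [ffun i => - (a ord0)^-1 * a' i].
case: (sW) => _ _ /(_ (a ord0)^-1 _ Wa).
rewrite mulrDr mulrA -rmorphM mulVf // rmorph1 mul1r; congr (W (_ + _)).
rewrite /lincomb mulr_sumr -sumrN; apply: eq_bigr => i _.
by rewrite [in RHS]ffunE rmorphM rmorphN !mulNr opprK mulrA.
Qed.

Lemma has_quotient_dim_trans U V W n l : subspace U -> subspace V -> subspace W ->
  (forall z, W z -> V z) -> (forall z, V z -> U z) ->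
  has_quotient_dim V W n -> has_quotient_dim U V l -> has_quotient_dim U W (n + l).
Proof.
move=> sU sV sW WV VU /(has_quotient_dimP _ sV sW)[b [Vb sb ib]].
move=> /(has_quotient_dimP _ sU sV)[c [Uc sc ic]].
pose d (i : 'I_(n + l)) := match fintype.split i with inl j => b j | inr j => c j end.
have dE a : lincomb d a = lincomb b [ffun i => a (lshift l i)] +
    lincomb c [ffun i => a (rshift n i)].
  rewrite /lincomb big_split_ord; congr (_ + _); apply: eq_bigr => i _; rewrite ffunE /d.
    by rewrite (fintype.unsplitK (inl i)).
  by rewrite (fintype.unsplitK (inr i)).
apply: (has_quotient_dimI (b := d)) => //.
- by move=> i; rewrite /d; case: (fintype.split i) => j; [apply/VU/Vb | apply: Uc].
- move=> u /sc [a2 Va2]; have [a1 Wa1] := sb _ Va2.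
  exists [ffun i => match fintype.split i with inl j => a1 j | inr j => a2 j end].
  rewrite dE opprD addrA addrAC.
  have -> : [ffun i => [ffun i0 => match fintype.split i0 with
      inl j => a1 j | inr j => a2 j end] (lshift l i)] = a1.
    by apply/ffunP => i; rewrite !ffunE (fintype.unsplitK (inl i)).
  have -> // : [ffun i => [ffun i0 => match fintype.split i0 with
      inl j => a1 j | inr j => a2 j end] (rshift n i)] = a2.
  by apply/ffunP => i; rewrite !ffunE (fintype.unsplitK (inr i)).
- move=> a; rewrite dE => Wa.
  have V1 : V (lincomb b [ffun i => a (lshift l i)]) by apply: subspace_lincomb.
  have /ic a2 : V (lincomb c [ffun i => a (rshift n i)]).
    by have := subspaceB sV (WV _ Wa) V1; rewrite addrC addKr.
  move: Wa; rewrite a2 lincomb0 addr0 => /ib a1.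
  apply/ffunP => i; rewrite ffunE -(fintype.splitK i); case: (fintype.split i) => j.
    by have /ffunP/(_ j) := a1; rewrite !ffunE.
  by have /ffunP/(_ j) := a2; rewrite !ffunE.
Qed.

(** Independent families in either quotient have at most n members, so both dimensions exist; their
    sum is n by transitivity and uniqueness. *)
Lemma has_quotient_dim_split U V W n : subspace U -> subspace V -> subspace W ->
  (forall z, W z -> V z) -> (forall z, V z -> U z) ->
  has_quotient_dim U W n ->
  exists n1 n2, [/\ has_quotient_dim V W n1, has_quotient_dim U V n2 & n = (n1 + n2)%N].
Proof.
move=> sU sV sW WV VU hn.
have [b [Ub sb ib]] := (has_quotient_dimP _ sU sW).1 hn.
have [n1 _ h1] : exists2 n1, (n1 <= n)%N & has_quotient_dim V W n1.
  apply: has_quotient_dim_bounded => // l c Vc ic.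
  by apply: (independent_spans_leq sU sW _ ic sb) => i; apply/VU/Vc.
have [n2 _ h2] : exists2 n2, (n2 <= n)%N & has_quotient_dim U V n2.
  apply: has_quotient_dim_bounded => // l c Uc ic.
  apply: (independent_spans_leq sU sV Uc ic (c := b)) => u /sb [a Wa].
  by exists a; apply: WV.
exists n1, n2; split=> //; apply: has_quotient_dim_uniq hn _ => //.
exact: has_quotient_dim_trans h1 h2.
Qed.

Lemma has_quotient_dim_refl U : subspace U -> has_quotient_dim U U 0.
Proof.
move=> sU; apply: (has_quotient_dimI (b := fun=> 0)) => //; first by case.
  move=> u Uu; exists 0; rewrite lincomb0 subr0 //.
by move=> a _; apply/ffunP => -[].
Qed.

Lemma has_quotient_dim_scale U U' W W' z n : z != 0 ->
  (forall u, U' u <-> U (u / z)) -> (forall u, W' u <-> W (u / z)) ->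
  has_quotient_dim U W n -> has_quotient_dim U' W' n.
Proof.
move=> z0 UE WE [b Ub uniqb]; exists (fun i => z * b i).
  by move=> i; rewrite UE mulrC mulKf.
move=> u /UE /uniqb [a [Wa uniqa]].
have lz c : (u - lincomb (fun i => z * b i) c) / z = u / z - lincomb b c.
  rewrite mulrBl; congr (_ - _); rewrite /lincomb mulr_suml; apply: eq_bigr => i _.
  by rewrite mulrCA [z * _]mulrC mulfK.
exists a; split; first by rewrite WE lz.
by move=> a' /WE; rewrite lz => /uniqa.
Qed.

Lemma has_quotient_dim_ext U U' W W' n :
  (forall u, U' u <-> U u) -> (forall u, W' u <-> W u) ->
  has_quotient_dim U W n -> has_quotient_dim U' W' n.
Proof.
move=> UE WE; apply: (has_quotient_dim_scale (z := 1)); first exact: oner_neq0.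
  by move=> u; rewrite divr1.
by move=> u; rewrite divr1.
Qed.

End Dimension.

(** * Fractions and common denominators *)

Section Fractions.

Local Open Scope quotient_scope.

Lemma fractionE (R : idomainType) (z : {fraction R}) :
  exists n d : R, d != 0 /\ z = tofrac n / tofrac d.
Proof.
exists (frac (repr z)).1, (frac (repr z)).2.
have d0 := denom_ratioP (repr z); split=> //.
apply: (canRL (mulfK _)); first by rewrite tofrac_eq0.
rewrite -{1}[z]reprK; unlock tofrac.
rewrite -[LHS](@FracField.pi_mul R (repr z) (Ratio _ 1)).
apply/eqP; rewrite eqmodE /= /FracField.equivf /FracField.mulf /=.
rewrite !numden_Ratio ?oner_neq0 ?mulf_neq0 // ?mulr1 // ?oner_neq0 //; do ?exact: oner_neq0.
by rewrite mulrC.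
Qed.

Lemma poly_fractionE (R : idomainType) (f : {poly {fraction R}}) :
  exists (d : R) (r : {poly R}), d != 0 /\ tofrac d *: f = map_poly (@tofrac R) r.
Proof.
elim/poly_ind: f => [|f z [d [r [d0 eqr]]]].
  by exists 1, 0; rewrite oner_neq0 rmorph0 scaler0.
have [n [d' [d'0 ->]]] := fractionE z.
exists (d * d'), (d' *: r * 'X + (d * n)%:P); rewrite mulf_neq0 //; split=> //.
rewrite [RHS]rmorphD [in RHS]rmorphM /= map_polyX map_polyC /= map_polyZ /= -eqr.
rewrite scalerDr scalerAl [in RHS]scalerA scale_polyC !tofracM [tofrac d' * _]mulrC.
by congr (_ + _%:P); rewrite -mulrA [tofrac d' * _]mulrC divfK // tofrac_eq0.
Qed.

End Fractions.

(** * The ring k[x, y] and its weights *)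

Section Weight.
Variables (k : finFieldType) (q d1 : nat) (F : {poly k}).
Hypothesis q_gt1 : (1 < q)%N.
Hypothesis sizeF : size F = (q * d1).+2.
Implicit Types (r h : {poly {poly k}}) (a : {poly k}).

Local Notation d := (q * d1).+1.

Definition as_rel : {poly {poly k}} := 'X^q - 'X - F%:P.

Lemma size_as_rel : size as_rel = q.+1.
Proof.
have e : size ('X^q - 'X : {poly {poly k}}) = q.+1.
  by rewrite size_polyDl size_polyXn // size_polyN size_polyX.
rewrite /as_rel size_polyDl ?e // size_polyN.
by apply: leq_ltn_trans (size_polyC_leq1 _) _; rewrite ltnS ltnW.
Qed.

Lemma as_rel_monic : as_rel \is monic.
Proof.
rewrite monicE lead_coefE size_as_rel /as_rel !coefB coefXn eqxx coefX coefC.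
by case: q q_gt1 => [|[|q']] //= _; rewrite !subr0.
Qed.

(* Weights are degrees in T: x has weight q, with x = T^q, and y has weight
   d = deg F, with y = Y T^d. *)
Definition to_weight a : {poly {poly k}} := map_poly polyC a \Po 'X^q.

HB.instance Definition _ := GRing.RMorphism.copy to_weight
  (comp_poly 'X^q \o map_poly polyC).

Definition weighted r : {poly {poly k}} := (map_poly to_weight r).['X%:P * 'X^d].

HB.instance Definition _ := GRing.RMorphism.copy weighted
  (horner_eval ('X%:P * 'X^d) \o map_poly to_weight).

Lemma coef_to_weight a n :
  (to_weight a)`_n = if (q %| n)%N then (a`_(n %/ q))%:P else 0.
Proof. by rewrite /to_weight coef_comp_poly_Xn ?coef_map // ltnW. Qed.

Lemma weight_subn n :
  (n - d * (n %% q))%N = ((n %/ q - d1 * (n %% q)) * q)%N.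
Proof.
rewrite {1}(divn_eq n q) mulSn [X in (X - _)%N]addnC subnDl mulnBl.
by rewrite -mulnA [(q * _)%N]mulnC.
Qed.

(** Since d is 1 modulo q, a monomial x^i y^j with j < q has weight congruent to j, so n fixes j = n
    %% q and then i: each power of T receives a single monomial. *)
Lemma coef_weighted r n : (size r <= q)%N -> (weighted r)`_n =
  if (d * (n %% q) <= n)%N
  then ((r`_(n %% q))`_((n - d * (n %% q)) %/ q))%:P * 'X^(n %% q) else 0.
Proof.
move=> size_r.
have -> : weighted r = \sum_(j < q) (to_weight r`_j) * ('X^j)%:P * 'X^(d * j).
  rewrite /weighted (horner_coef_wide _ (n := q)); last first.
    exact: leq_trans (size_poly _ _) _.
  apply: eq_bigr => j _; rewrite coef_map_id0 ?rmorph0 // exprMn -exprM -mulrA.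
  by rewrite rmorphXn.
rewrite coef_sum.
have n_lt : (n %% q < q)%N by rewrite ltn_mod ltnW.
rewrite (bigD1 (Ordinal n_lt)) //= big1 ?addr0 => [|j /negP neq_j].
  rewrite coefMXn ltnNge; case: leqP => //= le_n; rewrite coefMC coef_to_weight.
  suff -> : (q %| n - d * (n %% q))%N by [].
  by rewrite weight_subn dvdn_mull.
rewrite coefMXn; case: ltnP => // le_n; rewrite coefMC coef_to_weight.
case: ifP => [dv|_]; last by rewrite mul0r.
case: neq_j; apply/eqP/val_inj => /=.
have -> : n = (n - d * j + d * j)%N by rewrite subnK.
by case/dvdnP: dv => c ->; rewrite mulSn addnCA -mulnA [(q * _)%N]mulnC -mulnDl addnC
  modnMDl modn_small.
Qed.

Lemma coef_weighted_mon r i j : (size r <= q)%N -> (j < q)%N ->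
  (weighted r)`_(q * i + d * j) = ((r`_j)`_i)%:P * 'X^j.
Proof.
move=> size_r lt_j; rewrite coef_weighted //.
have -> : ((q * i + d * j) %% q = j)%N.
  by rewrite mulSn addnCA -mulnA -mulnDr [(q * _)%N]mulnC addnC modnMDl modn_small.
by rewrite leq_addl addnK mulKn // ltnW.
Qed.

Variable sigma : k.
Hypothesis sigmaE : sigma ^+ q = lead_coef F.

(* Any lift to k[x][Y] of an element of k[x, y] may be used to compute its
   weight, provided that its leading form does not vanish at [sigma]. *)
Definition good r := (lead_coef (weighted r)).[sigma] != 0.

Definition weight r := (size (weighted r)).-1.

Lemma F_neq0 : F != 0. Proof. by rewrite -size_poly_eq0 sizeF. Qed.

Lemma sigma_neq0 : sigma != 0.
Proof.
apply/eqP => s0; have := F_neq0; rewrite -lead_coef_eq0 -sigmaE s0.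
by rewrite expr0n gtn_eqF ?(ltnW q_gt1) // eqxx.
Qed.

Lemma good_neq0 r : good r -> weighted r != 0.
Proof. by rewrite /good; apply: contraNneq => ->; rewrite lead_coef0 horner0. Qed.

Lemma goodM r h : good (r * h) = good r && good h.
Proof. by rewrite /good rmorphM /= lead_coefM hornerM mulf_eq0 negb_or. Qed.

Lemma weightM r h : good r -> good h -> weight (r * h) = (weight r + weight h)%N.
Proof.
move=> /good_neq0 r0 /good_neq0 h0; rewrite /weight rmorphM /= size_mul //.
move: r0 h0; rewrite -!size_poly_gt0.
by case: (size _) => // a _; case: (size _) => // b _; rewrite addSn addnS.
Qed.

Lemma weighted_eq0 r : (size r <= q)%N -> (weighted r == 0) = (r == 0).
Proof.
move=> size_r; apply/eqP/eqP => [w0|->]; last by rewrite rmorph0.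
apply/polyP => j; rewrite coef0; case: (ltnP j q) => lt_j; last first.
  by rewrite nth_default // (leq_trans size_r).
apply/polyP => i; rewrite coef0; have := coef_weighted_mon i size_r lt_j.
rewrite w0 coef0 => /esym/eqP; rewrite mulf_eq0 polyC_eq0 expf_eq0 polyX_eq0 andbF orbF.
by move/eqP.
Qed.

Lemma lead_coef_weighted r : (size r <= q)%N ->
  exists c, lead_coef (weighted r) = c%:P * 'X^(weight r %% q).
Proof.
move=> size_r; rewrite lead_coefE coef_weighted //.
by case: ifP => _; [eexists | exists 0; rewrite mul0r].
Qed.

(** The leading form is a monomial c Y^j, and [sigma] is nonzero. *)
Lemma good_normal r : (size r <= q)%N -> r != 0 -> good r.
Proof.
move=> size_r; rewrite -weighted_eq0 // -lead_coef_eq0 /good.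
have [c ->] := lead_coef_weighted size_r.
rewrite mulf_eq0 polyC_eq0 expf_eq0 polyX_eq0 andbF orbF => c0.
by rewrite !hornerE mulf_neq0 ?expf_neq0 ?sigma_neq0.
Qed.

Lemma weight_eq i j i' j' : (j < q)%N -> (j' < q)%N ->
  (q * i + d * j = q * i' + d * j')%N -> i = i' /\ j = j'.
Proof.
move=> lt_j lt_j' eq_w.
have mE i0 j0 : (j0 < q)%N -> ((q * i0 + d * j0) %% q = j0)%N.
  move=> lt_j0; rewrite mulSn addnCA -mulnA -mulnDr [(q * _)%N]mulnC addnC modnMDl.
  by rewrite modn_small.
have eq_j : j = j' by rewrite -(mE i j lt_j) eq_w mE.
split=> //; move/eqP: eq_w; rewrite eq_j eqn_add2r eqn_pmul2l ?(ltnW q_gt1) //.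
by move/eqP.
Qed.

Lemma weight_leqP r n : (size r <= q)%N ->
  (size (weighted r) <= n)%N <->
  (forall i j, (j < q)%N -> (n <= q * i + d * j)%N -> (r`_j)`_i = 0).
Proof.
move=> size_r; split=> [size_w i j lt_j lt_n|r0].
  have := coef_weighted_mon i size_r lt_j; rewrite nth_default; last exact: leq_trans lt_n.
  move=> /esym/eqP; rewrite mulf_eq0 polyC_eq0 expf_eq0 polyX_eq0 andbF orbF.
  by move/eqP.
apply/leq_sizeP => l lt_l; rewrite coef_weighted //.
case: leqP => // le_l; rewrite r0 ?mul0r ?ltn_mod ?(ltnW q_gt1) //.
by rewrite mulnC divnK ?subnK // weight_subn dvdn_mull.
Qed.

Lemma lead_monomial r : (size r <= q)%N -> r != 0 ->
  exists i j, [/\ (j < q)%N, (r`_j)`_i != 0 & weight r = (q * i + d * j)%N].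
Proof.
move=> size_r; rewrite -weighted_eq0 // -lead_coef_eq0 lead_coefE -/(weight r).
rewrite coef_weighted //; case: leqP => // le_n; last by rewrite eqxx.
rewrite mulf_eq0 polyC_eq0 negb_or => /andP[c0 _].
exists ((weight r - d * (weight r %% q)) %/ q)%N, (weight r %% q)%N; split=> //.
  by rewrite ltn_mod ltnW.
by rewrite mulnC divnK ?subnK // weight_subn dvdn_mull.
Qed.

Lemma weightC a : weight a%:P = (q * (size a).-1)%N.
Proof.
rewrite /weight /weighted map_polyC hornerC /= /to_weight size_comp_poly.
by rewrite size_map_polyC size_polyXn /= mulnC.
Qed.

Lemma weightX : weight 'X = d.
Proof.
rewrite /weight /weighted map_polyX hornerX mul_polyC size_scale ?polyX_eq0 //.
by rewrite size_polyXn.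
Qed.

(** y^q and F both have weight q d, while y has only d, so just these two terms reach the leading
    form. *)
Lemma lead_coef_weighted_as_rel : lead_coef (weighted as_rel) = 'X^q - (lead_coef F)%:P.
Proof.
have q0 : (0 < q)%N by apply: ltnW.
have e1 : weighted as_rel = ('X^q)%:P * 'X^(d * q) - 'X%:P * 'X^d - to_weight F.
  rewrite /weighted /as_rel !rmorphB /= map_polyXn map_polyX map_polyC /=.
  by rewrite !hornerE exprMn -exprM polyC_exp.
have c1 : (weighted as_rel)`_(d * q) = 'X^q - (lead_coef F)%:P.
  rewrite e1 !coefB coef_to_weight dvdn_mull // mulnK // lead_coefE sizeF /=.
  rewrite !coefCM !coefXn eqxx mulr1 (_ : (d * q == d)%N = false) ?mulr0 ?subr0 //.
  by apply/eqP; nia.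
have s1 : (size (weighted as_rel) <= (d * q).+1)%N.
  apply/leq_sizeP => j lt_j; rewrite e1 !coefB !coefCM !coefXn coef_to_weight.
  rewrite gtn_eqF // [(j == d)]gtn_eqF ?mulr0 ?subr0 ?sub0r; last by nia.
  case: ifP => [/dvdnP[c eq_j]|_]; last by rewrite oppr0.
  rewrite eq_j mulnK // nth_default ?polyC0 ?oppr0 // sizeF.
  by move: lt_j; rewrite eq_j ltn_pmul2r.
have c0 : (weighted as_rel)`_(d * q) != 0.
  rewrite c1 -size_poly_gt0 size_polyDl ?size_polyXn // size_polyN.
  exact: leq_ltn_trans (size_polyC_leq1 _) _.
rewrite lead_coefE -c1; congr _`_ _; apply/eqP; rewrite eqn_leq.
have : (d * q < size (weighted as_rel))%N.
  by rewrite ltnNge; apply: contra c0 => /leq_sizeP ->.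
by case: (size _) s1 => //= n; rewrite !ltnS => -> ->.
Qed.

Lemma as_rel_ngood r : as_rel %| r -> ~~ good r.
Proof.
rewrite Pdiv.IdomainMonic.dvdp_eq ?as_rel_monic // => /eqP ->.
rewrite goodM negb_and [X in _ || X]negbK lead_coef_weighted_as_rel.
by rewrite !hornerE sigmaE subrr eqxx orbT.
Qed.

(** If the weights differed, r - h would inherit the leading form of the heavier lift and be good,
    which a multiple of the relation is not. *)
Lemma weight_uniq r h : good r -> good h -> as_rel %| r - h -> weight r = weight h.
Proof.
wlog lt_wh : r h / (weight h < weight r)%N => [hwlog gr gh dv|gr gh dv].
  case: (ltngtP (weight h) (weight r)) => // lt_w; first exact: hwlog.
  by apply/esym/hwlog => //; rewrite -opprB dvdpNr.
suff : good (r - h) by have := as_rel_ngood dv => /negP.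
rewrite /good rmorphB /= lead_coefDl // size_polyN.
move: lt_wh (good_neq0 gr) (good_neq0 gh); rewrite /weight -!size_poly_gt0.
by case: (size _) => // n; case: (size _).
Qed.

End Weight.

Lemma map_poly_funfield (k : fieldType) (K : fieldExtType (ratfun k))
    (r : {poly {poly k}}) :
  map_poly (in_funfield K) r =
  map_poly (GRing.in_alg K) (map_poly (@tofrac {poly k}) r).
Proof.
apply/polyP => i; rewrite coef_map_id0 ?rmorph0 // /in_funfield.
rewrite [RHS]coef_map_id0; last exact: scale0r.
by congr (_ *: _); rewrite coef_map_id0 ?tofrac0.
Qed.

Lemma addr_subr_eq (i j i' j' : int) : i + j' = i' + j -> i - j = i' - j'.
Proof. lia. Qed.

Lemma min_intB (i j i' j' l : int) :
  Num.min (i + j') (i' + j) <= l -> Num.min (i - j) (i' - j') <= l - (j + j').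
Proof. lia. Qed.

(** * The subring k[x, y] of K *)

Section Evaluation.
Variables (k : finFieldType) (K : fieldExtType (ratfun k)) (y : K).

Definition ev (r : {poly {poly k}}) : K := (map_poly (in_funfield K) r).[y].

HB.instance Definition _ := GRing.RMorphism.copy ev
  (horner_eval y \o map_poly (in_funfield K)).

Lemma evD r h : ev (r + h) = ev r + ev h. Proof. exact: rmorphD. Qed.
Lemma evN r : ev (- r) = - ev r. Proof. exact: rmorphN. Qed.
Lemma evB r h : ev (r - h) = ev r - ev h. Proof. exact: rmorphB. Qed.
Lemma evM r h : ev (r * h) = ev r * ev h. Proof. exact: rmorphM. Qed.
Lemma evXn r n : ev (r ^+ n) = ev r ^+ n. Proof. exact: rmorphXn. Qed.
Lemma ev0 : ev 0 = 0. Proof. exact: rmorph0. Qed.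
Lemma ev1 : ev 1 = 1. Proof. exact: rmorph1. Qed.

Lemma evC a : ev a%:P = in_funfield K a.
Proof. by rewrite /ev map_polyC hornerC. Qed.

Lemma evX : ev 'X = y.
Proof. by rewrite /ev map_polyX hornerX. Qed.

Variables (q d1 : nat) (F : {poly k}) (sigma : k).
Hypothesis q_gt1 : (1 < q)%N.
Hypothesis sizeF : size F = (q * d1).+2.
Hypothesis sigmaE : sigma ^+ q = lead_coef F.
Hypothesis K_gen : <<1; y>>%VS = fullv.
Hypothesis y_eq : y ^+ q - y = in_funfield K F.
Implicit Types (r h : {poly {poly k}}) (a : {poly k}) (z : K).

Lemma ev_as_rel : ev (as_rel q F) = 0.
Proof. by rewrite /as_rel !rmorphB rmorphXn /= evX evC y_eq subrr. Qed.

Lemma ev_fraction z : exists r a, a != 0 /\ z = ev r / in_funfield K a.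
Proof.
have : z \in <<1; y>>%VS by rewrite K_gen memvf.
case/Fadjoin_polyP => f /polyOver1P[f' ->] ->.
have [a [r [a0 eqr]]] := poly_fractionE f'; exists r, a; split=> //.
apply: (canRL (mulfK _)); first by rewrite in_funfield_eq0.
have -> : ev r = (map_poly (GRing.in_alg K) (map_poly (@tofrac _) r)).[y].
  by rewrite /ev map_poly_funfield.
rewrite -eqr map_polyZ hornerZ mulrC; congr (_ * _).
Qed.

(* If [r] is a normal relation of minimal degree, then [as_rel] is, up to a
   factor in k[x], the product of two normal polynomials, and hence good. *)
Lemma ev_normal_eq0 r : (size r <= q)%N -> ev r = 0 -> r = 0.
Proof.
move=> size_r evr0; apply/eqP; apply: contrapT => /negP r0.
pose ex n := `[< exists r, [/\ size r = n, r != 0, (size r <= q)%N & ev r = 0] >].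
have exP : exists n, ex n by exists (size r); apply/asboolP; exists r.
case: (ex_minnP exP) => n /asboolP [{evr0 size_r r0}r [size_r r0 le_r evr0]] minn.
have := Pdiv.WeakIdomain.divp_eq (as_rel q F) r; set c := _ ^+ _ => eqr.
have modr0 : as_rel q F %% r = 0.
  apply/eqP; apply: contrapT => /negP m0.
  have lt_m := Pdiv.CommonIdomain.ltn_modpN0 (as_rel q F) r0.
  suff : (n <= size (as_rel q F %% r)%R)%N by rewrite leqNgt -size_r lt_m.
  apply: minn; apply/asboolP; exists (as_rel q F %% r); split=> //.
    by apply: leq_trans le_r; apply: ltnW.
  have -> : as_rel q F %% r = c *: as_rel q F - as_rel q F %/ r * r.
    by rewrite eqr addrC addKr.
  by rewrite -mul_polyC rmorphB !rmorphM /= ev_as_rel evr0 !mulr0 subrr.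
have c0 : c != 0 by rewrite expf_neq0 // lead_coef_eq0.
rewrite modr0 addr0 in eqr.
have size_as := size_as_rel F q_gt1.
have h0 : as_rel q F %/ r != 0.
  apply: contra_eqN eqr => /eqP ->; rewrite mul0r -mul_polyC mulf_eq0 polyC_eq0 negb_or c0.
  by rewrite -size_poly_eq0 size_as.
have r_gt1 : (1 < size r)%N.
  rewrite ltnNge; apply/negP => /size1_polyC r_const.
  move: evr0 r0; rewrite r_const evC => /eqP; rewrite in_funfield_eq0 polyC_eq0.
  by move=> ->.
have size_h : (size (as_rel q F %/ r)%R <= q)%N.
  have : size (c *: as_rel q F) = size (as_rel q F %/ r * r) by rewrite eqr.
  rewrite size_scale // size_as size_mul //.
  by move: r_gt1; move: (size r) (size (_ %/ _)) => i j; lia.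
have : ~~ good q d1 sigma (c *: as_rel q F).
  by apply: (as_rel_ngood q_gt1 sizeF sigmaE); rewrite -mul_polyC dvdp_mull.
by rewrite eqr goodM !(good_normal q_gt1 sizeF sigmaE).
Qed.

Lemma normalize r : exists r', [/\ (size r' <= q)%N, as_rel q F %| r - r' & ev r' = ev r].
Proof.
have mon := as_rel_monic F q_gt1.
have eqr := Pdiv.IdomainMonic.divp_eq mon r.
exists (r %% as_rel q F); split.
- by rewrite -ltnS -(size_as_rel F q_gt1) ltn_modpN0 // monic_neq0.
- by rewrite {1}eqr addrK dvdp_mull.
- by rewrite {2}eqr rmorphD rmorphM /= ev_as_rel mulr0 add0r.
Qed.

Lemma ev_eq0 r : (ev r == 0) = (as_rel q F %| r).
Proof.
apply/eqP/idP => [evr0|].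
  have [r' [size_r' dvr' evr']] := normalize r.
  by rewrite (ev_normal_eq0 size_r') ?subr0 // in dvr' *; rewrite evr'.
rewrite Pdiv.IdomainMonic.dvdp_eq ?as_rel_monic // => /eqP ->.
by rewrite rmorphM /= ev_as_rel mulr0.
Qed.

Lemma ev_eqP r h : ev r = ev h -> as_rel q F %| r - h.
Proof. by move=> e; rewrite -ev_eq0 rmorphB /= e subrr. Qed.

Lemma ev_good_neq0 r : good q d1 sigma r -> ev r != 0.
Proof.
by move=> gr; rewrite ev_eq0; apply: contraL gr => /(as_rel_ngood q_gt1 sizeF sigmaE).
Qed.

Lemma ev_exists_normal z : (exists r, z = ev r) ->
  exists2 r : {poly {poly k}}, (size r <= q)%N & z = ev r.
Proof. by move=> [r ->]; have [r' [size_r' _ <-]] := normalize r; exists r'. Qed.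

Lemma ev_exists_good r : ev r != 0 ->
  exists r', [/\ (size r' <= q)%N, good q d1 sigma r' & ev r = ev r'].
Proof.
move=> r0; have [r' [size_r' _ evr']] := normalize r; exists r'; split=> //.
apply: (good_normal q_gt1 sizeF sigmaE) => //.
by apply: contraNneq r0 => r'0; rewrite -evr' r'0 rmorph0.
Qed.

(** The inverse of [ev r] is a fraction whose denominator lies in k[x]; that denominator is a. So
    the zeros of an element of k[x, y] are controlled by those of a polynomial in x. *)
Lemma ev_multiple_in_x r : ev r != 0 -> exists r' a, a != 0 /\ ev r * ev r' = in_funfield K a.
Proof.
move=> r0; have [r' [a [a0 eq_inv]]] := ev_fraction (ev r)^-1.
exists r', a; split=> //; have ia0 : in_funfield K a != 0 by rewrite in_funfield_eq0.
by rewrite -[ev r'](divfK ia0) -eq_inv mulrA divff // mul1r.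
Qed.

(** * Places of K from valuations on k[x, y] *)

Section PlaceOfRing.
(** A relation between lifts and values, because in the applications the value of a lift comes from
    an existence statement; [v_uniq] makes it depend only on the image in K. *)
Variable v : {poly {poly k}} -> int -> Prop.
Hypothesis v_total : forall r, ev r != 0 -> exists n, v r n.
Hypothesis v_uniq : forall r h n l, ev r = ev h -> ev r != 0 -> v r n -> v h l -> n = l.
Hypothesis vM : forall r h n l, ev r != 0 -> ev h != 0 ->
  v r n -> v h l -> v (r * h) (n + l).
Hypothesis vD : forall r h n l, ev r != 0 -> ev h != 0 -> ev (r + h) != 0 ->
  v r n -> v h l -> exists2 j, v (r + h) j & Num.min n l <= j.
Hypothesis v_const : forall c : k, c != 0 -> v c%:P%:P 0.
Hypothesis v_surj : exists r h n l,
  [/\ ev r != 0, ev h != 0, v r n, v h l & n - l = 1].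

Let val_of z n := exists r h i j,
  [/\ ev r != 0 /\ ev h != 0, z = ev r / ev h, v r i, v h j & n = i - j].

Let val_of_total z : z != 0 -> exists n, val_of z n.
Proof.
move=> z0; have [r [a [a0 eqz]]] := ev_fraction z.
have r0 : ev r != 0 by apply: contraNneq z0 => r0; rewrite eqz r0 mul0r.
have a0' : ev a%:P != 0 by rewrite evC in_funfield_eq0.
have [i vi] := v_total r0; have [j vj] := v_total a0'.
by exists (i - j), r, a%:P, i, j; split=> //; rewrite evC.
Qed.

Let val_of_uniq z n l : val_of z n -> val_of z l -> n = l.
Proof.
move=> [r [h [i [j [[r0 h0] eqz vr vh ->]]]]] [r' [h' [i' [j' [[r0' h0'] eqz' vr' vh' ->]]]]].
have e : ev (r * h') = ev (r' * h).
  rewrite !rmorphM /=; apply/eqP; rewrite -eqr_div //; apply/eqP.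
  by rewrite -eqz -eqz'.
have e0 : ev (r * h') != 0 by rewrite rmorphM /= mulf_neq0.
by apply: addr_subr_eq; apply: v_uniq e e0 (vM r0 h0' vr vh') (vM r0' h0 vr' vh).
Qed.

Lemma place_of_ring : exists P : place K, forall r n, ev r != 0 -> v r n -> P (ev r) = n.
Proof.
(* The value at 0 is set to 0, as the record [place] demands. *)
have /choice [f fP] z : exists n, (z = 0 -> n = 0) /\ (z != 0 -> val_of z n).
  have [->|z0] := eqVneq z 0; first by exists 0; split.
  by have [n vn] := val_of_total z0; exists n; split=> // /eqP; rewrite (negPf z0).
have fE z n : z != 0 -> val_of z n -> f z = n.
  by move=> z0; apply: val_of_uniq; apply: (fP z).2.
have one0 : ev 1 != 0 by rewrite rmorph1 oner_neq0.
have v1 : v 1 0 by rewrite -[1]/((1%:P)%:P); apply: v_const; rewrite oner_neq0.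
have evE r n : ev r != 0 -> v r n -> f (ev r) = n.
  move=> r0 vr; apply: fE => //; exists r, 1, n, 0; split=> //; last by rewrite subr0.
  by rewrite rmorph1 divr1.
have f0 : f 0 = 0 by apply: (fP 0).1.
have fM z w : z != 0 -> w != 0 -> f (z * w) = f z + f w.
  move=> z0 w0; apply: fE; first exact: mulf_neq0.
  have [r [h [i [j [[r0 h0] -> vr vh ->]]]]] := (fP z).2 z0.
  have [r' [h' [i' [j' [[r0' h0'] -> vr' vh' ->]]]]] := (fP w).2 w0.
  exists (r * r'), (h * h'), (i + i'), (j + j').
  split; [idtac | idtac | by apply: vM | by apply: vM | by rewrite opprD addrACA].
    by rewrite !rmorphM !mulf_neq0.
  by rewrite mulf_div !rmorphM.
have fD z w : z != 0 -> w != 0 -> z + w != 0 -> Num.min (f z) (f w) <= f (z + w).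
  move=> z0 w0 zw0.
  have [r [h [i [j [[r0 h0] eqz vr vh eqf]]]]] := (fP z).2 z0.
  have [r' [h' [i' [j' [[r0' h0'] eqw vr' vh' eqf']]]]] := (fP w).2 w0.
  have e : z + w = ev (r * h' + r' * h) / ev (h * h').
    by rewrite eqz eqw addf_div // rmorphD !rmorphM.
  have n0 : ev (r * h' + r' * h) != 0 by apply: contraNneq zw0 => n0; rewrite e n0 mul0r.
  have rh0 : ev (r * h') != 0 by rewrite rmorphM mulf_neq0.
  have hr0 : ev (r' * h) != 0 by rewrite rmorphM mulf_neq0.
  have [l vl le_l] := vD rh0 hr0 n0 (vM r0 h0' vr vh') (vM r0' h0 vr' vh).
  have -> : f (z + w) = l - (j + j').
    apply: fE => //; exists (r * h' + r' * h), (h * h'), l, (j + j'); split=> //.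
      by rewrite rmorphM mulf_neq0.
    exact: vM.
  by rewrite eqf eqf'; apply: min_intB.
have fC c : c != 0 -> f (constant K c) = 0.
  move=> c0; rewrite /constant -evC; apply: evE; last exact: v_const.
  by rewrite evC in_funfield_eq0 polyC_eq0.
have fS : exists2 t, t != 0 & f t = 1.
  have [r [h [n [l [r0 h0 vr vh e]]]]] := v_surj.
  exists (ev r / ev h); first by rewrite mulf_neq0 // invr_eq0.
  apply: fE; first by rewrite mulf_neq0 // invr_eq0.
  by exists r, h, n, l.
by exists (Place f0 fM fD fC fS).
Qed.

End PlaceOfRing.

End Evaluation.

(** As (q d1 + 1) - q d1 = 1, the equation gives vx = q vy - q d1 vx, so h = vx d1 - vy. *)
Lemma infty_values (q d1 : nat) (vx vy : int) : (1 < q)%N ->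
  vy * q%:Z = vx * (q * d1).+1%:Z -> vx < 0 ->
  exists2 h : int, 0 < h & vx = - (h * q%:Z) /\ vy = - (h * (q * d1).+1%:Z).
Proof.
move=> q_gt1 e vx0; exists (vx * d1%:Z - vy).
  have : 0 < (vx * d1%:Z - vy) * q%:Z by nia.
  by rewrite pmulr_lgt0 //; lia.
by split; nia.
Qed.

Lemma pos_int_unit (h n : int) : 0 < h -> h * n = 1 -> h = 1.
Proof.
move=> h0 e; have n0 : 0 < n by rewrite -(pmulr_rgt0 _ h0) e.
by nia.
Qed.

Lemma mulrn_int (a : int) (n : nat) : a *+ n = a * n%:Z.
Proof. by rewrite pmulrn mulrzz. Qed.

Lemma monomial_value (h : int) (q i d j : nat) :
  - (h * q%:Z) *+ i + - (h * d%:Z) *+ j = - (h * (q * i + d * j)%N%:Z).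
Proof. by rewrite !mulrn_int; lia. Qed.

(** * The place at infinity *)

Section Infinity.
Variables (k : finFieldType) (K : fieldExtType (ratfun k)) (y : K).
Variables (q d1 : nat) (F : {poly k}) (sigma : k).
Hypothesis q_gt1 : (1 < q)%N.
Hypothesis sizeF : size F = (q * d1).+2.
Hypothesis sigmaE : sigma ^+ q = lead_coef F.
Hypothesis K_gen : <<1; y>>%VS = fullv.
Hypothesis y_eq : y ^+ q - y = in_funfield K F.
Implicit Types (r h : {poly {poly k}}) (a : {poly k}) (z : K) (P : place K).

Local Notation d := (q * d1).+1.
Local Notation ev := (ev y).
Local Notation good := (good q d1 sigma).
Local Notation weight := (weight q d1).
Local Notation x := (in_funfield K 'X).

Let gP := good_normal q_gt1 sizeF sigmaE.

Lemma weight_ev_uniq r h : good r -> good h -> ev r = ev h -> weight r = weight h.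
Proof.
move=> gr gh e; apply: (weight_uniq q_gt1 sizeF sigmaE) => //.
exact: (ev_eqP q_gt1 sizeF sigmaE y_eq).
Qed.

Lemma good_normalize r : good r ->
  exists r', [/\ (size r' <= q)%N, r' != 0, ev r = ev r' & weight r = weight r'].
Proof.
move=> gr; have r0 := ev_good_neq0 q_gt1 sizeF sigmaE y_eq gr.
have [r' [size_r' gr' e]] := ev_exists_good q_gt1 sizeF sigmaE y_eq r0.
exists r'; split=> //; last exact: weight_ev_uniq.
by apply: contraNneq r0 => r'0; rewrite e r'0 rmorph0.
Qed.

Definition infty_place P := forall r, good r -> P (ev r) = - (weight r)%:Z.

Lemma infty_place_exists : exists P, infty_place P.
Proof.
pose v r (n : int) := exists2 r', good r' & ev r = ev r' /\ n = - (weight r')%:Z.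
have [P PE] : exists P : place K, forall r n, ev r != 0 -> v r n -> P (ev r) = n.
  apply: (place_of_ring K_gen).
  - move=> r r0; have [r' [_ gr' e]] := ev_exists_good q_gt1 sizeF sigmaE y_eq r0.
    by exists (- (weight r')%:Z), r'.
  - move=> r h n l e r0 [r' gr' [er ->]] [h' gh' [eh ->]].
    by rewrite (weight_ev_uniq gr' gh') // -er -eh.
  - move=> r h n l r0 h0 [r' gr' [er ->]] [h' gh' [eh ->]].
    exists (r' * h'); first by rewrite goodM gr'.
    rewrite !rmorphM /= er eh; split=> //.
    by rewrite (weightM gr') // PoszD opprD.
  (* Good lifts are not closed under addition, but lifts of degree < q in Y are; so both are first
     replaced by such lifts. *)
  - move=> r h n l r0 h0 rh0 [r1 /good_normalize[r' [size_r' r'0 er' wr']] [er ->]].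
    move=> [h1 /good_normalize[h' [size_h' h'0 eh' wh']] [eh ->]].
    have size_rh : (size (r' + h')%R <= q)%N.
      by apply: leq_trans (size_polyD _ _) _; rewrite geq_max size_r'.
    have e : ev (r + h) = ev (r' + h') by rewrite !rmorphD /= er er' eh eh'.
    exists (- (weight (r' + h'))%:Z).
      exists (r' + h') => //; apply: gP => //.
      by apply: contraNneq rh0; rewrite e => ->; rewrite rmorph0.
    have : (weight (r' + h') <= maxn (weight r') (weight h'))%N.
      rewrite /weight rmorphD /=.
      have := size_polyD (weighted q d1 r') (weighted q d1 h').
      move: (size (weighted q d1 r' + weighted q d1 h')) (size (weighted q d1 r')).
      by move: (size (weighted q d1 h')); clear; lia.
    by rewrite wr' wh'; move: (weight r') (weight h') (weight _); clear; lia.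
  - move=> c c0; exists c%:P%:P => //; last by rewrite weightC // size_polyC c0 muln0.
    by apply: gP; rewrite ?polyC_eq0 // (leq_trans (size_polyC_leq1 _)) // ltnW.
  (* x^d1 / y is a uniformizer at infinity: its value is - q d1 + d = 1. *)
  - exists ('X^d1)%:P, 'X, (- (q * d1)%N%:Z), (- d%:Z).
    have gX1 : good ('X^d1)%:P.
      apply: gP; first by rewrite (leq_trans (size_polyC_leq1 _)) // ltnW.
      by rewrite polyC_eq0 expf_neq0 ?polyX_eq0.
    have gX : good 'X by apply: gP; rewrite ?polyX_eq0 ?size_polyX.
    split; try exact: (ev_good_neq0 q_gt1 sizeF sigmaE y_eq).
    + by exists ('X^d1)%:P => //; split=> //; rewrite weightC // size_polyXn.
    + by exists 'X => //; split=> //; rewrite weightX.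
    + by lia.
exists P => r gr; apply: PE; first exact: (ev_good_neq0 q_gt1 sizeF sigmaE y_eq).
by exists r.
Qed.

Lemma infty_place_uniq P P' : infty_place P -> infty_place P' -> P = P'.
Proof.
move=> iP iP'; apply: place_ext => z z0.
have [r [a [a0 eqz]]] := ev_fraction K_gen z.
have r0 : ev r != 0 by apply: contraNneq z0 => r0; rewrite eqz r0 mul0r.
have [r' [_ gr er]] := ev_exists_good q_gt1 sizeF sigmaE y_eq r0.
have ga : good a%:P.
  by apply: gP; rewrite ?polyC_eq0 // (leq_trans (size_polyC_leq1 _)) // ltnW.
have a0' := ev_good_neq0 q_gt1 sizeF sigmaE y_eq ga.
by rewrite eqz -(evC y) !valuation_div // er iP // iP' // iP // iP'.
Qed.

Section Values.
(** At a pole of x the values of x and y are known at first only up to a common factor h;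
    surjectivity of the valuation later forces h = 1. *)
Variables (P : place K) (h : int).
Hypothesis h_gt0 : 0 < h.
Hypothesis Px : x != 0 -> P x = - (h * q%:Z).
Hypothesis Py : y != 0 -> P y = - (h * d%:Z).

Let x0 : x != 0. Proof. by rewrite in_funfield_eq0 polyX_eq0. Qed.

Lemma in_funfield_sum a n : (size a <= n)%N ->
  in_funfield K a = \sum_(i < n) constant K a`_i * x ^+ i.
Proof.
move=> size_a; rewrite -[in LHS](coefK a) poly_def rmorph_sum.
rewrite (big_ord_widen n (fun i => in_funfield K (a`_i *: 'X^i)) size_a) big_mkcond.
apply: eq_bigr => i _; rewrite -mul_polyC rmorphM rmorphXn /=; case: ltnP => // le_i.
by rewrite nth_default // /constant rmorph0 mul0r.
Qed.

Lemma ev_sum r n : (size r <= n)%N -> ev r = \sum_(j < n) in_funfield K r`_j * y ^+ j.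
Proof.
move=> size_r; rewrite /ev (horner_coef_wide _ (n := n)).
  by apply: eq_bigr => j _; rewrite coef_map_id0 ?rmorph0.
exact: leq_trans (size_poly _ _) size_r.
Qed.

Let y0 : y != 0.
Proof. by rewrite -(evX y) (ev_good_neq0 q_gt1 sizeF sigmaE) // gP ?polyX_eq0 ?size_polyX. Qed.

Lemma valuation_monomial i j c : c != 0 ->
  P (constant K c * x ^+ i * y ^+ j) = - (h * (q * i + d * j)%N%:Z).
Proof.
move=> c0; have c0' : constant K c != 0 by rewrite in_funfield_eq0 polyC_eq0.
rewrite !valuationM ?mulf_neq0 ?expf_neq0 // !valuationX // valuation_constant //.
by rewrite Px // Py // add0r monomial_value.
Qed.

Lemma vge_weighted r n : (size r <= q)%N -> (size (weighted q d1 r) <= n)%N ->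
  vge P (h * (1 - n%:Z)) (ev r).
Proof.
move=> size_r /(weight_leqP _ q_gt1 _ size_r) r0.
rewrite (ev_sum size_r); apply: vge_sum => j _.
rewrite (in_funfield_sum (leqnn _)) mulr_suml; apply: vge_sum => i _.
have [->|c0] := eqVneq (r`_j)`_i 0; first by rewrite rmorph0 !mul0r; apply: vge0.
right; rewrite valuation_monomial // -mulrN ler_pM2l //.
have : (q * i + d * j < n)%N.
  by rewrite ltnNge; apply: contraNN c0 => le_n; rewrite r0.
by move: (_ + _)%N; lia.
Qed.

(** Distinct monomials x^i y^j with j < q have distinct weights, so removing the leading monomial m
    lowers the weight, and m alone decides the value. *)
Lemma valuation_good r : good r -> P (ev r) = - (h * (weight r)%:Z).
Proof.
move=> /good_normalize[{}r [size_r r0 -> ->]].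
have [i [j [lt_j c0 wr]]] := lead_monomial d1 q_gt1 size_r r0.
pose m : {poly {poly k}} := ((r`_j)`_i *: 'X^i) *: 'X^j.
have evm : ev m = constant K (r`_j)`_i * x ^+ i * y ^+ j.
  by rewrite /m -!mul_polyC !rmorphM !rmorphXn /= !evC evX.
have size_m : (size m <= q)%N.
  by rewrite /m (leq_trans (size_scale_leq _ _)) // size_polyXn.
have size_rm : (size (r - m)%R <= q)%N.
  by apply: leq_trans (size_polyD _ _) _; rewrite geq_max size_r size_polyN.
have w_rm : (size (weighted q d1 (r - m)) <= weight r)%N.
  apply/(weight_leqP _ q_gt1 _ size_rm) => i' j' lt_j'.
  rewrite leq_eqVlt coefB coefB !coefZ !coefXn => /orP[/eqP|lt_w].
    rewrite wr => /(weight_eq q_gt1 lt_j lt_j')[<- <-].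
    by rewrite eqxx mulr1 coefZ coefXn eqxx mulr1 subrr.
  have r'0 : (r`_j')`_i' = 0.
    have/(weight_leqP _ q_gt1 _ size_r) -> // : (size (weighted q d1 r) <= (weight r).+1)%N.
    by rewrite /weight leqSpred.
  rewrite r'0; case: eqP => [eq_j|_]; last by rewrite mulr0 coef0 subrr.
  rewrite mulr1 coefZ coefXn; case: eqP => [eq_i|_]; last by rewrite mulr0 subrr.
  by move: lt_w; rewrite eq_i eq_j wr ltnn.
have m0 : ev m != 0.
  by rewrite evm !mulf_neq0 ?expf_neq0 // in_funfield_eq0 polyC_eq0.
have Pm : P (ev m) = - (h * (weight r)%:Z) by rewrite evm valuation_monomial // wr.
have er : ev r = ev m + ev (r - m).
  by rewrite -[in LHS](subrK m r) rmorphD addrC.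
have lt_m : vge P (P (ev m) + 1) (ev (r - m)).
  apply: vgeW (vge_weighted size_rm w_rm).
  by rewrite Pm mulrBr mulr1 addrC lerD2r; apply: h_gt0.
by rewrite er; have [_ ->] := valuationD_lt m0 lt_m.
Qed.

End Values.

(** At a pole of x the leading term gives F the value P x * d, hence y has a pole too and y^q
    dominates y. This yields q P y = d P x, and all values are h times the expected ones. *)
Lemma infty_placeP P : ~ vge P 0 x -> infty_place P.
Proof.
move=> Px; have x0 : x != 0 by apply/eqP => x0; apply: Px; left.
have vx0 : P x < 0 by rewrite ltNge; apply/negP => vx0; apply: Px; right.
have vF : P (in_funfield K F) = P x * d%:Z.
  have Fsum n a : (size a <= n.+1)%N -> vge P (P x * n%:Z) (in_funfield K a).
    move=> size_a; rewrite (in_funfield_sum size_a); apply: vge_sum => i _.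
    rewrite -[P x * _]add0r; apply: vgeM; first exact: vge_const.
    right; rewrite valuationX // mulrn_int ler_nM2l // lez_nat.
    by rewrite -ltnS.
  have lF0 : F`_d != 0 by have := F_neq0 sizeF; rewrite -lead_coef_eq0 lead_coefE sizeF.
  pose F1 := F - F`_d *: 'X^d.
  have sF1 : (size F1 <= d)%N.
    apply/leq_sizeP => j le_j; rewrite coefB coefZ coefXn.
    move: le_j; rewrite leq_eqVlt => /predU1P[<-|lt_j]; first by rewrite eqxx mulr1 subrr.
    by rewrite nth_default ?sizeF // gtn_eqF // mulr0 subrr.
  have eF : in_funfield K F = constant K F`_d * x ^+ d + in_funfield K F1.
    by rewrite /F1 rmorphB -mul_polyC rmorphM rmorphXn addrC subrK.
  have c0 : constant K F`_d != 0 by rewrite in_funfield_eq0 polyC_eq0.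
  have z0 : constant K F`_d * x ^+ d != 0 by rewrite mulf_neq0 ?expf_neq0.
  have Pz : P (constant K F`_d * x ^+ d) = P x * d%:Z.
    by rewrite valuationM ?expf_neq0 // valuation_constant // valuationX // add0r mulrn_int.
  have lt_F : vge P (P (constant K F`_d * x ^+ d) + 1) (in_funfield K F1).
    apply: vgeW (Fsum (q * d1)%N _ sF1); rewrite Pz.
    by move: (P x) (q * d1)%N vx0; clear; lia.
  by rewrite eF; have [_ ->] := valuationD_lt z0 lt_F.
have y0 : y != 0.
  rewrite -(evX y) (ev_good_neq0 q_gt1 sizeF sigmaE) //.
  by apply: gP; rewrite ?polyX_eq0 ?size_polyX.
have vy0 : P y < 0.
  rewrite ltNge; apply/negP => vy0.
  have vy : vge P 0 y by right.
  have : vge P 0 (in_funfield K F) by rewrite -y_eq; apply: vgeB => //; apply: vgeX.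
  have F0 : in_funfield K F != 0 by rewrite in_funfield_eq0 (F_neq0 sizeF).
  by move/(vgeE F0); rewrite vF; move: (P x) vx0; lia.
have vyF : P y * q%:Z = P x * d%:Z.
  have yq0 : y ^+ q != 0 by rewrite expf_neq0.
  have lt_y : vge P (P (y ^+ q) + 1) (- y).
    right; rewrite valuationN valuationX // mulrn_int.
    by move: (P y) q vy0 q_gt1; clear; nia.
  rewrite -vF -y_eq; have [_ ->] := valuationD_lt yq0 lt_y.
  by rewrite valuationX // mulrn_int.
have [h h0 [ex ey]] := infty_values q_gt1 vyF vx0.
have vE := valuation_good h0 (fun=> ex) (fun=> ey).
(* Every value is a multiple of h, and the value 1 occurs. *)
suff h1 : h = 1 by move=> r gr; rewrite vE // h1 mul1r.
have [t t0 Pt] := valuation_surj P.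
have [r [a [a0 eqt]]] := ev_fraction K_gen t.
have r0 : ev r != 0 by apply: contraNneq t0 => r0; rewrite eqt r0 mul0r.
have [r' [_ gr er]] := ev_exists_good q_gt1 sizeF sigmaE y_eq r0.
have ga : good a%:P.
  by apply: gP; rewrite ?polyC_eq0 // (leq_trans (size_polyC_leq1 _)) // ltnW.
have a0' := ev_good_neq0 q_gt1 sizeF sigmaE y_eq ga.
move: Pt; rewrite eqt -(evC y) valuation_div // er !vE //.
by rewrite opprK addrC -mulrBr => /(pos_int_unit h0).
Qed.

Lemma infty_place_x P : infty_place P -> P x = - q%:Z /\ P y = - d%:Z.
Proof.
move=> iP; rewrite -(evC y) -{2}(evX y) !iP ?weightX ?weightC ?size_polyX ?muln1 //.
  by apply: gP; rewrite ?polyX_eq0 ?size_polyX.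
by apply: gP; rewrite ?polyC_eq0 ?polyX_eq0 // (leq_trans (size_polyC_leq1 _)) // ltnW.
Qed.

End Infinity.

(** * A power map that fixes k[x, y] modulo an irreducible polynomial *)

Lemma exprBn_pchar (R : comNzRingType) (a b : R) n :
  [pchar R].-nat n -> (a - b) ^+ n = a ^+ n - b ^+ n.
Proof. by move=> nP; rewrite exprDn_pchar // exprNn_pchar. Qed.

(** Fermat in the field k[x]/(g), which has #|k|^(deg g) elements, iterated n times. *)
Lemma dvdp_exp_card_sub (k : finFieldType) (g a : {poly k}) n :
  monic_irreducible_poly g -> g %| a ^+ ((#|k| ^ (size g).-1) ^ n) - a.
Proof.
move=> gI; set N := (#|k| ^ _)%N.
have fermat b : g %| b ^+ N - b.
  have e : (in_qpoly g b : {poly %/ g with gI}) ^+ N = in_qpoly g b.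
    by rewrite -[N](card_qfpoly gI) expf_card.
  have : in_qpoly g (b ^+ N - b) = 0.
    by rewrite rmorphB rmorphXn /=; apply/eqP; rewrite subr_eq0; apply/eqP.
  move/(congr1 val) => /=; rewrite (mk_monicE gI) => e0.
  by rewrite /dvdp Pdiv.IdomainMonic.modpE ?e0 ?(snd gI).
elim: n => [|n IH]; first by rewrite expn0 expr1 subrr dvdp0.
rewrite expnSr exprM.
have -> : (a ^+ (N ^ n)) ^+ N - a = ((a ^+ (N ^ n)) ^+ N - a ^+ (N ^ n)) + (a ^+ (N ^ n) - a).
  by rewrite addrA subrK.
by rewrite dvdp_add.
Qed.

Section Frobenius.
Variables (k : finFieldType) (K : fieldExtType (ratfun k)) (y : K).
Variables (p nk e q : nat) (F : {poly k}).
Hypothesis p_prime : prime p.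
Hypothesis card_k : #|k| = (p ^ nk)%N.
Hypothesis e_gt0 : (0 < e)%N.
Hypothesis q_def : q = (p ^ e)%N.
Hypothesis y_eq : y ^+ q - y = in_funfield K F.
Implicit Types (r h : {poly {poly k}}) (a g : {poly k}).

Local Notation ev := (ev y).

Definition ideal_mult g r := exists h, ev r = in_funfield K g * ev h.

Lemma ideal_multD g r h : ideal_mult g r -> ideal_mult g h -> ideal_mult g (r + h).
Proof. by move=> [r' er] [h' eh]; exists (r' + h'); rewrite !evD er eh mulrDr. Qed.

Lemma ideal_multM g r h : ideal_mult g h -> ideal_mult g (r * h).
Proof. by move=> [h' eh]; exists (r * h'); rewrite !evM eh mulrCA. Qed.

Lemma ideal_multC g a : g %| a -> ideal_mult g a%:P.
Proof.
by move=> /dvdpP[b ->]; exists b%:P; rewrite [b * g]mulrC !evC rmorphM.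
Qed.

Lemma ideal_mult0 g r : ev r = 0 -> ideal_mult g r.
Proof. by move=> r0; exists 0; rewrite ev0 mulr0. Qed.

Let pcharp : p \in [pchar k].
Proof. exact: card_finPcharP card_k p_prime. Qed.

Let pcharA : p \in [pchar {poly {poly k}}].
Proof. by rewrite !pchar_poly. Qed.

(** Iterates y^q = y + F: each further q-th power adds F and raises the earlier summand to the power
    q. *)
Lemma y_expq M : exists a, ev ('X ^+ (q ^ M) - 'X - a%:P) = 0.
Proof.
have pcharK : p \in [pchar K] by apply: (rmorph_pchar (constant K)).
elim: M => [|M [a IH]]; first by exists 0; rewrite expn0 expr1 subrr subr0 ev0.
exists (a ^+ q + F); rewrite !evB evXn evX evC.
rewrite expnSr exprM.
have -> : y ^+ (q ^ M) = y + in_funfield K a.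
  by apply/eqP; rewrite -subr_eq0 opprD addrA; move: IH; rewrite !evB evXn evX evC => ->.
have qK : [pchar K].-nat q.
  by rewrite q_def pnatX pnatE ?pcharK //.
rewrite exprDn_pchar // in_funfieldD in_funfieldXn -y_eq.
by rewrite [X in _ - X]addrCA [X in _ - X]addrA subrr.
Qed.

(* Modulo g, the N-th power map fixes k[x] and adds an element a of k[x] to y,
   so that its p-th iterate is the identity. *)
Lemma exists_frobenius g : monic_irreducible_poly g ->
  exists2 E, (1 < E)%N & forall r, ideal_mult g (r ^+ E - r).
Proof.
move=> gI.
have g_gt1 : (1 < size g)%N by case: (fst gI).
have [M cardE] : exists M, (#|k| ^ (size g).-1 = p ^ M)%N.
  by exists (nk * (size g).-1)%N; rewrite card_k expnM.
(* The exponent e makes N a power of q as well, so [y_expq] applies to it while Fermat still fixes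
   k[x] modulo g. *)
pose N := ((#|k| ^ (size g).-1) ^ e)%N.
have NE : N = (q ^ M)%N by rewrite /N cardE q_def -!expnM mulnC.
have Npchar : [pchar {poly {poly k}}].-nat N.
  by rewrite /N cardE !pnatX pnatE ?pcharA.
have [a ya] := y_expq M.
have ya' : ideal_mult g ('X^N - 'X - a%:P) by apply: ideal_mult0; rewrite NE.
have Na b : ideal_mult g ((b%:P) ^+ N - b%:P).
  by rewrite -rmorphXn -rmorphB; apply/ideal_multC/dvdp_exp_card_sub.
have N_gt0 : (0 < N)%N by rewrite NE q_def !expn_gt0 prime_gt0.
have yj j : ideal_mult g ('X^(N ^ j) - 'X - (a *+ j)%:P).
  elim: j => [|j IH].
    by apply: ideal_mult0; rewrite expn0 expr1 subrr mulr0n sub0r polyC0 oppr0 ev0.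
  have -> : 'X^(N ^ j.+1) - 'X - (a *+ j.+1)%:P =
      ('X^(N ^ j) - 'X - (a *+ j)%:P) ^+ N.-1 * ('X^(N ^ j) - 'X - (a *+ j)%:P) +
      (('X^N - 'X - a%:P) + ((a *+ j)%:P ^+ N - (a *+ j)%:P)).
    rewrite -exprSr prednK // !exprBn_pchar // -exprM -expnSr mulrS polyCD.
    by ring.
  by apply: ideal_multD; [apply: ideal_multM | apply: ideal_multD].
have Epchar : [pchar {poly {poly k}}].-nat (N ^ p)%N by rewrite pnatX Npchar.
have Npj j b : ideal_mult g ((b%:P) ^+ (N ^ j) - b%:P).
  rewrite -rmorphXn -rmorphB; apply/ideal_multC.
  by rewrite /N -expnM; apply: dvdp_exp_card_sub.
exists (N ^ p)%N.
  rewrite /N -!expnM -(expn0 #|k|) ltn_exp2l ?card_finRing_gt1 //.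
  rewrite !muln_gt0 e_gt0 (prime_gt0 p_prime) /= ?andbT.
  by case: (size g) g_gt1 => [|[]].
elim/poly_ind => [|r b IH].
  have Np_gt0 : (0 < N ^ p)%N by rewrite expn_gt0 N_gt0.
  by apply: ideal_mult0; rewrite -(prednK Np_gt0) exprS mul0r subrr ev0.
rewrite exprDn_pchar // exprMn.
have -> : r ^+ (N ^ p) * 'X ^+ (N ^ p) + b%:P ^+ (N ^ p) - (r * 'X + b%:P) =
    r ^+ (N ^ p) * ('X^(N ^ p) - 'X - (a *+ p)%:P) + 'X * (r ^+ (N ^ p) - r)
    + (b%:P ^+ (N ^ p) - b%:P) + r ^+ (N ^ p) * (a *+ p)%:P by ring.
have -> : a *+ p = 0 by rewrite -mulr_natr pcharf0 ?mulr0 // pchar_poly.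
rewrite polyC0 mulr0 addr0; apply: ideal_multD => //; apply: ideal_multD.
  have := ideal_multM (r ^+ (N ^ p)) (yj p).
  by rewrite [a *+ p](_ : _ = 0) // -mulr_natr pcharf0 ?mulr0 // pchar_poly.
exact: ideal_multM.
Qed.
End Frobenius.

(** * Finite places *)

Section FinitePlaces.
Variables (k : finFieldType) (K : fieldExtType (ratfun k)) (y : K).
Variables (p nk e q d1 : nat) (F : {poly k}).
Hypothesis p_prime : prime p.
Hypothesis card_k : #|k| = (p ^ nk)%N.
Hypothesis e_gt0 : (0 < e)%N.
Hypothesis q_def : q = (p ^ e)%N.
Hypothesis K_gen : <<1; y>>%VS = fullv.
Hypothesis y_eq : y ^+ q - y = in_funfield K F.
Implicit Types (r h : {poly {poly k}}) (a g : {poly k}) (z : K) (P : place K).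

Local Notation ev := (ev y).
Local Notation x := (in_funfield K 'X).

Definition finite_place P := vge P 0 x.

Lemma finite_vge_poly P a : finite_place P -> vge P 0 (in_funfield K a).
Proof.
move=> fP; rewrite (in_funfield_sum K (leqnn (size a))); apply: vge_sum => i _.
by apply: vgeZ; apply: vgeX.
Qed.

(** y is integral over k[x]: at a pole of y, y^q would dominate y and give F = y^q - y a pole. *)
Lemma finite_vge_ev P r : finite_place P -> vge P 0 (ev r).
Proof.
move=> fP; have vy : vge P 0 y.
  have [->|y0] := eqVneq y 0; first exact: vge0.
  right; rewrite leNgt; apply/negP => vy0.
  have q_gt1 : (1 < q)%N by rewrite q_def -(expn0 p) ltn_exp2l ?prime_gt1.
  have yq0 : y ^+ q != 0 by rewrite expf_neq0.
  have lt_y : vge P (P (y ^+ q) + 1) (- y).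
    right; rewrite valuationN valuationX // mulrn_int.
    by move: (P y) q vy0 q_gt1; clear; nia.
  have [F0 vF] := valuationD_lt yq0 lt_y.
  rewrite y_eq in F0 vF; have := vgeE F0 (finite_vge_poly F fP).
  rewrite vF valuationX // mulrn_int.
  by move: (P y) q vy0 q_gt1; clear; nia.
rewrite (ev_sum y (leqnn (size r))); apply: vge_sum => i _.
by rewrite -[0]addr0; apply: vgeM (vgeX _ vy); apply: finite_vge_poly.
Qed.

Lemma valuation_ev_ge0 P r : finite_place P -> 0 <= P (ev r).
Proof.
move=> fP; have [->|r0] := eqVneq (ev r) 0; first by rewrite valuation0.
exact: vgeE (finite_vge_ev r fP).
Qed.

Lemma valuation_funfield_ge0 P a : finite_place P -> 0 <= P (in_funfield K a).
Proof. by move=> fP; rewrite -(evC y); apply: valuation_ev_ge0. Qed.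

Lemma valuation_monic P a : a != 0 ->
  P (in_funfield K ((lead_coef a)^-1 *: a)) = P (in_funfield K a).
Proof.
move=> a0; rewrite -mul_polyC in_funfieldM valuationM.
- rewrite -[in_funfield K _%:P]/(constant K _) valuation_constant ?add0r //.
  by rewrite invr_eq0 lead_coef_eq0.
- by rewrite in_funfield_eq0 polyC_eq0 invr_eq0 lead_coef_eq0.
- by rewrite in_funfield_eq0.
Qed.

Lemma finite_center P : finite_place P ->
  exists2 g, monic_irreducible_poly g & 0 < P (in_funfield K g).
Proof.
move=> fP.
(* A P trivial on k[x] would be trivial on k[x, y], each nonzero element of which divides one of
   k[x], and then on K. *)
have [a a0 Pa] : exists2 a : {poly k}, a != 0 & 0 < P (in_funfield K a).
  apply: contrapT => nex; have Pa0 a : a != 0 -> P (in_funfield K a) = 0.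
    move=> a0; apply/eqP; rewrite eq_le valuation_funfield_ge0 // andbT leNgt.
    by apply/negP => Pa; apply: nex; exists a.
  have [z z0 Pz] := valuation_surj P; have [r [a [a0 eqz]]] := ev_fraction K_gen z.
  have r0 : ev r != 0 by apply: contraNneq z0 => r0; rewrite eqz r0 mul0r.
  have [r' [b [b0 e']]] := ev_multiple_in_x K_gen r0.
  have r'0 : ev r' != 0.
    by apply: contraNneq b0 => r'0; rewrite -(in_funfield_eq0 K) -e' r'0 mulr0.
  have : P (ev r * ev r') = 0 by rewrite e' Pa0.
  have : P (ev r) = 1.
    by move: Pz; rewrite eqz valuation_div ?in_funfield_eq0 // Pa0 // subr0.
  rewrite valuationM // => ->; have := valuation_ev_ge0 r' fP.
  by move: (P _); clear; lia.
(* A g of least degree is irreducible, since in a proper factorization one factor would have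
   positive value and smaller degree. *)
pose ex n := `[< exists g, [/\ size g = n, g \is monic & 0 < P (in_funfield K g)] >].
have exP : exists n, ex n.
  exists (size ((lead_coef a)^-1 *: a)); apply/asboolP; exists ((lead_coef a)^-1 *: a).
  split=> //; last by rewrite valuation_monic.
  by rewrite monicE lead_coefZ mulVf ?lead_coef_eq0.
case: (ex_minnP exP) => n /asboolP [g [size_g mon_g Pg]] minn.
have min_g (h : {poly k}) : h != 0 -> 0 < P (in_funfield K h) -> (size g <= size h)%N.
  move=> h0 Ph; rewrite size_g; apply: minn; apply/asboolP.
  exists ((lead_coef h)^-1 *: h); split; last by rewrite valuation_monic.
    by rewrite size_scale // invr_eq0 lead_coef_eq0.
  by rewrite monicE lead_coefZ mulVf ?lead_coef_eq0.
have g0 := monic_neq0 mon_g.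
exists g => //; split=> //; split.
  rewrite ltnNge; apply/negP => /size1_polyC g_const.
  move: Pg g0; rewrite g_const polyC_eq0 => Pg g0.
  by move: Pg; rewrite -[in_funfield K _%:P]/(constant K _) valuation_constant.
move=> h size_h dv_h.
have h0 : h != 0 by apply: contraNneq g0 => h0; move: dv_h; rewrite h0 dvd0p.
have [Ph|Ph] := ltP 0 (P (in_funfield K h)).
  by rewrite -dvdp_size_eqp // eqn_leq dvdp_leq // min_g.
case/dvdpP: dv_h => h' eqg; have h'0 : h' != 0.
  by apply: contraNneq g0 => h'0; rewrite eqg h'0 mul0r.
have Ph' : 0 < P (in_funfield K h').
  move: Pg; rewrite eqg in_funfieldM valuationM ?in_funfield_eq0 //.
  by move: (P _) (P (in_funfield K h)) Ph; clear; lia.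
have := min_g _ h'0 Ph'; rewrite {1}eqg size_mul //.
move: size_h; rewrite -size_poly_gt0 in h0.
by move: (size h) (size h') h0; clear; lia.
Qed.

(* When [r ^+ E - r] is a multiple of g, multiplying [r] by the unit
   [1 - r ^+ E.-1] at P makes it divisible by g. *)
Lemma one_sub_frobenius P r E : (1 < E)%N -> finite_place P -> 0 < P (ev r) ->
  ev (1 - r ^+ E.-1) != 0 /\ P (ev (1 - r ^+ E.-1)) = 0.
Proof.
move=> E_gt1 fP Pr; have r0 : ev r != 0.
  by apply: contraTneq Pr => ->; rewrite valuation0 ltxx.
have v1 : vge P (P 1 + 1) (- ev (r ^+ E.-1)).
  right; rewrite valuation1 add0r valuationN evXn valuationX // mulrn_int.
  by move: (P _) E Pr E_gt1; clear; nia.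
have [e0 e1] := valuationD_lt (oner_neq0 K) v1.
by rewrite evB ev1; split=> //; rewrite e1; apply: valuation1.
Qed.

(** While P (ev r) > 0, a factor that is a unit at P moves r into g k[x, y], and dividing by g
    lowers the value. So r is a power of g up to units at P. *)
Lemma finite_factor P g : finite_place P -> monic_irreducible_poly g ->
  0 < P (in_funfield K g) -> forall r, ev r != 0 ->
  exists n s t, [/\ ev s != 0 /\ ev t != 0, P (ev s) = 0, P (ev t) = 0 &
    ev s * ev r = in_funfield K g ^+ n * ev t].
Proof.
move=> fP gI Pg r.
have [E E_gt1 frob] := exists_frobenius p_prime card_k e_gt0 q_def y_eq gI.
have g0 : in_funfield K g != 0 by rewrite in_funfield_eq0 monic_neq0 // (snd gI).
have [N leN] : exists N : nat, P (ev r) < N%:Z.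
  exists (`|P (ev r)|%N.+1); have := valuation_ev_ge0 r fP; move: (P _); clear; lia.
elim: N r leN => [|N IH] r ltN r0.
  by move: ltN; rewrite ltNge valuation_ev_ge0.
have [Pr|] := ltP 0 (P (ev r)); last first.
  move=> Pr; exists 0%N, 1, r; rewrite ev1 expr0; split=> //.
  - by rewrite oner_neq0.
  - exact: valuation1.
  - by apply/eqP; rewrite eq_le Pr valuation_ev_ge0.
have [s0 Ps] := one_sub_frobenius E_gt1 fP Pr.
have [h eh] := frob r; set s := 1 - _ in s0 Ps.
have es : ev s * ev r = in_funfield K g * ev (- h).
  have -> : ev s * ev r = ev (- (r ^+ E - r)).
    by rewrite -evM /s mulrBl mul1r -exprSr prednK ?(ltnW E_gt1) // opprB.
  by rewrite evN eh evN mulrN.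
have sr0 : ev s * ev r != 0 by rewrite mulf_neq0.
have h0 : ev (- h) != 0 by apply: contraNneq sr0 => h0; rewrite es h0 mulr0.
have Ph : P (ev (- h)) = P (ev r) - P (in_funfield K g).
  by have := congr1 P es; rewrite !valuationM // Ps add0r => ->; rewrite addrC addKr.
have lth : P (ev (- h)) < N%:Z.
  by rewrite Ph; move: (P _) (P (in_funfield K g)) Pg ltN; clear; lia.
have [n [s' [t [[s'0 t0] Ps' Pt est]]]] := IH _ lth h0.
exists n.+1, (s' * s), t; rewrite !evM; split=> //.
- by rewrite mulf_neq0.
- by rewrite valuationM // Ps' Ps.
- by rewrite -mulrA es mulrCA est exprS mulrA.
Qed.

Lemma factor_valuation P g r n s t : finite_place P -> in_funfield K g != 0 ->
  ev r != 0 -> ev s != 0 -> ev t != 0 -> P (ev s) = 0 -> P (ev t) = 0 ->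
  ev s * ev r = in_funfield K g ^+ n * ev t ->
  P (ev r) = P (in_funfield K g) * n%:Z.
Proof.
move=> fP g0 r0 s0 t0 Ps Pt est.
have := congr1 P est; rewrite !valuationM ?expf_neq0 // Ps Pt add0r addr0 => ->.
by rewrite valuationX // mulrn_int.
Qed.

(** By [finite_factor] every value is a multiple of that of g, and the value 1 occurs: g is
    unramified in K. *)
Lemma finite_uniformizer P g : finite_place P -> monic_irreducible_poly g ->
  0 < P (in_funfield K g) -> P (in_funfield K g) = 1.
Proof.
move=> fP gI Pg; have fct := finite_factor fP gI Pg.
have g0 : in_funfield K g != 0 by rewrite in_funfield_eq0 monic_neq0 // (snd gI).
have [z z0 Pz] := valuation_surj P; have [r [a [a0 eqz]]] := ev_fraction K_gen z.
have r0 : ev r != 0 by apply: contraNneq z0 => r0; rewrite eqz r0 mul0r.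
have a0' : ev a%:P != 0 by rewrite evC in_funfield_eq0.
have [n [s [t [[s0 t0] Ps Pt est]]]] := fct _ r0.
have [n' [s' [t' [[s'0 t'0] Ps' Pt' est']]]] := fct _ a0'.
have Pr := factor_valuation fP g0 r0 s0 t0 Ps Pt est.
have Pa := factor_valuation fP g0 a0' s'0 t'0 Ps' Pt' est'.
move: Pz; rewrite eqz -(evC y) valuation_div // Pr Pa -mulrBr.
exact: pos_int_unit.
Qed.

(** One inclusion of centres in k[x, y] is enough: the same g is a uniformizer for both places and
    units at P are units at P', so a factorization from [finite_factor] at P also computes the value
    at P'. *)
Lemma finite_place_ext P P' : finite_place P -> finite_place P' ->
  (forall r, ev r != 0 -> 0 < P' (ev r) -> 0 < P (ev r)) -> P = P'.
Proof.
move=> fP fP' sub; have [g gI P'g] := finite_center fP'.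
have g0 : in_funfield K g != 0 by rewrite in_funfield_eq0 monic_neq0 // (snd gI).
have Pg : 0 < P (in_funfield K g).
  by rewrite -(evC y); apply: sub; rewrite evC.
have unit0 s : ev s != 0 -> P (ev s) = 0 -> P' (ev s) = 0.
  move=> s0 Ps; apply/eqP; rewrite eq_le valuation_ev_ge0 // andbT leNgt.
  by apply/negP => /(sub _ s0); rewrite Ps ltxx.
have eqr r : ev r != 0 -> P (ev r) = P' (ev r).
  move=> r0; have [n [s [t [[s0 t0] Ps Pt est]]]] := finite_factor fP gI Pg r0.
  rewrite (factor_valuation fP g0 r0 s0 t0 Ps Pt est).
  rewrite (factor_valuation fP' g0 r0 s0 t0 (unit0 _ s0 Ps) (unit0 _ t0 Pt) est).
  by rewrite (finite_uniformizer fP gI Pg) (finite_uniformizer fP' gI P'g).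
apply: place_ext => z z0; have [r [a [a0 eqz]]] := ev_fraction K_gen z.
have r0 : ev r != 0 by apply: contraNneq z0 => r0; rewrite eqz r0 mul0r.
have a0' : ev a%:P != 0 by rewrite evC in_funfield_eq0.
by rewrite eqz -(evC y) !valuation_div // !eqr.
Qed.

Lemma frobenius_unit P g E r : finite_place P -> 0 < P (in_funfield K g) ->
  (1 < E)%N -> ideal_mult y g (r ^+ E - r) -> ev r != 0 -> P (ev r) = 0 ->
  vge P 1 (ev (r ^+ E.-1 - 1)).
Proof.
move=> fP Pg E_gt1 [h eh] r0 Pr.
have e0 : ev (r ^+ E.-1 - 1) * ev r = in_funfield K g * ev h.
  by rewrite -eh -evM mulrBl mul1r -exprSr prednK // ltnW.
have : vge P (1 + 0) (in_funfield K g * ev h).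
  by apply: vgeM; [right | apply: finite_vge_ev].
by rewrite -e0 => /(vge_mulIf r0); rewrite Pr addr0 subr0.
Qed.

Lemma residue_surj P z : finite_place P -> vge P 0 z ->
  exists r, vge P 1 (z - ev r).
Proof.
move=> fP; have [->|z0] := eqVneq z 0.
  by exists 0; rewrite ev0 subr0; apply: vge0.
move=> /(vgeE z0) Pz.
have [g gI Pg] := finite_center fP; have Pg1 := finite_uniformizer fP gI Pg.
have g0 : in_funfield K g != 0 by rewrite in_funfield_eq0 monic_neq0 // (snd gI).
have [E E_gt1 frob] := exists_frobenius p_prime card_k e_gt0 q_def y_eq gI.
have [r [a [a0 eqz]]] := ev_fraction K_gen z.
have r0 : ev r != 0 by apply: contraNneq z0 => r0; rewrite eqz r0 mul0r.
have a0' : ev a%:P != 0 by rewrite evC in_funfield_eq0.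
have [n [s [t [[s0 t0] Ps Pt est]]]] := finite_factor fP gI Pg r0.
have [l [s' [t' [[s'0 t'0] Ps' Pt' est']]]] := finite_factor fP gI Pg a0'.
have le_ln : (l <= n)%N.
  move: Pz; rewrite eqz -(evC y) valuation_div //.
  rewrite (factor_valuation fP g0 r0 s0 t0 Ps Pt est).
  rewrite (factor_valuation fP g0 a0' s'0 t'0 Ps' Pt' est') Pg1.
  by clear; lia.
(* After cancellation of g^l, z = w / u with u a unit at P. *)
pose u := s * t'; pose w := (g%:P) ^+ (n - l) * t * s'.
have u0 : ev u != 0 by rewrite evM mulf_neq0.
have Pu : P (ev u) = 0 by rewrite evM valuationM // Ps Pt'.
have ezu : z * ev u = ev w.
  have gl0 : in_funfield K g ^+ l != 0 by rewrite expf_neq0.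
  apply: (mulfI gl0); apply: (mulfI a0'); apply: (mulIf s'0).
  have e1 : in_funfield K a * z = ev r by rewrite eqz mulrC divfK // in_funfield_eq0.
  rewrite /u /w !evM evXn !evC; rewrite evC in est'.
  transitivity (in_funfield K g ^+ l * ev s' * ((in_funfield K a * z) * ev s) * ev t').
    by ring.
  rewrite e1 [ev r * ev s]mulrC est -{1}(subnK le_ln) exprD.
  transitivity (in_funfield K g ^+ (n - l) * in_funfield K g ^+ l * ev t * ev s' *
    (in_funfield K g ^+ l * ev t')); first by ring.
  by rewrite -est'; ring.
(* u^(E - 1) is 1 modulo P, so u^(E - 2) inverts u there. *)
exists (w * u ^+ E.-2).
have -> : z - ev (w * u ^+ E.-2) = - (z * ev (u ^+ E.-1 - 1)).
  rewrite evM -ezu -mulrA -evM -exprS prednK; last by case: E E_gt1 {frob} => [|[]].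
  by rewrite evB ev1 mulrBr mulr1 opprB.
apply: vgeN; rewrite -[1]add0r; apply: vgeM; first by right.
exact: (frobenius_unit fP Pg E_gt1).
Qed.

End FinitePlaces.

(** * The place at a point of the affine curve *)

Lemma dvdp_multiplicity (k : fieldType) (g a : {poly k}) :
  (1 < size g)%N -> a != 0 ->
  exists a1 m, [/\ a = a1 * g ^+ m, ~~ (g %| a1) & (m <= size a)%N].
Proof.
move=> g_gt1; have [n] := ubnP (size a); elim: n a => // n IH a lt_a a0.
have [/dvdpP[b eab]|ndv] := boolP (g %| a); last first.
  by exists a, 0%N; rewrite expr0 mulr1.
have b0 : b != 0 by apply: contraNneq a0 => b0; rewrite eab b0 mul0r.
have g0 : g != 0 by rewrite -size_poly_gt0 ltnW.
have lt_ba : (size b < size a)%N.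
  rewrite eab size_mul //; move: b0 g_gt1; rewrite -size_poly_gt0.
  by move: (size b) (size g); clear; lia.
have [a1 [m [eb ndv le_m]]] := IH b (leq_trans lt_ba lt_a) b0.
exists a1, m.+1; split=> //; first by rewrite eab eb -mulrA -exprSr.
exact: leq_ltn_trans lt_ba.
Qed.

Section PlaceOfPoint.
Variables (k : finFieldType) (K : fieldExtType (ratfun k)) (y : K).
Variables (p nk e q d1 : nat) (F : {poly k}) (sigma : k).
Hypothesis p_prime : prime p.
Hypothesis card_k : #|k| = (p ^ nk)%N.
Hypothesis e_gt0 : (0 < e)%N.
Hypothesis q_def : q = (p ^ e)%N.
Hypothesis q_gt1 : (1 < q)%N.
Hypothesis sizeF : size F = (q * d1).+2.
Hypothesis sigmaE : sigma ^+ q = lead_coef F.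
Hypothesis K_gen : <<1; y>>%VS = fullv.
Hypothesis y_eq : y ^+ q - y = in_funfield K F.
Implicit Types (r h : {poly {poly k}}) (a : {poly k}) (z : K) (P : place K).

Local Notation ev := (ev y).
Local Notation x := (in_funfield K 'X).

Variables (L : fieldType) (chi : {rmorphism {poly {poly k}} -> L}) (g : {poly k}).
Hypothesis gI : monic_irreducible_poly g.
Hypothesis chi_rel : chi (as_rel q F) = 0.
Hypothesis chi_g : chi g%:P = 0.

Lemma chi_ev r h : ev r = ev h -> chi r = chi h.
Proof.
move=> /(ev_eqP q_gt1 sizeF sigmaE y_eq).
rewrite Pdiv.IdomainMonic.dvdp_eq ?as_rel_monic // => /eqP e0.
by apply/eqP; rewrite -subr_eq0 -rmorphB e0 rmorphM chi_rel mulr0.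
Qed.

Lemma chi_neq0 r : chi r != 0 -> ev r != 0.
Proof.
by apply: contraNneq => r0; rewrite (chi_ev (h := 0)) ?ev0 // rmorph0.
Qed.

Let g0 : in_funfield K g != 0.
Proof. by rewrite in_funfield_eq0 monic_neq0 // (snd gI). Qed.

Lemma chi_const_neq0 a : ~~ (g %| a) -> chi a%:P != 0.
Proof.
rewrite -(irreducible_poly_coprime a (fst gI)) => /Bezout_eq1_coprimepP [u eu].
apply/negP => /eqP a0; have := congr1 (fun b : {poly k} => chi b%:P) eu.
rewrite /= polyCD !polyCM rmorphD !rmorphM chi_g a0 !mulr0 addr0 polyC1 rmorph1.
by move=> /esym/eqP; rewrite oner_eq0.
Qed.

(* [chi] is the evaluation at a point above g; the order of vanishing of [r] at
   this point is measured with the uniformizer g. *)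
Definition vanishing r (n : nat) : Prop := exists s t,
  [/\ chi s != 0, chi t != 0 & ev s * ev r = in_funfield K g ^+ n * ev t].

Lemma vanishing_uniq r h n l : ev r = ev h -> ev r != 0 ->
  vanishing r n -> vanishing h l -> n = l.
Proof.
have le r1 h1 n1 l1 : ev r1 = ev h1 -> vanishing r1 n1 -> vanishing h1 l1 -> (l1 <= n1)%N.
  move=> erh [s [t [s0 t0 est]]] [s' [t' [s'0 t'0 est']]]; rewrite leqNgt.
  apply/negP => lt_nl.
  have e1 : ev (s' * t) = ev (s * g%:P ^+ (l1 - n1) * t').
    have gn0 : in_funfield K g ^+ n1 != 0 by rewrite expf_neq0.
    apply: (mulfI gn0); rewrite !evM evXn evC.
    transitivity (ev s' * (ev s * ev r1)); first by rewrite est; ring.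
    transitivity (ev s * (ev s' * ev h1)); first by rewrite erh; ring.
    by rewrite est' -{1}(subnK (ltnW lt_nl)) exprD; ring.
  move: (chi_ev e1) s'0 t0; rewrite !rmorphM rmorphXn chi_g.
  have -> : (0 : L) ^+ (l1 - n1) = 0.
    by move: lt_nl; rewrite -subn_gt0; case: (l1 - n1)%N => // j _; rewrite exprS mul0r.
  by rewrite mulr0 mul0r => /eqP; rewrite mulf_eq0 => /orP[] /eqP ->; rewrite eqxx.
move=> erh r0 vr vh; apply/eqP; rewrite eqn_leq.
by rewrite (le h r l n) // (le r h n l).
Qed.

(** The exponents are bounded, because r divides some a in k[x] in which g has finite multiplicity.
    At the largest one the cofactor t is nonzero at the point: otherwise (1 - t^(E - 1)) t lies in g
    k[x, y] while 1 - t^(E - 1) takes the value 1 there, and one more g could be removed. *)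
Lemma vanishing_exists r : ev r != 0 -> exists n, vanishing r n.
Proof.
move=> r0; have [r' [a [a0 err']]] := ev_multiple_in_x K_gen r0.
have [E E_gt1 frob] := exists_frobenius p_prime card_k e_gt0 q_def y_eq gI.
pose ex n := `[< exists s t, chi s != 0 /\ ev s * ev r = in_funfield K g ^+ n * ev t >].
have ex0 : exists n, ex n.
  by exists 0%N; apply/asboolP; exists 1, r; rewrite rmorph1 oner_neq0 ev1 expr0.
have g_gt1 : (1 < size g)%N by case: (fst gI).
have exB n : ex n -> (n <= size a)%N.
  move=> /asboolP [s [t [s0 est]]]; rewrite leqNgt; apply/negP => lt_n.
  have [a1 [m [ea ndv le_m]]] := dvdp_multiplicity g_gt1 a0.
  have lt_mn := leq_ltn_trans le_m lt_n.
  have e1 : ev (s * a1%:P) = ev (g%:P ^+ (n - m) * (t * r')).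
    have gm0 : in_funfield K g ^+ m != 0 by rewrite expf_neq0.
    apply: (mulfI gm0); rewrite !evM evXn !evC.
    transitivity (ev s * in_funfield K a).
      by rewrite ea in_funfieldM in_funfieldXn; ring.
    rewrite -err' mulrA est -(subnKC (ltnW lt_mn)) exprD addKn.
    by ring.
  have := chi_ev e1; rewrite !rmorphM rmorphXn chi_g.
  have -> : (0 : L) ^+ (n - m) = 0.
    by move: lt_mn; rewrite -subn_gt0; case: (n - m)%N => // j _; rewrite exprS mul0r.
  by rewrite mul0r => /eqP; rewrite mulf_eq0 (negPf s0) (negPf (chi_const_neq0 ndv)).
case: (ex_maxnP ex0 exB) => n /asboolP [s [t [s0 est]]] maxn.
exists n, s, t; split=> //; apply/negP => /eqP t0.
have [h eh] := frob t.
suff /maxn : ex n.+1 by rewrite ltnn.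
apply/asboolP; exists ((1 - t ^+ E.-1) * s), (- h); split.
  rewrite rmorphM mulf_neq0 // rmorphB rmorph1 rmorphXn t0.
  by rewrite -subn1 -[(E - 1)%N]prednK ?subn_gt0 // exprS mul0r subr0 oner_neq0.
rewrite evM -mulrA est mulrCA -evM mulrBl mul1r -exprSr prednK ?(ltnW E_gt1) //.
by rewrite -opprB [ev (- (t ^+ E - t))]evN eh [ev (- h)]evN exprSr -mulrA !mulrN.
Qed.

Lemma place_of_point : exists P, [/\ finite_place P, P (in_funfield K g) = 1 &
  forall r, chi r != 0 -> P (ev r) = 0].
Proof.
pose v r (n : int) := exists2 j : nat, n = j%:Z & vanishing r j.
have vanM r h n l : vanishing r n -> vanishing h l -> vanishing (r * h) (n + l)%N.
  move=> [s [t [s0 t0 est]]] [s' [t' [s'0 t'0 est']]].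
  exists (s * s'), (t * t'); split; [by rewrite rmorphM mulf_neq0..|].
  by rewrite !evM mulrACA est est' mulrACA exprD.
have vanD r h n l : (n <= l)%N -> ev (r + h) != 0 -> vanishing r n -> vanishing h l ->
    exists2 j, vanishing (r + h) j & (n <= j)%N.
  move=> le_nl rh0 [s [t [s0 t0 est]]] [s' [t' [s'0 t'0 est']]].
  (* Up to the factor s s', the sum is g^n w; the order j of w at the point is then added to n. *)
  pose w := s' * t + s * g%:P ^+ (l - n) * t'.
  have ew : ev (s * s') * ev (r + h) = in_funfield K g ^+ n * ev w.
    rewrite /w !evD !evM evXn evC.
    transitivity (ev s' * (ev s * ev r) + ev s * (ev s' * ev h)); first by ring.
    by rewrite est est' -{1}(subnKC le_nl) exprD; ring.
  have ss0 : ev (s * s') != 0 by apply: chi_neq0; rewrite rmorphM mulf_neq0.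
  have w0 : ev w != 0.
    apply: contraNneq rh0 => w0; move/eqP: ew; rewrite w0 mulr0 mulf_eq0.
    by rewrite (negPf ss0).
  have [j [s2 [t2 [s20 t20 est2]]]] := vanishing_exists w0.
  exists (n + j)%N; last exact: leq_addr.
  exists (s2 * (s * s')), t2; split=> //; first by rewrite !rmorphM !mulf_neq0.
  by rewrite evM -mulrA ew mulrCA est2 exprD mulrA.
have [P PE] : exists P : place K, forall r n, ev r != 0 -> v r n -> P (ev r) = n.
  apply: (place_of_ring K_gen).
  - by move=> r /vanishing_exists [n vn]; exists n%:Z, n.
  - by move=> r h n l e0 r0 [j -> vr] [j' -> vh]; rewrite (vanishing_uniq e0 r0 vr vh).
  - move=> r h n l r0 h0 [j -> vr] [j' -> vh]; exists (j + j')%N; first by rewrite PoszD.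
    exact: vanM.
  - move=> r h n l r0 h0 rh0 [j -> vr] [j' -> vh].
    have [le_jj|/ltnW le_jj] := leqP j j'.
      have [i vi le_i] := vanD _ _ _ _ le_jj rh0 vr vh.
      by exists i%:Z; [exists i | rewrite ge_min lez_nat le_i].
    rewrite addrC in rh0 *; have [i vi le_i] := vanD _ _ _ _ le_jj rh0 vh vr.
    by exists i%:Z; [exists i | rewrite ge_min !lez_nat le_i orbT].
  - move=> c c0; exists 0%N => //; exists 1, c%:P%:P.
    rewrite rmorph1 oner_neq0 ev1 mul1r ?expr0 ?mul1r; split=> //.
    apply/negP => /eqP e0; have : chi (c%:P%:P * (c^-1)%:P%:P) = 0 by rewrite rmorphM e0 mul0r.
    by rewrite -!polyCM divff // !polyC1 rmorph1 => /eqP; rewrite oner_eq0.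
  - exists g%:P, 1, 1, 0; split=> //.
    + by rewrite evC.
    + by rewrite ev1 oner_neq0.
    + exists 1%N => //; exists 1, 1; rewrite rmorph1 oner_neq0 ev1 mul1r mulr1 evC expr1.
      by split.
    + by exists 0%N => //; exists 1, 1; rewrite rmorph1 oner_neq0 ev1 mul1r ?expr0.
have vg : P (in_funfield K g) = 1.
  rewrite -(evC y); apply: PE; first by rewrite evC.
  by exists 1%N => //; exists 1, 1; rewrite rmorph1 oner_neq0 ev1 mul1r mulr1 evC expr1.
exists P; split=> // [|r r0].
  have x0 : ev ('X%:P) != 0 by rewrite evC in_funfield_eq0 polyX_eq0.
  have [n vn] := vanishing_exists x0; right.
  by rewrite -(evC y) (PE _ n%:Z) //; exists n.
apply: PE; first exact: chi_neq0.
by exists 0%N => //; exists 1, r; rewrite rmorph1 oner_neq0 r0 ev1 mul1r ?expr0 ?mul1r.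
Qed.

End PlaceOfPoint.

(** * k[x, y] as the ring of functions without finite poles *)

Lemma exists_monic_irreducible_factor (k : fieldType) (a : {poly k}) :
  (1 < size a)%N -> exists2 g, monic_irreducible_poly g & g %| a.
Proof.
move=> a_gt1; have a0 : a != 0 by rewrite -size_poly_gt0 ltnW.
pose ex n := `[< exists g : {poly k}, [/\ size g = n, (1 < size g)%N & g %| a] >].
have exP : exists n, ex n by exists (size a); apply/asboolP; exists a.
case: (ex_minnP exP) => n /asboolP [g [size_g g_gt1 dv_g]] minn.
have g0 : g != 0 by rewrite -size_poly_gt0 ltnW.
have c0 : (lead_coef g)^-1 != 0 by rewrite invr_eq0 lead_coef_eq0.
exists ((lead_coef g)^-1 *: g); last by rewrite dvdpZl.
split; last by rewrite monicE lead_coefZ mulVf ?lead_coef_eq0.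
split=> [|h size_h]; first by rewrite size_scale.
rewrite dvdpZr // => dv_h; apply: eqp_trans (_ : g %= _); last first.
  by rewrite eqp_sym eqp_scale.
have h0 : h != 0 by apply: contraNneq g0 => h0; move: dv_h; rewrite h0 dvd0p.
rewrite -dvdp_size_eqp // eqn_leq dvdp_leq // size_g; apply: minn; apply/asboolP.
exists h; split=> //; last exact: dvdp_trans dv_h dv_g.
by move: size_h; rewrite -size_poly_gt0 in h0; move: (size h) h0; clear; lia.
Qed.

(** Send x to a root xi of g in an algebraic closure. The coefficient of index j survives, so r
    becomes a nonzero polynomial in Y of degree < q, whereas the relation becomes separable, with
    derivative -1, and has q distinct roots; one of them is not a root of r. *)
Lemma exists_point (k : finFieldType) (p e q : nat) (F g : {poly k})
    (r : {poly {poly k}}) j :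
  p \in [pchar k] -> (0 < e)%N -> q = (p ^ e)%N ->
  monic_irreducible_poly g -> (size r <= q)%N -> ~~ (g %| r`_j) ->
  exists (L : fieldType) (chi : {rmorphism {poly {poly k}} -> L}),
    [/\ chi (as_rel q F) = 0, chi g%:P = 0 & chi r != 0].
Proof.
move=> pcharp e_gt0 q_def gI size_r ndv.
have [L [iota _]] := countable_algebraic_closure k.
have g_gt1 : (1 < size g)%N by case: (fst gI).
have [xi root_xi] : exists xi, root (map_poly iota g) xi.
  by apply/closed_rootP; rewrite size_map_poly gtn_eqF.
pose chi0 : {rmorphism {poly k} -> L} := horner_eval xi \o map_poly iota.
have chi0g : chi0 g = 0 by apply/eqP.
pose r1 := map_poly chi0 r.
have r1_neq0 : r1 != 0.
  apply: contraNneq ndv => r10; have : chi0 r`_j = 0 by rewrite -coef_map -/r1 r10 coef0.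
  move=> c0; rewrite -[g %| _]negbK -(irreducible_poly_coprime _ (fst gI)).
  apply/negP => /Bezout_eq1_coprimepP [u eu].
  have := congr1 chi0 eu; rewrite rmorphD !rmorphM chi0g c0 !mulr0 addr0 rmorph1.
  by move=> /esym/eqP; rewrite oner_eq0.
pose f := map_poly chi0 (as_rel q F).
have q_gt1 : (1 < q)%N.
  by rewrite q_def -(expn0 p) ltn_exp2l // prime_gt1 // (pcharf_prime pcharp).
have fE : f = 'X^q - 'X - (chi0 F)%:P.
  by rewrite /f /as_rel !rmorphB /= map_polyXn map_polyX map_polyC.
have size_f : size f = q.+1.
  by rewrite /f size_map_poly_id0 ?size_as_rel // (eqP (as_rel_monic F q_gt1)) rmorph1 oner_neq0.
have f0 : f != 0 by rewrite -size_poly_eq0 size_f.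
have sep_f : separable_poly f.
  rewrite unlock fE !derivB derivXn derivX derivC.
  have -> : 'X^(q.-1) *+ q = 0 :> {poly L}.
    have pL : p \in [pchar {poly L}] by rewrite pchar_poly (rmorph_pchar iota).
    by rewrite -mulr_natr q_def natrX pcharf0 // expr0n gtn_eqF // mulr0.
  by rewrite sub0r subr0 -[X in coprimep _ X]scaleN1r coprimepZr ?oppr_eq0 ?oner_neq0 // coprimep1.
have [rs eq_f] := closed_field_poly_normal f.
have lf0 : lead_coef f != 0 by rewrite lead_coef_eq0.
have uniq_rs : uniq rs.
  rewrite -separable_prod_XsubC; move: sep_f; rewrite eq_f.
  by rewrite (eqp_separable (eqp_scale _ lf0)).
have size_rs : size rs = q.
  by move: size_f; rewrite eq_f size_scale // size_prod_XsubC => -[].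
have [eta eta_rs nroot] : exists2 eta, eta \in rs & ~~ root r1 eta.
  apply/allPn; apply/negP => all_root.
  have := max_poly_roots r1_neq0 all_root uniq_rs.
  rewrite size_rs ltnNge => /negP; apply; apply: leq_trans size_r.
  exact: size_poly.
exists L, (horner_eval eta \o map_poly chi0); split.
- rewrite /= -/f; apply/eqP; rewrite -/(root f eta) eq_f rootZ //.
  by rewrite root_prod_XsubC.
- by rewrite /= map_polyC /= /horner_eval hornerC.
- exact: nroot.
Qed.

Section IntegralClosure.
Variables (k : finFieldType) (K : fieldExtType (ratfun k)) (y : K).
Variables (p nk e q d1 : nat) (F : {poly k}) (sigma : k).
Hypothesis p_prime : prime p.
Hypothesis card_k : #|k| = (p ^ nk)%N.
Hypothesis e_gt0 : (0 < e)%N.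
Hypothesis q_def : q = (p ^ e)%N.
Hypothesis q_gt1 : (1 < q)%N.
Hypothesis sizeF : size F = (q * d1).+2.
Hypothesis sigmaE : sigma ^+ q = lead_coef F.
Hypothesis K_gen : <<1; y>>%VS = fullv.
Hypothesis y_eq : y ^+ q - y = in_funfield K F.
Implicit Types (r h : {poly {poly k}}) (a g : {poly k}) (z : K) (P : place K).

Local Notation ev := (ev y).

(** If g misses a coefficient of the reduced lift of r, [exists_point] yields a place where r is a
    unit and g has value 1, so that r / g has a pole. *)
Lemma divisible_of_integral g r : monic_irreducible_poly g ->
  (forall P, finite_place P -> vge P 0 (ev r / in_funfield K g)) ->
  exists r', ev r = in_funfield K g * ev r'.
Proof.
have [r1 [size_r1 _ <-]] := normalize q_gt1 y_eq r => gI int_r.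
have g0 : in_funfield K g != 0 by rewrite in_funfield_eq0 monic_neq0 // (snd gI).
have [all_dv|/existsNP[j /negP ndv]] := pselect (forall j, g %| r1`_j).
  exists (\poly_(j < size r1) (r1`_j %/ g)); rewrite -(evC y) -evM; congr (ev _).
  apply/polyP => j; rewrite coefCM coef_poly; case: ltnP => [_|le_j].
    by rewrite mulrC divpK.
  by rewrite mulr0 nth_default.
have pcharp : p \in [pchar k] by apply: card_finPcharP card_k p_prime.
have [L [chi [chi_rel chi_g chi_r]]] := exists_point F pcharp e_gt0 q_def gI size_r1 ndv.
have [P [fP Pg Pr]] := place_of_point p_prime card_k e_gt0 q_def q_gt1 sizeF sigmaE
  K_gen y_eq gI chi_rel chi_g.
have r0 := chi_neq0 q_gt1 sizeF sigmaE y_eq chi_rel chi_r.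
have r0' : ev r1 / in_funfield K g != 0 by rewrite mulf_neq0 // invr_eq0.
by have := vgeE r0' (int_r P fP); rewrite valuation_div // Pg Pr.
Qed.

(** The irreducible factors of a denominator are removed one at a time: z times the other factors is
    still integral and has denominator g. *)
Lemma integral_closure z : (forall P, finite_place P -> vge P 0 z) ->
  exists2 r : {poly {poly k}}, (size r <= q)%N & z = ev r.
Proof.
move=> int_z; apply: (ev_exists_normal q_gt1 y_eq).
have [r [a [a0 eqz]]] := ev_fraction K_gen z.
have [n] := ubnP (size a); elim: n a r a0 eqz => // n IH a r a0 eqz lt_a.
have ia0 : in_funfield K a != 0 by rewrite in_funfield_eq0.
have [/size1_polyC a_const|a_gt1] := leqP (size a) 1.
  move: (a`_0) a_const => c a_const; exists ((c^-1)%:P%:P * r); rewrite evM evC eqz.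
  have c0 : c != 0 by move: a0; rewrite a_const polyC_eq0.
  apply: (mulIf ia0); rewrite divfK // mulrAC a_const -in_funfieldM -polyCM.
  by rewrite mulVf // polyC1 rmorph1 mul1r.
have [g gI dv_g] := exists_monic_irreducible_factor a_gt1.
case/dvdpP: (dv_g) => b eab.
have g0 : g != 0 by rewrite monic_neq0 // (snd gI).
have b0 : b != 0 by apply: contraNneq a0 => b0; rewrite eab b0 mul0r.
have ig0 : in_funfield K g != 0 by rewrite in_funfield_eq0.
have ib0 : in_funfield K b != 0 by rewrite in_funfield_eq0.
have eqzb : z * in_funfield K b = ev r / in_funfield K g.
  by rewrite eqz eab in_funfieldM; field; rewrite ig0.
have [r' er'] : exists r', ev r = in_funfield K g * ev r'.
  apply: divisible_of_integral => // P fP; rewrite -eqzb -[0]addr0.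
  by apply: vgeM; [apply: int_z | apply: finite_vge_poly].
apply: (IH b r') => //.
  by rewrite eqz er' eab in_funfieldM; field; rewrite ?ig0 ?ib0.
rewrite -ltnS; apply: leq_trans lt_a; rewrite ltnS eab size_mul //.
have g_gt1 : (1 < size g)%N by case: (fst gI).
by rewrite -size_poly_gt0 in b0; move: (size b) (size g) b0 g_gt1; clear; lia.
Qed.

End IntegralClosure.

(** * Dimensions computed on the coefficients of the powers of y *)

Definition poly_subspace (k : fieldType) (A : {poly k} -> Prop) : Prop :=
  [/\ A 0, forall a b, A a -> A b -> A (a + b) & forall c a, A a -> A (c *: a)].

(* [A] is the direct sum of [B] and of the polynomials of degree < [n]. *)
Definition poly_complement (k : fieldType) (A B : {poly k} -> Prop) (n : nat) : Prop :=
  [/\ forall a, B a -> A a, forall i, (i < n)%N -> A 'X^i,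
      forall a, A a -> exists2 c : {poly k}, (size c <= n)%N & B (a - c) &
      forall c : {poly k}, (size c <= n)%N -> B c -> c = 0].

Section CoefficientwiseDimension.
Variables (k : finFieldType) (K : fieldExtType (ratfun k)) (y : K).
Variables (q d1 : nat) (F : {poly k}) (sigma : k).
Hypothesis q_gt1 : (1 < q)%N.
Hypothesis sizeF : size F = (q * d1).+2.
Hypothesis sigmaE : sigma ^+ q = lead_coef F.
Hypothesis y_eq : y ^+ q - y = in_funfield K F.
Implicit Types (r h : {poly {poly k}}) (a : {poly k}) (z : K).
Implicit Types (A B : nat -> {poly k} -> Prop).

Local Notation ev := (ev y).

Definition coefs_in A z := exists2 r : {poly {poly k}}, (size r <= q)%N &
  z = ev r /\ forall j, (j < q)%N -> A j r`_j.

Lemma coefs_in_subspace A : (forall j, poly_subspace (A j)) -> subspace (coefs_in A).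
Proof.
move=> sA; split=> [|_ _ [r size_r [-> Ar]] [h size_h [-> Ah]]|c _ [r size_r [-> Ar]]].
- exists 0; rewrite ?size_poly0 // ev0; split=> // j _; rewrite coef0.
  by case: (sA j).
- exists (r + h); first by apply: leq_trans (size_polyD _ _) _; rewrite geq_max size_r.
  rewrite evD; split=> // j lt_j; rewrite coefD; case: (sA j) => _ AD _.
  by apply: AD; [apply: Ar | apply: Ah].
- exists (c%:P *: r); first exact: leq_trans (size_scale_leq _ _) size_r.
  rewrite -mul_polyC evM evC; split=> // j lt_j; rewrite coefCM mul_polyC.
  by case: (sA j) => _ _; apply; apply: Ar.
Qed.

Lemma lincomb_monomials n t (a : {ffun 'I_n -> k}) :
  lincomb (fun i : 'I_n => ev (('X^i)%:P * 'X^t)) a =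
  ev ((\sum_(i < n) a i *: 'X^i)%:P * 'X^t).
Proof.
rewrite /lincomb evM evC rmorph_sum mulr_suml /=; apply: eq_bigr => i _.
by rewrite evM evC -mul_polyC in_funfieldM [LHS]mulrA.
Qed.

Lemma coef_sum_monomials n (a : {ffun 'I_n -> k}) (i : 'I_n) :
  (\sum_(i < n) a i *: 'X^i)`_i = a i.
Proof.
rewrite coef_sum (bigD1 i) //= big1 => [|j neq_ji]; rewrite coefZ coefXn ?eqxx ?mulr1 ?addr0 //.
by rewrite eq_sym (inj_eq val_inj) (negPf neq_ji) mulr0.
Qed.

Lemma size_sum_monomials n (a : {ffun 'I_n -> k}) :
  (size (\sum_(i < n) a i *: 'X^i)%R <= n)%N.
Proof.
apply: leq_trans (size_sum _ _ _) _; apply/bigmax_leqP => i _.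
by apply: leq_trans (size_scale_leq _ _) _; rewrite size_polyXn.
Qed.

Lemma coefs_in_dim1 A B t n : (t < q)%N ->
  (forall j, poly_subspace (A j)) -> (forall j, poly_subspace (B j)) ->
  (forall j, j <> t -> A j = B j) -> poly_complement (A t) (B t) n ->
  has_quotient_dim (coefs_in A) (coefs_in B) n.
Proof.
move=> lt_t sA sB eqAB [BA AX Acompl Bindep].
have size_m (c : {poly k}) : (size (c%:P * 'X^t : {poly {poly k}})%R <= q)%N.
  rewrite mul_polyC; apply: leq_trans (size_scale_leq _ _) _.
  by rewrite size_polyXn.
have coef_m (c : {poly k}) j : (c%:P * 'X^t : {poly {poly k}})`_j = if j == t then c else 0.
  by rewrite coefCM coefXn; case: eqP => _; rewrite ?mulr1 ?mulr0.
apply: (has_quotient_dimI (b := fun i : 'I_n => ev (('X^i)%:P * 'X^t))).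
- exact: coefs_in_subspace.
- move=> i; exists (('X^i)%:P * 'X^t) => //; split=> // j _; rewrite coef_m.
  by case: eqP => [->|_]; [apply: AX | case: (sA j)].
- move=> _ [r size_r [-> Ar]]; have [c size_c Brc] := Acompl _ (Ar t lt_t).
  exists [ffun i : 'I_n => c`_i]; rewrite lincomb_monomials.
  have -> : \sum_(i < n) [ffun i : 'I_n => c`_i] i *: 'X^i = c.
    rewrite -[RHS](coefK c) poly_def (big_ord_widen n (fun i => c`_i *: 'X^i) size_c).
    rewrite [RHS]big_mkcond; apply: eq_bigr => i _; rewrite ffunE; case: ltnP => // le_i.
    by rewrite nth_default // scale0r.
  rewrite -evB; exists (r - c%:P * 'X^t).
    by apply: leq_trans (size_polyD _ _) _; rewrite geq_max size_r size_polyN size_m.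
  split=> // j lt_j; rewrite coefB coef_m; case: eqP => [->//|neq_j].
  by rewrite subr0 -eqAB //; apply: Ar.
- move=> a; rewrite lincomb_monomials => -[r size_r [er Br]].
  set c := \sum_(i < n) a i *: 'X^i in er *.
  have : c%:P * 'X^t - r = 0.
    apply: (ev_normal_eq0 q_gt1 sizeF sigmaE y_eq); last by rewrite evB er subrr.
    by apply: leq_trans (size_polyD _ _) _; rewrite geq_max size_m size_polyN.
  move=> /subr0_eq e0; have := Br t lt_t; rewrite -e0 coef_m eqxx.
  move=> /(Bindep _ (size_sum_monomials a)) c0.
  by apply/ffunP => i; rewrite ffunE -coef_sum_monomials c0 coef0.
Qed.

Lemma coefs_in_dim A B (n : nat -> nat) :
  (forall j, poly_subspace (A j)) -> (forall j, poly_subspace (B j)) ->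
  (forall j, (j < q)%N -> poly_complement (A j) (B j) (n j)) ->
  has_quotient_dim (coefs_in A) (coefs_in B) (\sum_(j < q) n j).
Proof.
(* C t interpolates: the first t coefficients obey A and the others B, so that one coefficient
   changes at a time. *)
move=> sA sB cAB; pose C t j := if (j < t)%N then A j else B j.
have sC t j : poly_subspace (C t j) by rewrite /C; case: ifP.
have subC t t' : (t <= t')%N -> (t' <= q)%N -> forall z, coefs_in (C t) z -> coefs_in (C t') z.
  move=> le_t le_tq _ [r size_r [-> Cr]]; exists r => //; split=> // j lt_j.
  have := Cr j lt_j; rewrite /C; case: ltnP => [lt_jt|_].
    by rewrite (leq_trans lt_jt).
  by case: ifP => // _; case: (cAB j lt_j) => BA _ _ _; apply: BA.
have C0 z : coefs_in B z <-> coefs_in (C 0%N) z by [].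
have Cq z : coefs_in A z <-> coefs_in (C q) z.
  split=> -[r size_r [-> Cr]]; exists r => //; split=> // j lt_j.
    by rewrite /C lt_j; apply: Cr.
  by have := Cr j lt_j; rewrite /C lt_j.
apply: (has_quotient_dim_ext Cq C0).
suff H t : (t <= q)%N -> has_quotient_dim (coefs_in (C t)) (coefs_in (C 0%N)) (\sum_(j < t) n j).
  exact: H.
elim: t => [|t IH] lt_t.
  by rewrite big_ord0; apply: has_quotient_dim_refl; apply: coefs_in_subspace.
rewrite big_ord_recr /=.
apply: (has_quotient_dim_trans (V := coefs_in (C t))); try exact: coefs_in_subspace.
- by apply: subC => //; apply: ltnW.
- exact: subC.
- by apply: IH; apply: ltnW.
apply: (coefs_in_dim1 lt_t) => //.
  by move=> j neq_j; rewrite /C ltnS leq_eqVlt (negPf (introN eqP neq_j)).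
by rewrite /C ltnSn ltnn; apply: cAB.
Qed.

End CoefficientwiseDimension.

(** * Residue fields and finiteness of zeros *)

Lemma enum_of_injection (T : eqType) (U : finType) (S : T -> Prop) (phi : T -> U) :
  (forall a b, S a -> S b -> phi a = phi b -> a = b) ->
  exists2 s : seq T, uniq s & forall a, a \in s <-> S a.
Proof.
move=> inj; pose f u : option T :=
  match pselect (exists a, S a /\ phi a = u) with
  | left ex => Some (projT1 (cid ex)) | right _ => None end.
exists (undup (pmap f (enum U))); first exact: undup_uniq.
move=> a; rewrite mem_undup mem_pmap; split=> [/mapP[u _]|Sa].
  rewrite /f; case: pselect => // ex [->]; case: (cid ex) => b [] //.
apply/mapP; exists (phi a); first by rewrite mem_enum.
rewrite /f; case: pselect => [ex|[]]; last by exists a.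
by case: (cid ex) => b [Sb eb] /=; congr Some; apply: inj.
Qed.

Section ResidueFields.
Variables (k : finFieldType) (K : fieldExtType (ratfun k)) (y : K).
Variables (p nk e q d1 : nat) (F : {poly k}) (sigma : k).
Hypothesis p_prime : prime p.
Hypothesis card_k : #|k| = (p ^ nk)%N.
Hypothesis e_gt0 : (0 < e)%N.
Hypothesis q_def : q = (p ^ e)%N.
Hypothesis q_gt1 : (1 < q)%N.
Hypothesis sizeF : size F = (q * d1).+2.
Hypothesis sigmaE : sigma ^+ q = lead_coef F.
Hypothesis K_gen : <<1; y>>%VS = fullv.
Hypothesis y_eq : y ^+ q - y = in_funfield K F.
Implicit Types (r h : {poly {poly k}}) (a f g : {poly k}) (z : K) (P Q : place K).

Local Notation ev := (ev y).

Definition poly_ring z := exists r, z = ev r.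

Definition principal_ideal f z := exists r, z = in_funfield K f * ev r.

Lemma poly_ring_subspace : subspace poly_ring.
Proof.
split=> [|_ _ [r ->] [h ->]|c _ [r ->]]; first by exists 0; rewrite ev0.
  by exists (r + h); rewrite evD.
by exists (c%:P%:P * r); rewrite evM evC.
Qed.

(** Divisibility by f is tested on each of the q coefficients in y, with the remainders modulo f as
    a complement of dimension deg f. *)
Lemma principal_ideal_dim f : f != 0 ->
  has_quotient_dim poly_ring (principal_ideal f) (q * (size f).-1).
Proof.
move=> f0.
have := @coefs_in_dim k K y q d1 F sigma q_gt1 sizeF sigmaE y_eq
  (fun=> fun=> True) (fun=> fun a => f %| a) (fun=> (size f).-1).
rewrite sum_nat_const card_ord => dimA.
apply: has_quotient_dim_ext (dimA _ _ _).
- move=> z; split=> [[r ->]|[r _ [-> _]]]; last by exists r.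
  by have [r' [size_r' _ <-]] := normalize q_gt1 y_eq r; exists r'.
- move=> z; split=> [[r ->]|[r size_r [-> dv_r]]].
    have [r' [size_r' _ <-]] := normalize q_gt1 y_eq r.
    exists (f%:P * r'); last by rewrite evM evC; split=> // j _; rewrite coefCM dvdp_mulr.
    by rewrite mul_polyC (leq_trans (size_scale_leq _ _)).
  exists (\poly_(j < q) (r`_j %/ f)); rewrite -(evC y) -evM; congr (ev _).
  apply/polyP => j; rewrite coefCM coef_poly; case: ltnP => [lt_j|le_j].
    by rewrite mulrC divpK // dv_r.
  by rewrite mulr0 nth_default // (leq_trans size_r).
- by [].
- move=> _; split=> [|a b dva dvb|c a dva]; rewrite ?dvdp0 ?dvdp_add //.
  by rewrite -mul_polyC dvdp_mull.
- move=> j _; split=> // [a _|c size_c dv_c].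
    exists (a %% f); first by rewrite -ltnS prednK ?size_poly_gt0 // ltn_modpN0.
    by rewrite {1}(divp_eq a f) addrK dvdp_mull.
  apply: contraTeq dv_c => c0; apply/negP => /(dvdp_leq c0); rewrite leqNgt.
  by rewrite (leq_ltn_trans size_c) // prednK ?size_poly_gt0.
Qed.

Lemma vge_subspace P n : subspace (vge P n).
Proof. by split=> [|z w|c z]; [apply: vge0 | apply: vgeD | apply: vgeZ]. Qed.

(** By [residue_surj] a basis of k[x, y] modulo g spans the residue field; so [place_degree] is its
    true dimension and not the default of [xget]. *)
Lemma finite_degree P : finite_place P ->
  has_quotient_dim (vge P 0) (vge P 1) (place_degree P).
Proof.
move=> fP; have sO := vge_subspace P 0; have sM := vge_subspace P 1.
suff [n hn] : exists n, has_quotient_dim (vge P 0) (vge P 1) n.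
  by rewrite /place_degree (quotient_dimE sO sM hn).
have [g gI Pg] := finite_center p_prime e_gt0 q_def K_gen y_eq fP.
have g0 : g != 0 by rewrite monic_neq0 // (snd gI).
have dimg := principal_ideal_dim g0.
have sR := poly_ring_subspace.
have sI : subspace (principal_ideal g).
  split=> [|_ _ [r ->] [h ->]|c _ [r ->]]; first by exists 0; rewrite ev0 mulr0.
    by exists (r + h); rewrite evD mulrDr.
  by exists (c%:P%:P * r); rewrite evM evC mulrCA.
have [c [Rc sc _]] := (has_quotient_dimP _ sR sI).1 dimg.
have [n _ hn] : exists2 n, (n <= q * (size g).-1)%N &
    has_quotient_dim (vge P 0) (vge P 1) n; last by exists n.
apply: has_quotient_dim_bounded => // n b vb ib.
apply: (independent_spans_leq sO sM vb ib (c := c)) => z vz.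
have [r vr] := residue_surj p_prime card_k e_gt0 q_def K_gen y_eq fP vz.
have [a [h eh]] := sc (ev r) (ex_intro _ r erefl).
exists a; have -> : z - lincomb c a = (z - ev r) + (ev r - lincomb c a).
  by rewrite addrA subrK.
apply: vgeD => //; rewrite eh -[1]addr0; apply: vgeM; first by right.
exact: (finite_vge_ev p_prime e_gt0 q_def y_eq _ fP).
Qed.

(** A zero of f is determined by its centre, and the centre by the classes modulo f that it
    contains; the finitely many [mpoly M] represent these classes. *)
Lemma zeros_finite f : f != 0 -> exists2 Z : seq (place K), uniq Z &
  forall P, P \in Z <-> finite_place P /\ 0 < P (in_funfield K f).
Proof.
move=> f0; pose mpoly (M : {ffun 'I_q -> 'rV[k]_(size f)}) : {poly {poly k}} :=
  \sum_(j < q) rVpoly (M j) *: 'X^j.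
apply: (@enum_of_injection _ {set {ffun 'I_q -> 'rV[k]_(size f)}} _
  (fun P => [set M | 0 < P (ev (mpoly M))]%SET)).
have small r : exists M h, ev r = in_funfield K f * ev h + ev (mpoly M).
  have [r' [size_r' _ <-]] := normalize q_gt1 y_eq r.
  exists [ffun j : 'I_q => poly_rV (r'`_j %% f)], (\sum_(j < q) (r'`_j %/ f) *: 'X^j).
  rewrite -(evC y) -evM -evD; congr (ev _).
  rewrite -[LHS]coefK poly_def (big_ord_widen q (fun j => r'`_j *: 'X^j) size_r').
  rewrite big_mkcond mulr_sumr -big_split; apply: eq_bigr => j _ /=.
  rewrite ffunE poly_rV_K; last by rewrite ltnW // ltn_modpN0.
  rewrite mul_polyC scalerA -scalerDl [f * _]mulrC -divp_eq.
  by case: ltnP => // le_j; rewrite nth_default // scale0r.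
have half P P' : finite_place P -> finite_place P' -> 0 < P (in_funfield K f) ->
    0 < P' (in_funfield K f) ->
    [set M | 0 < P (ev (mpoly M))]%SET = [set M | 0 < P' (ev (mpoly M))]%SET ->
    forall r, ev r != 0 -> 0 < P' (ev r) -> 0 < P (ev r).
  move=> fP fP' Pf P'f eqM r r0 P'r; have [M [h er]] := small r.
  have vfh P1 : finite_place P1 -> 0 < P1 (in_funfield K f) -> vge P1 1 (in_funfield K f * ev h).
    move=> fP1 P1f; rewrite -[1]addr0; apply: vgeM; first by right.
    exact: (finite_vge_ev p_prime e_gt0 q_def y_eq _ fP1).
  have : vge P' 1 (ev (mpoly M)).
    have -> : ev (mpoly M) = ev r - in_funfield K f * ev h by rewrite er addrC addKr.
    by apply: vgeB; [right | apply: vfh].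
  move=> vM; have {vM} : vge P 1 (ev (mpoly M)).
    case: vM => [->|vM]; first exact: vge0.
    right; have : M \in [set M | 0 < P (ev (mpoly M))]%SET by rewrite eqM inE gtz0_ge1.
    by rewrite inE gtz0_ge1.
  move=> vM; have : vge P 1 (ev r) by rewrite er; apply: vgeD => //; apply: vfh.
  by move/(vgeE r0).
move=> P P' [fP Pf] [fP' P'f] eqM.
apply: (finite_place_ext p_prime card_k e_gt0 q_def K_gen y_eq fP fP').
exact: half.
Qed.

End ResidueFields.

(** * Zeros of polynomials in x *)

Section ZeroDivisor.
Variables (k : finFieldType) (K : fieldExtType (ratfun k)) (y : K).
Variables (p nk e q d1 : nat) (F : {poly k}) (sigma : k).
Hypothesis p_prime : prime p.
Hypothesis card_k : #|k| = (p ^ nk)%N.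
Hypothesis e_gt0 : (0 < e)%N.
Hypothesis q_def : q = (p ^ e)%N.
Hypothesis q_gt1 : (1 < q)%N.
Hypothesis sizeF : size F = (q * d1).+2.
Hypothesis sigmaE : sigma ^+ q = lead_coef F.
Hypothesis K_gen : <<1; y>>%VS = fullv.
Hypothesis y_eq : y ^+ q - y = in_funfield K F.
Implicit Types (r h : {poly {poly k}}) (a f g : {poly k}) (z : K) (P Q : place K).
Implicit Types (Z : seq (place K)) (C : place K -> nat).

Local Notation ev := (ev y).
Local Notation poly_ring := (poly_ring y).
Local Notation principal_ideal := (principal_ideal y).

Let vge_ev P r : finite_place P -> vge P 0 (ev r).
Proof. exact: (finite_vge_ev p_prime e_gt0 q_def y_eq). Qed.

Let val_ev P r : finite_place P -> 0 <= P (ev r).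
Proof. exact: (valuation_ev_ge0 p_prime e_gt0 q_def y_eq). Qed.

(** Distinct finite places have incomparable centres, so for each P in Z some element vanishes at P
    but not at Q; take the product. *)
Lemma separating_element Q Z : finite_place Q -> (forall P, P \in Z -> finite_place P) ->
  Q \notin Z ->
  exists W, [/\ ev W != 0, Q (ev W) = 0 & forall P, P \in Z -> 0 < P (ev W)].
Proof.
move=> fQ; elim: Z => [|P Z IH] fZ nQ.
  by exists 1; rewrite ev1 valuation1 oner_neq0; split.
rewrite inE negb_or in nQ; case/andP: nQ => neq_QP nQ.
have fP : finite_place P by apply: fZ; rewrite inE eqxx.
have [|W [W0 QW PW]] := IH _ nQ; first by move=> P' P'Z; apply: fZ; rewrite inE P'Z orbT.
have [r [r0 Pr Qr]] : exists r, [/\ ev r != 0, 0 < P (ev r) & Q (ev r) = 0].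
  apply: contrapT => nex; case/eqP: neq_QP.
  apply: (finite_place_ext p_prime card_k e_gt0 q_def K_gen y_eq fQ fP) => r r0 Pr.
  rewrite lt_def val_ev // andbT; apply/negP => /eqP Qr.
  by apply: nex; exists r.
exists (r * W); rewrite evM; split=> [|| P'].
- by rewrite mulf_neq0.
- by rewrite valuationM // Qr QW.
rewrite inE valuationM // => /predU1P[->|P'Z].
  by apply: ltr_wpDr => //; apply: val_ev.
by apply: ltr_wpDl; [apply/val_ev/fZ; rewrite inE P'Z orbT | apply: PW].
Qed.

(** W^(E - 1) is 1 modulo Q and vanishes at each P in Z; its N-th power is still 1 modulo Q and
    vanishes to order N. *)
Lemma approximate_unit Q Z (N : nat) : finite_place Q ->
  (forall P, P \in Z -> finite_place P) -> Q \notin Z ->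
  exists u, vge Q 1 (ev u - 1) /\ forall P, P \in Z -> vge P N%:Z (ev u).
Proof.
move=> fQ fZ nQ; have [W [W0 QW PW]] := separating_element fQ fZ nQ.
have [g gI Qg] := finite_center p_prime e_gt0 q_def K_gen y_eq fQ.
have [E E_gt1 frob] := exists_frobenius p_prime card_k e_gt0 q_def y_eq gI.
have vW := frobenius_unit p_prime e_gt0 q_def y_eq fQ Qg E_gt1 (frob W) W0 QW.
exists ((W ^+ E.-1) ^+ N); split=> [|P PZ].
  rewrite -(ev1 y) -evB subrX1 evM -[1]addr0; apply: vgeM => //.
  exact: vge_ev.
right; rewrite -exprM evXn valuationX // mulrn_int PoszM.
have E1 : (0 < E.-1)%N by rewrite -ltnS prednK // ltnW.
have := PW P PZ; rewrite mulrA; move: (P _) E.-1 E1; clear => v E E1 v1.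
by apply: ler_peMl => //; nia.
Qed.

Definition vanishing_order_ge Z C z := poly_ring z /\
  forall P, P \in Z -> vge P (C P)%:Z z.

Lemma vanishing_order_subspace Z C : subspace (vanishing_order_ge Z C).
Proof.
have [R0 RD RZ] := poly_ring_subspace y.
split=> [|z w [Rz vz] [Rw vw]|c z [Rz vz]]; split; try by [apply: R0 | apply: RD | apply: RZ].
- by move=> P _; apply: vge0.
- by move=> P PZ; apply: vgeD; [apply: vz | apply: vw].
- by move=> P PZ; apply: vgeZ; apply: vz.
Qed.

(** The quotient is the residue field at Q: lift a basis of the latter to k[x, y], scale by g^(C Q)
    to reach the order at Q, and multiply by u, which is 1 at Q and absorbs the conditions at the
    other places. *)
Lemma vanishing_order_step Z C Q : uniq Z -> (forall P, P \in Z -> finite_place P) ->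
  Q \in Z ->
  has_quotient_dim (vanishing_order_ge Z C)
    (vanishing_order_ge Z (fun P => (C P + (P == Q))%N)) (place_degree Q).
Proof.
move=> uZ fZ QZ; have fQ := fZ _ QZ.
have sV := vanishing_order_subspace Z.
have sO := vge_subspace Q 0; have sM := vge_subspace Q 1.
have := finite_degree p_prime card_k e_gt0 q_def q_gt1 sizeF sigmaE K_gen y_eq fQ.
move=> /(has_quotient_dimP _ sO sM)[b [Ob sb ib]].
have /choice[r vr] i : exists r, vge Q 1 (b i - ev r).
  exact: (residue_surj p_prime card_k e_gt0 q_def K_gen y_eq fQ (Ob i)).
have [g gI Qg0] := finite_center p_prime e_gt0 q_def K_gen y_eq fQ.
have Qg := finite_uniformizer p_prime card_k e_gt0 q_def K_gen y_eq fQ gI Qg0.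
have g0 : in_funfield K g != 0 by rewrite in_funfield_eq0 monic_neq0 // (snd gI).
have [||u [Qu Zu]] := @approximate_unit Q (rem Q Z) (\max_(P <- Z) C P) fQ.
- by move=> P /mem_rem /fZ.
- by rewrite mem_rem_uniq // inE eqxx.
have gC0 : in_funfield K g ^+ C Q != 0 by rewrite expf_neq0.
have vgC : Q (in_funfield K g ^+ C Q) = (C Q)%:Z.
  by rewrite valuationX // Qg mulrn_int mul1r.
pose c i := ev (g%:P ^+ C Q * r i * u).
have cE (a : {ffun 'I_(place_degree Q) -> k}) : lincomb c a =
    in_funfield K g ^+ C Q * lincomb (fun i => ev (r i) * ev u) a.
  rewrite /lincomb mulr_sumr; apply: eq_bigr => i _.
  by rewrite /c !evM evXn evC -[in LHS]mulrA mulrCA.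
have diff_b (a : {ffun 'I_(place_degree Q) -> k}) :
    vge Q 1 (lincomb b a - lincomb (fun i => ev (r i) * ev u) a).
  rewrite /lincomb -sumrB; apply: vge_sum => i _; rewrite -mulrBr; apply: vgeZ.
  have -> : b i - ev (r i) * ev u = (b i - ev (r i)) - ev (r i) * (ev u - 1).
    by rewrite mulrBr mulr1 opprB addrA subrK.
  by apply: vgeB => //; rewrite -[1]add0r; apply: vgeM => //; apply: vge_ev.
have Vc i : vanishing_order_ge Z C (c i).
  split; first by exists (g%:P ^+ C Q * r i * u).
  move=> P PZ; rewrite /c; have fP := fZ _ PZ.
  have [->|neq_PQ] := eqVneq P Q.
    rewrite -mulrA evM evXn evC -[(C Q)%:Z]addr0; apply: vgeM; last exact: vge_ev.
    by right; rewrite vgC.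
  rewrite evM -[(C P)%:Z]add0r; apply: vgeM; first exact: vge_ev.
  apply: vgeW (Zu P _); first by rewrite lez_nat; apply: leq_bigmax_seq.
  by rewrite mem_rem_uniq // inE neq_PQ.
have vge_gC n z : vge Q (n + (C Q)%:Z) (in_funfield K g ^+ C Q * z) -> vge Q n z.
  by rewrite mulrC => /(vge_mulIf gC0); rewrite vgC addrK.
apply: (has_quotient_dimI (b := c)) => //.
- move=> z [Rz vz].
  have vzg : vge Q 0 (z / in_funfield K g ^+ C Q).
    by apply: vge_gC; rewrite add0r mulrC divfK //; apply: vz.
  have [a va] := sb _ vzg; exists a; split.
    apply: (subspaceB (poly_ring_subspace y)) => //.
    by apply: subspace_lincomb; [apply: poly_ring_subspace | move=> i; case: (Vc i)].
  move=> P PZ; have [->|neq_PQ] := eqVneq P Q; last first.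
    rewrite addn0; apply: vgeB; first exact: vz.
    by have [_] := subspace_lincomb a (sV C) Vc; apply.
  rewrite cE -{1}[z](divfK gC0) [_ / _ * _]mulrC -mulrBr PoszD.
  apply: vgeM; first by right; rewrite vgC.
  have -> : z / in_funfield K g ^+ C Q - lincomb (fun i => ev (r i) * ev u) a =
      (z / in_funfield K g ^+ C Q - lincomb b a) +
      (lincomb b a - lincomb (fun i => ev (r i) * ev u) a) by rewrite addrA subrK.
  exact: vgeD.
- move=> a [_ /(_ Q QZ)]; rewrite eqxx cE PoszD addrC => /vge_gC va; apply: ib.
  have -> : lincomb b a = (lincomb b a - lincomb (fun i => ev (r i) * ev u) a) +
    lincomb (fun i => ev (r i) * ev u) a by rewrite subrK.
  exact: vgeD.
Qed.

Lemma vanishing_order_dim Z C : uniq Z -> (forall P, P \in Z -> finite_place P) ->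
  has_quotient_dim poly_ring (vanishing_order_ge Z C)
    (\sum_(P <- Z) C P * place_degree P).
Proof.
move=> uZ fZ; have [n] := ubnP (\sum_(P <- Z) C P)%N.
elim: n C => // n IH C lt_n.
have sR := poly_ring_subspace y; have sV := vanishing_order_subspace Z.
have [[Q QZ CQ]|nex] := pselect (exists2 Q, Q \in Z & (0 < C Q)%N); last first.
  have C0 P : P \in Z -> C P = 0%N.
    by move=> PZ; apply/eqP; rewrite -leqn0 leqNgt; apply/negP => ?; apply: nex; exists P.
  rewrite big_seq big1 => [|P PZ]; last by rewrite C0.
  apply: has_quotient_dim_ext (has_quotient_dim_refl sR) => // z.
  split=> [[]//|Rz]; split=> // P PZ; rewrite C0 //; case: Rz => r ->.
  by apply: vge_ev; apply: fZ.
pose C' P := (C P - (P == Q))%N.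
have eqC : C = fun P => (C' P + (P == Q))%N.
  by apply: funext => P; rewrite /C' subnK //; case: eqP => // ->.
have sumE (G : place K -> nat) : (\sum_(P <- Z) C P * G P = \sum_(P <- Z) C' P * G P + G Q)%N.
  rewrite {1}eqC; under eq_bigr do rewrite mulnDl.
  rewrite big_split /=; congr (_ + _)%N; rewrite (bigD1_seq Q) //= eqxx mul1n.
  by rewrite big1 ?addn0 // => P /negPf ->.
have := vanishing_order_step C' uZ fZ QZ; rewrite -eqC sumE => step.
have lt_C' : (\sum_(P <- Z) C' P < n)%N.
  rewrite -ltnS; apply: leq_trans lt_n; rewrite ltnS.
  have -> : (\sum_(P <- Z) C P = \sum_(P <- Z) C P * 1)%N.
    by apply: eq_bigr => P _; rewrite muln1.
  rewrite (sumE (fun=> 1%N)) addn1 ltnS; apply: eq_leq.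
  by apply: eq_bigr => P _; rewrite muln1.
rewrite addnC; have dimC' := IH _ lt_C'.
apply: (has_quotient_dim_trans sR (sV C') (sV C) _ _ step dimC') => [z [Rz vz]|z []//].
split=> // P PZ; apply: vgeW (vz P PZ).
by rewrite lez_nat /C' leq_subr.
Qed.

(** Both sides are the dimension of k[x, y] modulo f, counted by vanishing orders and by
    coefficients. The two ideals agree since z / f, having no finite pole, lies in k[x, y]. *)
Lemma zeros_degree f Z : f != 0 -> uniq Z ->
  (forall P, P \in Z <-> finite_place P /\ 0 < P (in_funfield K f)) ->
  (\sum_(P <- Z) `|P (in_funfield K f)|%N * place_degree P = q * (size f).-1)%N.
Proof.
move=> f0 uZ ZP; have if0 : in_funfield K f != 0 by rewrite in_funfield_eq0.
have fZ P : P \in Z -> finite_place P by move=> /ZP[].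
have dim1 := vanishing_order_dim (fun P => `|P (in_funfield K f)|%N) uZ fZ.
have dim2 := principal_ideal_dim q_gt1 sizeF sigmaE y_eq f0.
have sR := poly_ring_subspace y.
apply: (has_quotient_dim_uniq sR (vanishing_order_subspace _ _) dim1).
apply: has_quotient_dim_ext dim2 => // z.
have absf P : finite_place P -> `|P (in_funfield K f)|%N%:Z = P (in_funfield K f).
  by move=> fP; rewrite gez0_abs // -(evC y) val_ev.
split=> [[Rz vz]|[r ->]].
  suff [r _ er] : exists2 r : {poly {poly k}}, (size r <= q)%N & z / in_funfield K f = ev r.
    by exists r; rewrite -er mulrC divfK.
  apply: (integral_closure p_prime card_k e_gt0 q_def q_gt1 sizeF sigmaE K_gen y_eq).
  move=> P fP.
  have vzP : vge P (P (in_funfield K f)) z.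
    have [PZ|nPZ] := boolP (P \in Z); first by rewrite -absf //; apply: vz.
    have -> : P (in_funfield K f) = 0.
      apply/eqP; rewrite eq_le -{2}(evC y) val_ev // andbT leNgt; apply/negP => Pf.
      by case/negP: nPZ; apply/ZP.
    by case: Rz => r ->; apply: vge_ev.
  rewrite -(subrr (P (in_funfield K f))) -valuationV //.
  by apply: vgeM => //; right.
split; first by exists (f%:P * r); rewrite evM evC.
move=> P PZ; rewrite absf; last exact: fZ.
by have := vgeM (vge_refl P (in_funfield K f)) (vge_ev r (fZ _ PZ)); rewrite addr0.
Qed.

End ZeroDivisor.

(** * Riemann-Roch spaces and the genus *)

Section RiemannRochSpaces.
Variables (k : finFieldType) (K : fieldExtType (ratfun k)).
Hypothesis degree_dim : forall P : place K,
  has_quotient_dim (vge P 0) (vge P 1) (place_degree P).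
Implicit Types (P Q : place K) (D : place K -> int) (T : seq (place K)) (z : K).

Definition rr_space D z := forall P, vge P (- D P) z.

Lemma rr_spaceE D z : riemann_roch_space D z <-> rr_space D z.
Proof.
split=> [[->|vz] P|vz]; [exact: vge0 | by right | ].
have [->|z0] := eqVneq z 0; [by left | right=> P].
exact: vgeE z0 (vz P).
Qed.

Lemma rr_space_subspace D : subspace (rr_space D).
Proof.
split=> [P|z w vz vw P|c z vz P]; first exact: vge0.
  by apply: vgeD.
by apply: vgeZ.
Qed.

Lemma zero_subspace : subspace (fun z : K => z = 0).
Proof. by split=> // [z w -> ->|c z ->]; rewrite ?addr0 ?mulr0. Qed.

Lemma ellE D n : has_quotient_dim (rr_space D) (fun z => z = 0) n -> ell D = n.
Proof.
move=> hn; have sR : subspace (riemann_roch_space D).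
  have [R0 RD RZ] := rr_space_subspace D.
  by split=> [|z w /rr_spaceE vz /rr_spaceE vw|c z /rr_spaceE vz]; apply/rr_spaceE; auto.
rewrite /ell (quotient_dimE sR zero_subspace (n := n)) //.
by apply: has_quotient_dim_ext hn => // z; apply: rr_spaceE.
Qed.

Lemma place_value_surj Q (n : int) : exists2 t, t != 0 & Q t = n.
Proof.
have [t t0 Qt] := valuation_surj Q; case: n => n.
  by exists (t ^+ n); rewrite ?expf_neq0 // valuationX // Qt mulrn_int mul1r.
exists (t ^+ n.+1)^-1; first by rewrite invr_eq0 expf_neq0.
by rewrite valuationV ?expf_neq0 // valuationX // Qt mulrn_int mul1r NegzE.
Qed.

(** Multiplication by t, of value D Q + 1 at Q, embeds the quotient into the residue field at Q. *)
Lemma rr_space_step D Q : exists2 n, (n <= place_degree Q)%N &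
  has_quotient_dim (rr_space (fun P => D P + (P == Q)%:Z)) (rr_space D) n.
Proof.
have sR := rr_space_subspace.
have sO := vge_subspace Q 0; have sM := vge_subspace Q 1.
have [c [Oc sc _]] := (has_quotient_dimP _ sO sM).1 (degree_dim Q).
have [t t0 Qt] := place_value_surj Q (D Q + 1).
apply: has_quotient_dim_bounded => // n b Lb ib.
pose tb i := t * b i.
have tbE a : lincomb tb a = t * lincomb b a.
  by rewrite /lincomb mulr_sumr; apply: eq_bigr => i _; rewrite mulrCA.
apply: (independent_spans_leq (U := vge Q 0) (W := vge Q 1) (b := tb) (c := c)) => //.
  move=> i; have := vgeM (vge_refl Q t) (Lb i Q).
  by rewrite eqxx Qt subrr.
move=> a; rewrite tbE mulrC => /(vge_mulIf t0); rewrite Qt => va; apply: ib => P.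
have [->|neq_PQ] := eqVneq P Q; first by apply: vgeW va; lia.
have := subspace_lincomb a (sR _) Lb; move/(_ P).
by rewrite (negPf neq_PQ) addr0.
Qed.

(** Descends from D' to D one place at a time. The existence of the dimension for D is obtained
    along with the bound, as it is needed before [ell D] can be evaluated. *)
Lemma rr_space_mono D D' T n' : uniq T -> (forall P, D P <= D' P) ->
  (forall P, P \notin T -> D P = D' P) ->
  has_quotient_dim (rr_space D') (fun z => z = 0) n' ->
  exists2 n, has_quotient_dim (rr_space D) (fun z => z = 0) n &
    (n' <= n + \sum_(P <- T) `|D' P - D P|%N * place_degree P)%N.
Proof.
move=> uT; have [m] := ubnP (\sum_(P <- T) `|D' P - D P|)%N.
elim: m D' n' => // m IH D' n' lt_m leD eqD hn'.
have [[Q QT ltD]|nex] := pselect (exists2 Q, Q \in T & D Q < D' Q); last first.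
  have eqDD : D' = D.
    apply: funext => P; have [PT|/eqD //] := boolP (P \in T).
    by apply/eqP; rewrite eq_le leD andbT leNgt; apply/negP => ?; apply: nex; exists P.
  by exists n'; [rewrite -eqDD | rewrite leq_addr].
pose D1 P := D' P - (P == Q)%:Z.
have D'E : D' = fun P => D1 P + (P == Q)%:Z by apply: funext => P; rewrite subrK.
have leD1 P : D P <= D1 P.
  by rewrite /D1; have [->|_] := eqVneq P Q; rewrite ?subr0 ?leD // lerBrDr lezD1.
have sR := rr_space_subspace.
have [n2 le_n2] := rr_space_step D1 Q; rewrite -D'E => h2.
have sub1 z : rr_space D1 z -> rr_space D' z.
  move=> vz P; apply: vgeW (vz P); rewrite /D1; case: eqP => _; lia.
have sub0 z : z = 0 -> rr_space D1 z by move=> ->; case: (sR D1).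
have [n1 [n2' [h1 h2' e]]] := has_quotient_dim_split (sR D') (sR D1) zero_subspace sub0 sub1 hn'.
have e2 := has_quotient_dim_uniq (sR D') (sR D1) h2' h2.
have absE P : `|D' P - D P|%N = (`|D1 P - D P| + (P == Q))%N.
  by have := leD1 P; rewrite D'E /=; case: eqP => _; move: (D1 P) (D P); clear; lia.
have sumE (G : place K -> nat) : (\sum_(P <- T) `|D' P - D P|%N * G P =
    \sum_(P <- T) `|D1 P - D P|%N * G P + G Q)%N.
  under eq_bigr do rewrite absE mulnDl.
  rewrite big_split /=; congr (_ + _)%N; rewrite (bigD1_seq Q) //= eqxx mul1n.
  by rewrite big1 ?addn0 // => P /negPf ->.
have lt_D1 : (\sum_(P <- T) `|D1 P - D P|%N < m)%N.
  rewrite -ltnS; apply: leq_trans lt_m; rewrite ltnS.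
  have -> : (\sum_(P <- T) `|D' P - D P| = \sum_(P <- T) `|D' P - D P| * 1)%N.
    by apply: eq_bigr => P _; rewrite muln1.
  rewrite (sumE (fun=> 1%N)) addn1 ltnS; apply: eq_leq.
  by apply: eq_bigr => P _; rewrite muln1.
have eqD1 P : P \notin T -> D P = D1 P.
  move=> PT; rewrite /D1 eqD //; case: eqP => [eP|_]; last by rewrite subr0.
  by move: PT; rewrite eP QT.
have [n h le_n] := IH D1 n1 lt_D1 leD1 eqD1 h1.
exists n => //; rewrite sumE e e2 addnA leq_add //.
Qed.

Lemma divisor_degreeE D T : uniq T -> (forall P, P \notin T -> D P = 0) ->
  divisor_degree D = \sum_(P <- T) D P *+ place_degree P.
Proof.
move=> uT D0; rewrite /divisor_degree (fsbigE T) //.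
  by apply: eq_bigl => P; rewrite in_setT.
by move=> P _ PT; rewrite D0 // mul0rn.
Qed.

End RiemannRochSpaces.

(** * The genus *)

Lemma sum_pole_orders (d1 N t : nat) : (d1 * t <= N)%N ->
  (\sum_(j < t.+1) (N.+1 - d1 * j - (0 < j)) + d1 * 'C(t.+1, 2) = t.+1 * N + 1)%N.
Proof.
elim: t => [|t IH] le_N.
  by rewrite big_ord_recr big_ord0 /= !muln0 mul1n addn0 !subn0 addn1.
have le_t : (d1 * t <= N)%N by apply: leq_trans le_N; rewrite leq_mul2l leqnSn orbT.
rewrite big_ord_recr /= binS bin1 mulnDr; move: (IH le_t) le_N.
by move: (\sum_(j < _) _)%N 'C(t.+1, 2) (d1 * t.+1)%N => s b a; lia.
Qed.

Section Genus.
Variables (k : finFieldType) (K : fieldExtType (ratfun k)) (y : K).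
Variables (p nk e q d1 : nat) (F : {poly k}) (sigma : k).
Hypothesis p_prime : prime p.
Hypothesis card_k : #|k| = (p ^ nk)%N.
Hypothesis e_gt0 : (0 < e)%N.
Hypothesis q_def : q = (p ^ e)%N.
Hypothesis q_gt1 : (1 < q)%N.
Hypothesis sizeF : size F = (q * d1).+2.
Hypothesis sigmaE : sigma ^+ q = lead_coef F.
Hypothesis K_gen : <<1; y>>%VS = fullv.
Hypothesis y_eq : y ^+ q - y = in_funfield K F.
Implicit Types (r h : {poly {poly k}}) (a f g : {poly k}) (z : K) (P Q : place K).

Local Notation ev := (ev y).
Local Notation d := (q * d1).+1.
Local Notation good := (good q d1 sigma).
Local Notation weight := (weight q d1).
Local Notation infty_place := (infty_place y q d1 sigma).

Let goodC a : a != 0 -> good a%:P.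
Proof.
move=> a0; apply: (good_normal q_gt1 sizeF sigmaE); last by rewrite polyC_eq0.
by rewrite (leq_trans (size_polyC_leq1 _)) // ltnW.
Qed.

Lemma infty_valuation_poly P a : infty_place P -> a != 0 ->
  P (in_funfield K a) = - (q * (size a).-1)%N%:Z.
Proof. by move=> iP a0; rewrite -(evC y) iP ?goodC // weightC. Qed.

Lemma infty_not_finite P : infty_place P -> ~ finite_place P.
Proof.
move=> iP; have x0 : in_funfield K 'X != 0 by rewrite in_funfield_eq0 polyX_eq0.
move=> /(vgeE x0); rewrite (infty_valuation_poly iP) ?polyX_eq0 // size_polyX.
by move: q q_gt1; clear; lia.
Qed.

Lemma infty_vge_weighted P r n : infty_place P -> (size r <= q)%N ->
  (size (weighted q d1 r) <= n)%N -> vge P (1 - n%:Z) (ev r).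
Proof.
move=> iP size_r size_w; have [Px Py] := infty_place_x q_gt1 sizeF sigmaE iP.
rewrite -[1 - _]mul1r.
by apply: (vge_weighted q_gt1 sizeF sigmaE y_eq) => //; rewrite mul1r.
Qed.

(** Numerator and denominator of a function of value 0 have equal weight, hence the same leading
    monomial; subtracting the ratio of the two leading coefficients, a constant, lowers the weight
    of the numerator. *)
Lemma infty_degree P : infty_place P -> has_quotient_dim (vge P 0) (vge P 1) 1.
Proof.
move=> iP; have sM := vge_subspace P 1.
have lincomb1 (b : 'I_1 -> K) (a : {ffun 'I_1 -> k}) : lincomb b a = constant K (a ord0) * b ord0.
  by rewrite /lincomb big_ord1.
apply: (has_quotient_dimI (b := fun _ : 'I_1 => 1)) => // [_|z vz|a].
- by right; rewrite valuation1.
- have [v1|nv1] := pselect (vge P 1 z); first by exists 0; rewrite lincomb0 subr0.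
  have z0 : z != 0 by apply/eqP => z0; apply: nv1; rewrite z0; apply: vge0.
  have Pz : P z = 0.
    apply/eqP; rewrite eq_le (vgeE z0 vz) andbT leNgt; apply/negP => Pz.
    by apply: nv1; right; rewrite -gtz0_ge1.
  have [r [a [a0 eqz]]] := ev_fraction K_gen z.
  have ia0 : in_funfield K a != 0 by rewrite in_funfield_eq0.
  have r0 : ev r != 0 by apply: contraNneq z0 => r0; rewrite eqz r0 mul0r.
  have [r' [size_r' gr' er']] := ev_exists_good q_gt1 sizeF sigmaE y_eq r0.
  have r'0 : r' != 0 by apply: contraNneq r0 => r'0; rewrite er' r'0 ev0.
  have size_a : (size (a%:P : {poly {poly k}}) <= q)%N.
    by rewrite (leq_trans (size_polyC_leq1 _)) // ltnW.
  have eq_w : weight r' = weight a%:P.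
    move: Pz; rewrite eqz -(evC y) valuation_div ?evC // -(evC y) er' !iP ?goodC //.
    by move: (weight _) (weight a%:P); clear; lia.
  have a0' : a%:P != 0 :> {poly {poly k}} by rewrite polyC_eq0.
  have [i [j [lt_j c0 wr]]] := lead_monomial d1 q_gt1 size_r' r'0.
  have [i' [j' [lt_j' c'0 wa]]] := lead_monomial d1 q_gt1 size_a a0'.
  have [eq_i eq_j] : i = i' /\ j = j'.
    by apply: (weight_eq (d1 := d1) q_gt1 lt_j lt_j'); rewrite -wr -wa.
  rewrite -{}eq_i -{}eq_j in c'0.
  set c := (r'`_j)`_i in c0; set c' := ((a%:P)`_j)`_i in c'0.
  pose r1 := r' - (c / c')%:P%:P * a%:P.
  have size_r1 : (size r1 <= q)%N.
    apply: leq_trans (size_polyD _ _) _; rewrite geq_max size_r' size_polyN -polyCM.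
    by rewrite (leq_trans (size_polyC_leq1 _)) // ltnW.
  have w_r1 : (size (weighted q d1 r1) <= weight r')%N.
    apply/(weight_leqP _ q_gt1 _ size_r1) => i2 j2 lt_j2.
    have wP r2 : (size r2 <= q)%N -> weight r2 = weight r' ->
        (weight r' < q * i2 + d * j2)%N -> (r2`_j2)`_i2 = 0.
      move=> size_r2 <- lt_w; have/(weight_leqP _ q_gt1 _ size_r2) -> // :
        (size (weighted q d1 r2) <= (weight r2).+1)%N by rewrite leqSpred.
    rewrite leq_eqVlt /r1 coefB coefB coefCM coefCM => /orP[/eqP|lt_w].
      rewrite wr => /(weight_eq q_gt1 lt_j lt_j2)[<- <-].
      by rewrite -/c -/c' divfK // subrr.
    by rewrite !wP // mulr0 subrr.
  exists [ffun=> c / c']; rewrite lincomb1 ffunE mulr1.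
  have -> : z - constant K (c / c') = ev r1 / in_funfield K a.
    rewrite /r1 evB !evM !evC -er' eqz.
    by apply: (mulIf ia0); rewrite mulrBl !divfK.
  have -> : 1 = (1 - (weight r')%:Z) - P (in_funfield K a).
    by rewrite -(evC y) iP ?goodC // -eq_w opprK subrK.
  apply: vge_mulIf => //; rewrite divfK //.
  exact: infty_vge_weighted.
rewrite lincomb1 mulr1 => va; apply/ffunP => i; rewrite ffunE (ord1 i).
apply/eqP; apply: contrapT => /negP a0.
have a0' : constant K (a ord0) != 0 by rewrite in_funfield_eq0 polyC_eq0.
by have := vgeE a0' va; rewrite valuation_constant.
Qed.

Lemma degree_dim P : has_quotient_dim (vge P 0) (vge P 1) (place_degree P).
Proof.
have [fP|nfP] := pselect (finite_place P).
  exact: (finite_degree p_prime card_k e_gt0 q_def q_gt1 sizeF sigmaE K_gen y_eq fP).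
have iP := infty_placeP q_gt1 sizeF sigmaE K_gen y_eq nfP.
have h1 := infty_degree iP.
by rewrite /place_degree (quotient_dimE (vge_subspace P 0) (vge_subspace P 1) h1).
Qed.

Lemma infty_place_degree P : infty_place P -> place_degree P = 1%N.
Proof.
move=> iP; apply: (has_quotient_dim_uniq (vge_subspace P 0) (vge_subspace P 1)).
  exact: degree_dim.
exact: infty_degree.
Qed.

(* For j < q, the number of i such that q i + d j <= q N is
   N + 1 - d1 j - [j > 0]. *)
Lemma infty_space_dim Pinf N : infty_place Pinf -> (d1 * q <= N)%N ->
  exists2 n, (n + d1 * 'C(q, 2) = q * N + 1)%N &
    has_quotient_dim (fun z => (forall P, finite_place P -> vge P 0 z) /\
      vge Pinf (- (q * N)%N%:Z) z) (fun z => z = 0) n.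
Proof.
move=> iP le_N; pose n j := (N.+1 - d1 * j - (0 < j))%N.
exists (\sum_(j < q) n j)%N.
  have q0 : (0 < q)%N by apply: ltnW.
  rewrite -(prednK q0); apply: sum_pole_orders; apply: leq_trans le_N.
  by rewrite leq_mul2l leq_pred orbT.
have := @coefs_in_dim k K y q d1 F sigma q_gt1 sizeF sigmaE y_eq
  (fun j a => (size a <= n j)%N) (fun=> fun a => a = 0) n.
move=> dimA; apply: has_quotient_dim_ext (dimA _ _ _).
- have small r : (size r <= q)%N -> ((size (weighted q d1 r) <= (q * N).+1)%N <->
      forall j, (j < q)%N -> (size (r`_j)%R <= n j)%N).
    move=> size_r; split=> [/(weight_leqP _ q_gt1 _ size_r) w0 j lt_j|size_rj].
      apply/leq_sizeP => i le_i; apply: w0 => //.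
      by move: le_i; rewrite /n; case: j {lt_j} => [|j] /=; nia.
    apply/(weight_leqP _ q_gt1 _ size_r) => i j lt_j lt_w.
    have /leq_sizeP := size_rj j lt_j; apply.
    by move: lt_w lt_j; rewrite /n; case: j => [|j] /=; nia.
  move=> z; split=> [[int_z vz]|[r size_r [-> /(small r size_r) w_r]]].
    have [r size_r er] := integral_closure p_prime card_k e_gt0 q_def q_gt1 sizeF
      sigmaE K_gen y_eq int_z.
    exists r => //; split=> //; apply/(small r size_r).
    have [->|r0] := eqVneq r 0; first by rewrite rmorph0 size_poly0.
    have gr := good_normal q_gt1 sizeF sigmaE size_r r0.
    have z0 : z != 0 by rewrite er (ev_good_neq0 q_gt1 sizeF sigmaE y_eq gr).
    have := vgeE z0 vz; rewrite er iP // lerN2 lez_nat /weight => le_w.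
    by rewrite (leq_trans (leqSpred _)).
  split=> [P fP|]; first exact: (finite_vge_ev p_prime e_gt0 q_def y_eq _ fP).
  have := infty_vge_weighted iP size_r w_r; apply: vgeW.
  by move: (q * N)%N; clear; lia.
- move=> z; split=> [->|[r size_r [-> r0]]].
    by exists 0; rewrite ?size_poly0 // ev0; split=> // j _; rewrite coef0.
  suff -> : r = 0 by rewrite ev0.
  apply/polyP => j; rewrite coef0; case: (ltnP j q) => [/r0 //|le_j].
  by rewrite nth_default // (leq_trans size_r).
- move=> j; split=> [|a b sa sb|c a sa]; first by rewrite size_poly0.
    by apply: leq_trans (size_polyD _ _) _; rewrite geq_max sa.
  exact: leq_trans (size_scale_leq _ _) sa.
- by move=> j; split=> // [a b -> ->|c a ->]; rewrite ?addr0 ?scaler0.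
- move=> j lt_j; split=> // [a ->|i lt_i|a sa].
  + by rewrite size_poly0.
  + by rewrite size_polyXn.
  + by exists a; rewrite ?subrr.
Qed.

Theorem artin_schreier_genus : is_genus K (d1 * 'C(q, 2)).
Proof.
have [Pinf iP] := infty_place_exists q_gt1 sizeF sigmaE K_gen y_eq.
have finP P : P != Pinf -> finite_place P.
  move=> neqP; apply: contrapT => nfP; case/eqP: neqP.
  apply: (infty_place_uniq q_gt1 sizeF sigmaE K_gen y_eq) => //.
  exact: (infty_placeP q_gt1 sizeF sigmaE K_gen y_eq).
have nfin := infty_not_finite iP.
have deg_inf := infty_place_degree iP.
have rrN N : forall z, rr_space (fun P => if P == Pinf then (q * N)%N%:Z else 0) z <->
    (forall P, finite_place P -> vge P 0 z) /\ vge Pinf (- (q * N)%N%:Z) z.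
  move=> z; split=> [vz|[int_z vz] P].
    split=> [P fP|]; last by have := vz Pinf; rewrite eqxx.
    by have := vz P; case: eqP => [eP|_]; [case: nfin; rewrite -eP | rewrite oppr0].
  by case: eqP => [->//|/eqP /finP fP]; rewrite oppr0; apply: int_z.
split=> [D finD|]; last first.
  (* N = d1 q is the least value that [infty_space_dim] admits, and it already attains the genus. *)
  pose D P := if P == Pinf then (q * (d1 * q))%N%:Z else 0 : int.
  have D0 P : P \notin [:: Pinf] -> D P = 0 by rewrite inE /D => /negPf ->.
  exists D.
    apply: (sub_finite_set (B := [set` [:: Pinf]])); last exact: finite_seq.
    by move=> P /= DP; rewrite -[_ \in _]negbK; apply: contra DP => /D0 ->.
  rewrite (divisor_degreeE (T := [:: Pinf])) // big_seq1 deg_inf mulr1n /D eqxx.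
  have [n en hn] := infty_space_dim iP (leqnn (d1 * q)).
  rewrite (@ellE _ _ _ n); last first.
    by apply: has_quotient_dim_ext hn => // z; apply: rrN.
  by move: en; move: (q * _)%N (d1 * 'C(q, 2))%N; clear; lia.
have [T0 suppD] := (finite_seqP _).1 finD.
have D0 P : P \notin T0 -> D P = 0.
  move=> PT; apply/eqP; rewrite -[_ == _]negbK; apply/negP => DP.
  have : [set P | D P != 0]%classic P by [].
  by rewrite suppD /= => PT'; rewrite PT' in PT.
have /choice[g gP] P : exists g : {poly k}, g != 0 /\ (finite_place P -> 0 < P (in_funfield K g)).
  have [fP|nfP] := pselect (finite_place P); last by exists 1; rewrite oner_neq0.
  have [g gI Pg] := finite_center p_prime e_gt0 q_def K_gen y_eq fP.
  by exists g; rewrite monic_neq0 // (snd gI).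
(* As [g P] vanishes at a finite place P, f vanishes there to order at least |D P|. *)
pose f := \prod_(P <- T0) g P ^+ `|D P|.
have f0 : f != 0.
  by rewrite prodf_seq_neq0; apply/allP => P _ /=; rewrite expf_neq0 // (gP P).1.
have val_ge0 P a : finite_place P -> 0 <= P (in_funfield K a).
  by move=> fP; rewrite -(evC y); apply: (valuation_ev_ge0 p_prime e_gt0 q_def y_eq).
have if0 : in_funfield K f != 0 by rewrite in_funfield_eq0.
have leDf P : finite_place P -> `|D P|%N%:Z <= P (in_funfield K f).
  move=> fP; have [PT|/D0 ->] := boolP (P \in T0); last by rewrite absz0; apply: val_ge0.
  have ef : f = g P ^+ `|D P| * \prod_(Q <- rem P T0) g Q ^+ `|D Q|.
    by rewrite /f (big_rem P).
  have rest0 : \prod_(Q <- rem P T0) g Q ^+ `|D Q| != 0.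
    by apply: contraNneq f0 => r0; rewrite ef r0 mulr0.
  rewrite ef in_funfieldM valuationM ?in_funfield_eq0 ?expf_neq0 ?(gP P).1 //.
  rewrite in_funfieldXn valuationX ?in_funfield_eq0 ?(gP P).1 // mulrn_int.
  have := val_ge0 P (\prod_(Q <- rem P T0) g Q ^+ `|D Q|) fP.
  have := (gP P).2 fP.
  move: (P _) (P (in_funfield K (g P))) (D P); clear; nia.
have [Z uZ ZP] := zeros_finite p_prime card_k e_gt0 q_def q_gt1 K_gen y_eq f0.
have degZ := zeros_degree p_prime card_k e_gt0 q_def q_gt1 sizeF sigmaE K_gen y_eq f0 uZ ZP.
(* The first summand makes D' dominate D at infinity, the second meets the bound of
   [infty_space_dim]. *)
pose N := (`|D Pinf| + d1 * q)%N.
(* D' = (f)_0 + q N oo, and rr_space D' = f^-1 L(q (N + deg f) oo) *)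
pose D' P := if P == Pinf then (q * N)%N%:Z else P (in_funfield K f).
pose T := Pinf :: Z.
have uT : uniq T.
  by rewrite /= uZ andbT; apply/negP => /ZP[fP _]; apply: nfin.
have D'0 P : P \notin T -> D' P = 0.
  rewrite inE negb_or /D' => /andP[neqP nZ]; rewrite (negPf neqP).
  apply/eqP; rewrite eq_le (val_ge0 _ _ (finP _ neqP)) andbT leNgt; apply/negP => Pf.
  by case/negP: nZ; apply/ZP; split; first exact: finP.
have leDD' P : D P <= D' P.
  rewrite /D'; case: eqP => [->|/eqP /finP fP]; last first.
    by apply: le_trans (leDf _ fP); move: (D P); clear; lia.
  by rewrite /N; move: (D Pinf) q q_gt1; clear; nia.
have suppT P : P \notin T -> D P = 0.
  move=> PT; have := D'0 P PT; move: PT; rewrite inE negb_or => /andP[neqP _].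
  have := leDf _ (finP _ neqP); rewrite /D' (negPf neqP) => + Pf; rewrite Pf.
  by move: (D P); clear; lia.
pose N' := (N + (size f).-1)%N.
have le_N' : (d1 * q <= N')%N by rewrite /N' /N addnAC leq_addl.
have [n' en' hn'] := infty_space_dim iP le_N'.
have hD' : has_quotient_dim (rr_space D') (fun z => z = 0) n'.
  apply: (has_quotient_dim_scale (z := (in_funfield K f)^-1)) hn'.
  - by rewrite invr_eq0.
  - have shift P m z : vge P (- m) z <-> vge P (P (in_funfield K f) - m) (z / (in_funfield K f)^-1).
      rewrite invrK; split=> [vz|vz].
        by rewrite addrC; apply: vgeM vz (vge_refl _ _).
      by have := vge_mulIf if0 vz; rewrite addrAC subrr add0r.
    have Pf_inf := infty_valuation_poly iP f0.
    move=> z; split=> [vz|[int_z vz] P].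
      split=> [P fP|].
        have neqP : P != Pinf by apply/eqP => eP; apply: nfin; rewrite -eP.
        by have := vz P; rewrite /D' (negPf neqP) shift subrr.
      have := vz Pinf; rewrite /D' eqxx shift Pf_inf; congr vge.
      by rewrite /N' mulnDr; move: (q * N)%N (q * _)%N; clear; lia.
    rewrite shift /D'; case: eqP => [->|/eqP /finP fP]; last by rewrite subrr; apply: int_z.
    move: vz; rewrite Pf_inf; congr vge.
    by rewrite /N' mulnDr; move: (q * N)%N (q * _)%N; clear; lia.
  - move=> z; split=> [->|]; first by rewrite mul0r.
    by move/eqP; rewrite mulf_eq0 !invr_eq0 (negPf if0) orbF => /eqP.
have [|n hn le_n'] := rr_space_mono degree_dim uT leDD' _ hD'.
  by move=> P PT; rewrite D'0 // suppT.
rewrite (divisor_degreeE uT suppT) (ellE hn).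
set s := (\sum_(P <- T) `|D' P - D P| * place_degree P)%N in le_n'.
(* deg D' = q N + q deg f = q N', where [zeros_degree] gives the second summand. *)
have sumD : \sum_(P <- T) D P *+ place_degree P + s%:Z = (q * N')%N%:Z.
  rewrite /s (big_morph Posz PoszD (erefl _)) -big_split /=.
  have -> : \sum_(P <- T) (D P *+ place_degree P + (`|D' P - D P| * place_degree P)%N%:Z) =
      \sum_(P <- T) D' P *+ place_degree P.
    apply: eq_bigr => P _; rewrite !mulrn_int PoszM gez0_abs ?subr_ge0 //.
    by rewrite -mulrDl; congr (_ * _); move: (D P) (D' P); clear; lia.
  rewrite big_cons {1}/D' eqxx deg_inf mulr1n /N' mulnDr PoszD -degZ.
  congr (_ + _); rewrite (big_morph Posz PoszD (erefl _)) big_seq [RHS]big_seq.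
  apply: eq_bigr => P PZ; have [fP Pf] := (ZP P).1 PZ.
  have neqP : P != Pinf by apply/eqP => eP; apply: nfin; rewrite -eP.
  by rewrite /D' (negPf neqP) mulrn_int PoszM gez0_abs // ltW.
move: sumD en' le_n'; move: (\sum_(P <- T) _) s (q * N')%N (d1 * _)%N; clear; lia.
Qed.

End Genus.

(** * The trace form and the number of points *)

(** The fibres of f on D are the cosets of its kernel. *)
Lemma card_additive_image (V W : finZmodType) (f : V -> W) (D : {set V}) :
  {morph f : x z / x - z} -> (forall x z, x \in D -> z \in D -> x - z \in D) ->
  #|D| = (#|f @: D| * #|[set x in D | f x == 0%R]|)%N.
Proof.
move=> fB DB; rewrite -sum1_card.
rewrite (partition_big f (mem (f @: D))) => [|x xD]; last exact: imset_f.
rewrite -sum_nat_const; apply: eq_bigr => _ /imsetP[z zD ->].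
rewrite sum1_card -[RHS](card_imset _ (@addrI _ z)).
have D0 : 0 \in D by rewrite -(subrr z); apply: DB.
have f0 : f 0 = 0 by rewrite -(subrr 0) fB subrr.
apply: eq_card => x; rewrite -[LHS]/((x \in D) && (f x == f z)).
apply/andP/imsetP => [[xD /eqP fx]|[u]].
  exists (x - z); last by rewrite addrC subrK.
  by rewrite inE DB // fB fx subrr eqxx.
rewrite inE => /andP[uD /eqP fu] ->.
have fN : f (- u) = 0 by rewrite -sub0r fB f0 fu subrr.
have uD' : - u \in D by rewrite -sub0r DB.
by rewrite -[u]opprK DB // fB fN subr0.
Qed.

Lemma card_pairs (T U : finType) (C : T -> U -> bool) :
  #|[pred u : T * U | C u.1 u.2]| = (\sum_(x : T) #|[pred z | C x z]|)%N.
Proof.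
rewrite -sum1_card; under [RHS]eq_bigr do rewrite -sum1_card.
by rewrite (pair_big_dep xpredT C (fun _ _ => 1%N)).
Qed.

Lemma card_roots_lt (k : finFieldType) (f : {poly k}) :
  f != 0 -> (#|[pred x | root f x]| < size f)%N.
Proof.
move=> f0; rewrite cardE; apply: max_poly_roots => //; last exact: enum_uniq.
by apply/allP => x; rewrite mem_enum.
Qed.

(* Here [a] = q - 1, [R] = q^(n - 2), [w] is the size of the radical and [Z] the
   number of zeros of Q; [N] and [S] are the sums of the sizes, and of their
   squares, of the a other level sets of Q. *)
Lemma extremal_radical_arith (a R w X Z N S : nat) :
  (0 < a)%N -> (0 < R)%N -> (X + w = a.+1 * (a.+1 * R))%N ->
  (Z = a.+1 * R + a * R)%N -> (Z + N = a.+1 * (a.+1 * R))%N ->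
  (2 * (R * a * N) <= S + a * (R * a) ^ 2)%N ->
  (Z ^ 2 + S = w * (a.+1 * (a.+1 * R)) + X * (a.+1 * R))%N -> (R <= w)%N.
Proof.
move=> a0 R0 eX eZ eN le_S eS.
(* The a other levels thus have mean size R a, the number inserted in the bound [le_S]. *)
have eN' : N = (a * a * R)%N by lia.
have eX' : (X * (a.+1 * R) + w * (a.+1 * R) = a.+1 * (a.+1 * R) * (a.+1 * R))%N.
  by rewrite -mulnDl eX.
have : (R * (R * (a * a.+1)) <= w * (R * (a * a.+1)))%N.
  subst Z N; lia.
by rewrite leq_pmul2r // !muln_gt0 a0 R0.
Qed.

(** * The trace of k over F_q and Hilbert 90 *)

Section Trace.
Variables (k : finFieldType) (p e q n : nat).
Hypothesis p_prime : prime p.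
Hypothesis e_gt0 : (0 < e)%N.
Hypothesis q_def : q = (p ^ e)%N.
Hypothesis n_gt0 : (0 < n)%N.
Hypothesis card_k : #|k| = (q ^ n)%N.
Implicit Types (x z a c : k).

Lemma q_gt1 : (1 < q)%N.
Proof. by rewrite q_def -(expn0 p) ltn_exp2l // prime_gt1. Qed.

Let q_gt0 : (0 < q)%N. Proof. exact: ltnW q_gt1. Qed.

Lemma pchar_k : p \in [pchar k].
Proof. by apply: (@card_finPcharP _ p (e * n)%N); rewrite // card_k q_def expnM. Qed.

Lemma qpow_pchar i : [pchar k].-nat (q ^ i)%N.
Proof. by rewrite q_def !pnatX pnatE ?pchar_k. Qed.

Lemma qpowD i x z : (x + z) ^+ (q ^ i) = x ^+ (q ^ i) + z ^+ (q ^ i).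
Proof. exact/exprDn_pchar/qpow_pchar. Qed.

Lemma qpowN i x : (- x) ^+ (q ^ i) = - x ^+ (q ^ i).
Proof. exact/exprNn_pchar/qpow_pchar. Qed.

Lemma qpowB i x z : (x - z) ^+ (q ^ i) = x ^+ (q ^ i) - z ^+ (q ^ i).
Proof. by rewrite qpowD qpowN. Qed.

Lemma qpow0 i : (0 : k) ^+ (q ^ i) = 0.
Proof. by rewrite expr0n gtn_eqF // expn_gt0 q_gt0. Qed.

Lemma qpow_sum i (I : Type) (r : seq I) (P : pred I) (f : I -> k) :
  (\sum_(j <- r | P j) f j) ^+ (q ^ i) = \sum_(j <- r | P j) f j ^+ (q ^ i).
Proof. exact: (big_morph (fun x => x ^+ (q ^ i)) (qpowD i) (qpow0 i)). Qed.

Lemma qpow_comp i j x : (x ^+ (q ^ i)) ^+ (q ^ j) = x ^+ (q ^ (i + j)).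
Proof. by rewrite -exprM -expnD. Qed.

Lemma qpow_n x : x ^+ (q ^ n) = x.
Proof. by rewrite -card_k expf_card. Qed.

Lemma qpow_mod i x : x ^+ (q ^ (n + i)) = x ^+ (q ^ i).
Proof. by rewrite -qpow_comp qpow_n. Qed.

Lemma qpow_inj i : injective (fun x => x ^+ (q ^ i)).
Proof.
move=> x z /= exz; apply/eqP; rewrite -subr_eq0; have := congr1 (fun t => t - z ^+ (q ^ i)) exz.
by rewrite -qpowB subrr => /eqP; rewrite expf_eq0 => /andP[].
Qed.

Lemma qpow_surj i x : exists z, z ^+ (q ^ i) = x.
Proof. by exists (invF (@qpow_inj i) x); rewrite -{2}(f_invF (@qpow_inj i) x). Qed.

Definition Fq := [set c : k | c ^+ q == c].

Lemma Fq_qpow c i : c \in Fq -> c ^+ (q ^ i) = c.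
Proof.
rewrite inE => /eqP cq; elim: i => [|i IH]; first by rewrite expn0 expr1.
by rewrite expnS exprM cq.
Qed.

Lemma FqB c a : c \in Fq -> a \in Fq -> c - a \in Fq.
Proof.
by rewrite !inE => /eqP cq /eqP aq; rewrite -[q]expn1 qpowB expn1 cq aq.
Qed.

Lemma FqM c a : c \in Fq -> a \in Fq -> c * a \in Fq.
Proof. by rewrite !inE => /eqP cq /eqP aq; rewrite exprMn cq aq. Qed.

Lemma FqV c : c \in Fq -> c^-1 \in Fq.
Proof. by rewrite !inE => /eqP cq; rewrite exprVn cq. Qed.

Lemma Fq0 : 0 \in Fq.
Proof. by rewrite inE -[q]expn1 qpow0. Qed.

Lemma Fq1 : 1 \in Fq.
Proof. by rewrite inE expr1n. Qed.

Lemma FqN c : c \in Fq -> - c \in Fq.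
Proof. by move=> cF; rewrite -sub0r FqB ?Fq0. Qed.

Definition Tr x := \sum_(i < n) x ^+ (q ^ i).

Lemma TrD x z : Tr (x + z) = Tr x + Tr z.
Proof. by rewrite /Tr -big_split; apply: eq_bigr => i _; rewrite qpowD. Qed.

Lemma TrN x : Tr (- x) = - Tr x.
Proof. by rewrite /Tr -sumrN; apply: eq_bigr => i _; rewrite qpowN. Qed.

Lemma TrB x z : Tr (x - z) = Tr x - Tr z.
Proof. by rewrite TrD TrN. Qed.

Lemma Tr0 : Tr 0 = 0.
Proof. by rewrite -{1}(subrr 0) TrB subrr. Qed.

Lemma Tr_sum (I : Type) (r : seq I) (P : pred I) (f : I -> k) :
  Tr (\sum_(j <- r | P j) f j) = \sum_(j <- r | P j) Tr (f j).
Proof. exact: (big_morph Tr TrD Tr0). Qed.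

Lemma Tr_qpow1 x : Tr (x ^+ q) = Tr x.
Proof.
rewrite /Tr -(prednK n_gt0) big_ord_recr [RHS]big_ord_recl /= addrC; congr (_ + _).
  by rewrite -exprM -expnS prednK // qpow_n expn0 expr1.
by apply: eq_bigr => i _; rewrite -exprM -expnS.
Qed.

Lemma Tr_qpow i x : Tr (x ^+ (q ^ i)) = Tr x.
Proof. by elim: i => [|i IH]; rewrite ?expn0 ?expr1 // expnSr exprM Tr_qpow1. Qed.

Lemma TrZ c x : c \in Fq -> Tr (c * x) = c * Tr x.
Proof.
move=> cF; rewrite /Tr mulr_sumr; apply: eq_bigr => i _.
by rewrite exprMn (Fq_qpow i cF).
Qed.

Lemma Tr_Fq x : Tr x \in Fq.
Proof.
rewrite inE; apply/eqP; rewrite -[RHS](Tr_qpow1 x) -{1}[q]expn1 qpow_sum expn1.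
by apply: eq_bigr => i _; rewrite -!exprM mulnC.
Qed.

Definition ker_Tr := [set x | Tr x == 0].

Definition orthogonal a := [set x | Tr (x * a) == 0].

Lemma card_ker_Tr_le : (#|ker_Tr| <= q ^ n.-1)%N.
Proof.
pose f : {poly k} := \sum_(i < n) 'X^(q ^ i).
have size_f : size f = (q ^ n.-1).+1.
  rewrite /f -(prednK n_gt0) big_ord_recr /= addrC size_polyDl size_polyXn //.
  rewrite ltnS; apply: leq_trans (size_sum _ _ _) _; apply/bigmax_leqP => i _.
  by rewrite size_polyXn ltn_exp2l ?q_gt1.
have f0 : f != 0 by rewrite -size_poly_eq0 size_f.
have := card_roots_lt f0; rewrite size_f ltnS; congr (_ <= _)%N.
apply: eq_card => x; rewrite !inE /root /f horner_sum.
by congr (_ == _); apply: eq_bigr => i _; rewrite hornerXn.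
Qed.

Lemma card_Fq_le : (#|Fq| <= q)%N.
Proof.
pose f : {poly k} := 'X^q - 'X.
have size_f : size f = q.+1.
  by rewrite /f size_polyDl size_polyXn // size_polyN size_polyX ltnS q_gt1.
have f0 : f != 0 by rewrite -size_poly_eq0 size_f.
have := card_roots_lt f0; rewrite size_f ltnS; congr (_ <= _)%N.
by apply: eq_card => x; rewrite !inE /root /f !hornerE subr_eq0.
Qed.

Let artin x := x ^+ q - x.

Let artinB : {morph artin : x z / x - z}.
Proof. by move=> x z; rewrite /artin -[q]expn1 qpowB; ring. Qed.

Let card_artin : (q ^ n = #|artin @: [set: k]| * #|Fq|)%N.
Proof.
rewrite -card_k -cardsT (card_additive_image (D := [set: k]) artinB); last first.
  by move=> x z; rewrite !inE.
congr (_ * _)%N; apply: eq_card => x; rewrite !inE /artin subr_eq0 //.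
Qed.

Let artin_sub : artin @: [set: k] \subset ker_Tr.
Proof. by apply/fintype.subsetP => _ /imsetP[x _ ->]; rewrite inE TrB Tr_qpow1 subrr. Qed.

(** The image of x^q - x lies in the kernel of the trace, so q^n is at most #|ker_Tr| #|Fq|, and
    counting roots bounds this by q^(n - 1) q. All these are equalities; equality of image and
    kernel is Hilbert 90. *)
Lemma card_Fq : #|Fq| = q.
Proof.
apply/eqP; rewrite eqn_leq card_Fq_le -(leq_pmul2l (m := q ^ n.-1)) ?expn_gt0 ?q_gt0 //.
rewrite -expnSr prednK // card_artin leq_mul2r.
by rewrite (leq_trans (subset_leq_card artin_sub) card_ker_Tr_le) orbT.
Qed.

Let card_artin_image : #|artin @: [set: k]| = (q ^ n.-1)%N.
Proof.
apply/eqP; rewrite -(eqn_pmul2r q_gt0) -{1}card_Fq -card_artin.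
by rewrite -expnSr prednK.
Qed.

Lemma card_ker_Tr : #|ker_Tr| = (q ^ n.-1)%N.
Proof.
apply/eqP; rewrite eqn_leq card_ker_Tr_le -card_artin_image.
exact: subset_leq_card artin_sub.
Qed.

Lemma hilbert90 x : Tr x = 0 -> exists z, z ^+ q - z = x.
Proof.
move=> /eqP Trx; have : x \in ker_Tr by rewrite inE.
have /eqP <- : artin @: [set: k] == ker_Tr.
  by rewrite eqEcard artin_sub card_ker_Tr card_artin_image /=.
by case/imsetP => z _ ->; exists z.
Qed.

Lemma card_artin_fiber x :
  #|[pred z | z ^+ q - z == x]| = if Tr x == 0 then q else 0%N.
Proof.
case: eqP => [/hilbert90[z <-]|Trx].
  rewrite -[RHS]card_Fq -[RHS](card_imset _ (@addrI _ z)); apply: eq_card => u.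
  rewrite inE; apply/eqP/imsetP => [eu|[c cF ->]].
    exists (u - z); last by rewrite addrC subrK.
    by have := artinB u z; rewrite inE /artin eu subrr => /eqP; rewrite subr_eq0.
  rewrite -[q]expn1 qpowD expn1; move: cF; rewrite inE => /eqP ->.
  by rewrite opprD addrACA subrr addr0.
apply: eq_card0 => z; rewrite !inE; apply/negP => /eqP ez.
by apply: Trx; rewrite -ez TrB Tr_qpow1 subrr.
Qed.

Lemma card_orthogonal a : a != 0 -> #|orthogonal a| = (q ^ n.-1)%N.
Proof.
move=> a0; rewrite -card_ker_Tr -[LHS](card_imset _ (mulIf a0)); apply: eq_card => x.
apply/imsetP/idP => [[z]|]; rewrite !inE; first by move=> Trz ->.
by move=> Trx; exists (x / a); rewrite ?inE divfK.
Qed.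

Lemma Tr_nondegenerate a : (forall x, Tr (x * a) = 0) -> a = 0.
Proof.
move=> Tra; apply/eqP; apply: contrapT => /negP a0; have := card_orthogonal a0.
have -> : orthogonal a = [set: k] by apply/finset.setP => x; rewrite !inE Tra eqxx.
rewrite cardsT card_k => /eqP; rewrite eqn_exp2l ?q_gt1 // => /eqP e1.
by move: e1 n_gt0; clear; lia.
Qed.

Lemma qpoly_neq0_card (f : {poly k}) t : (forall x, root f x) -> (size f <= (q ^ t).+1)%N ->
  (t < n)%N -> f = 0.
Proof.
move=> rootf size_f lt_t; apply/eqP; apply: contrapT => /negP f0.
have := card_roots_lt f0; rewrite (eq_card (B := predT)); last by move=> x; rewrite !inE rootf.
rewrite card_k ltnNge => /negP; apply; apply: leq_trans size_f _.
by rewrite ltn_exp2l ?q_gt1.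
Qed.

(** A polynomial of degree at most q^(n - 1) < #|k| that vanishes on k is zero, and its exponents
    q^i are distinct. *)
Lemma qpoly_coef_eq0 (c : nat -> k) :
  (forall x, \sum_(i < n) c i * x ^+ (q ^ i) = 0) -> forall i, (i < n)%N -> c i = 0.
Proof.
move=> c0 i lt_i; pose f : {poly k} := \sum_(i < n) c i *: 'X^(q ^ i).
have f0 : f = 0.
  apply: (@qpoly_neq0_card _ n.-1); last by rewrite prednK.
    move=> x; rewrite /root /f horner_sum; apply/eqP; rewrite -[RHS](c0 x).
    by apply: eq_bigr => j _; rewrite hornerZ hornerXn.
  apply: leq_trans (size_sum _ _ _) _; apply/bigmax_leqP => j _.
  apply: leq_trans (size_scale_leq _ _) _; rewrite size_polyXn ltnS leq_exp2l ?q_gt1 //.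
  by rewrite -ltnS prednK.
have := congr1 (fun g : {poly k} => g`_(q ^ i)) f0.
rewrite coef0 coef_sum (bigD1 (Ordinal lt_i)) //= big1 => [|j neq_j].
  by rewrite coefZ coefXn eqxx mulr1 addr0.
rewrite coefZ coefXn eqn_exp2l ?q_gt1 // (_ : (i == j) = false) ?mulr0 //.
by apply/negP => /eqP ij; case/eqP: neq_j; apply: val_inj.
Qed.

(** * Quadratic forms Tr (x L(x)) and their radicals *)

Section QuadraticForm.
Variables (N : nat) (mu : nat -> k).
Hypothesis le_N : (N <= n.+1)%N.

Definition qlin x := \sum_(j < N) mu j * x ^+ (q ^ j).

Definition quad x := Tr (x * qlin x).

Definition polar x z := Tr (x * qlin z + z * qlin x).

(** Represents the polar form of x as z -> Tr (z * adjoint x): under the trace, the power q^(n - j)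
    brings z^(q^j) back to z. *)
Definition adjoint x := \sum_(j < N) (mu j * x ^+ (q ^ j) + (mu j * x) ^+ (q ^ (n - j))).

Lemma qlinD x z : qlin (x + z) = qlin x + qlin z.
Proof. by rewrite /qlin -big_split; apply: eq_bigr => j _; rewrite qpowD mulrDr. Qed.

Lemma qlinZ c x : c \in Fq -> qlin (c * x) = c * qlin x.
Proof.
move=> cF; rewrite /qlin mulr_sumr; apply: eq_bigr => j _.
by rewrite exprMn (Fq_qpow _ cF) mulrCA.
Qed.

Lemma quadD x z : quad (x + z) = quad x + quad z + polar x z.
Proof. by rewrite /quad /polar -!TrD qlinD; congr Tr; ring. Qed.

Lemma quadZ c x : c \in Fq -> quad (c * x) = c ^+ 2 * quad x.
Proof.
move=> cF; rewrite /quad (qlinZ _ cF) -TrZ; last by rewrite expr2 FqM.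
by congr Tr; ring.
Qed.

Lemma polarC x z : polar x z = polar z x.
Proof. by rewrite /polar addrC. Qed.

Lemma polar_diag x : polar x x = 2%:R * quad x.
Proof. by rewrite /polar TrD mulr_natl mulr2n. Qed.

Lemma polarE x z : polar x z = Tr (z * adjoint x).
Proof.
rewrite /polar /adjoint big_split /= mulrDr !TrD addrC; congr (_ + _).
rewrite /qlin !mulr_sumr !Tr_sum; apply: eq_bigr => j _.
rewrite -(Tr_qpow (n - j) (x * _)) !exprMn qpow_comp subnKC; last first.
  by rewrite -ltnS (leq_trans (ltn_ord j)).
by rewrite qpow_n; congr Tr; ring.
Qed.

Lemma polarDl x1 x2 z : polar (x1 + x2) z = polar x1 z + polar x2 z.
Proof. by rewrite /polar qlinD -TrD; congr Tr; ring. Qed.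

Lemma polarDr x z1 z2 : polar x (z1 + z2) = polar x z1 + polar x z2.
Proof. by rewrite ![polar x _]polarC polarDl. Qed.

Lemma polarZl c x z : c \in Fq -> polar (c * x) z = c * polar x z.
Proof. by move=> cF; rewrite /polar (qlinZ _ cF) -TrZ //; congr Tr; ring. Qed.

Lemma polarZr c x z : c \in Fq -> polar x (c * z) = c * polar x z.
Proof. by move=> cF; rewrite ![polar x _]polarC polarZl. Qed.

Lemma polarBl x1 x2 z : polar (x1 - x2) z = polar x1 z - polar x2 z.
Proof. by rewrite polarDl -mulN1r polarZl ?mulN1r // FqN ?Fq1. Qed.

Lemma adjoint_polar x : (forall z, polar x z = 0) <-> adjoint x = 0.
Proof.
split=> [xz0|x0 z]; last by rewrite polarE x0 mulr0 Tr0.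
by apply: Tr_nondegenerate => z; rewrite -polarE.
Qed.

Lemma quad_eq0_adjoint x : (forall z, quad z = 0) -> adjoint x = 0.
Proof.
move=> Q0; apply/adjoint_polar => z.
by have := quadD x z; rewrite !Q0 !add0r => <-.
Qed.

Definition radical := [set x | adjoint x == 0].

Lemma radicalP x : reflect (forall z, polar x z = 0) (x \in radical).
Proof. by rewrite inE; apply: (iffP eqP) => /adjoint_polar. Qed.

Lemma radicalB x z : x \in radical -> z \in radical -> x - z \in radical.
Proof. by move=> /radicalP xR /radicalP zR; apply/radicalP => u; rewrite polarBl xR zR subrr. Qed.

Lemma radicalZ c x : c \in Fq -> x \in radical -> c * x \in radical.
Proof. by move=> cF /radicalP xR; apply/radicalP => z; rewrite polarZl // xR mulr0. Qed.

End QuadraticForm.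

Lemma card_span (D : {set k}) x0 :
  (forall x z, x \in D -> z \in D -> x - z \in D) ->
  (forall c x, c \in Fq -> x \in D -> c * x \in D) -> x0 \notin D ->
  {in finset.setX Fq D &, injective (fun u : k * k => u.2 + u.1 * x0)}.
Proof.
move=> DB DZ x0D [c x] [a z] /finset.setXP[cF xD] /finset.setXP[aF zD] /= exz.
have caF : c - a \in Fq by exact: FqB.
have cx0 : c * x0 = z + a * x0 - x by rewrite -exz addrAC subrr add0r.
have e1 : (c - a) * x0 = z - x by rewrite mulrBl cx0; ring.
have [ca0|ca0] := eqVneq (c - a) 0.
  move: e1; rewrite ca0 mul0r => /esym/eqP; rewrite subr_eq0 => /eqP ->.
  by move/eqP: ca0; rewrite subr_eq0 => /eqP ->.
case/negP: x0D; rewrite -[x0](mulKf ca0) e1; apply: DZ; first exact: FqV.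
exact: DB.
Qed.

(** * The form of the curve and its zeros *)

Section Curve.
Variables (m : nat) (s : nat -> k).
Hypothesis m_ge2 : (2 <= m)%N.
Hypothesis n_def : n = (2 * m)%N.
Hypothesis two_neq0 : 2%:R != 0 :> k.

Let le_mn : (m <= n.+1)%N. Proof. by rewrite n_def; clear -m_ge2; lia. Qed.
Let le_m1n : (m.+1 <= n.+1)%N. Proof. by rewrite n_def; clear -m_ge2; lia. Qed.

(** As x^(q^n) = x, the power q^t wraps the large exponents n - j around to t - j, which leaves a
    q-polynomial of low degree. *)
Lemma adjoint_shift N (mu : nat -> k) t x : (N <= t.+1)%N -> (t <= n)%N ->
  adjoint N mu x ^+ (q ^ t) =
  \sum_(j < N) (mu j ^+ (q ^ t) * x ^+ (q ^ (t + j))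
                + mu j ^+ (q ^ (t - j)) * x ^+ (q ^ (t - j))).
Proof.
move=> le_N le_t; rewrite qpow_sum; apply: eq_bigr => j _; rewrite qpowD; congr (_ + _).
  by rewrite exprMn qpow_comp addnC.
have le_j : (j <= t)%N by rewrite -ltnS (leq_trans (ltn_ord j)).
rewrite qpow_comp (_ : (n - j + t = n + (t - j))%N) ?qpow_mod ?exprMn //.
by rewrite addnBA // addnBAC // (leq_trans le_j).
Qed.

(** For j = m = n / 2 the element w^(1 + q^m) is fixed by the power q^m, so the form depends on mu m
    only through mu m + (mu m)^(q^m). All conditions are read off the adjoint, a q-polynomial that
    vanishes on k. *)
Lemma quad_eq0 (mu : nat -> k) :
  (forall x, quad m.+1 mu x = 0) <->
  (forall j, (j < m)%N -> mu j = 0) /\ mu m + mu m ^+ (q ^ m) = 0.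
Proof.
split=> [Q0|[mu0 mum] x]; last first.
  rewrite /quad /qlin big_ord_recr /= big1 ?add0r => [|j _]; last by rewrite mu0 ?mul0r.
  set w := (X in Tr X); have ew : w ^+ (q ^ m) = - w.
    rewrite /w !exprMn qpow_comp addnn -mul2n -n_def qpow_n.
    by have /eqP := mum; rewrite addrC addr_eq0 => /eqP ->; ring.
  have := Tr_qpow m w; rewrite ew TrN => /eqP; rewrite eq_sym -addr_eq0 -mulr2n -mulr_natl.
  by rewrite mulf_eq0 (negPf two_neq0) => /eqP.
have m_gt0 : (0 < m)%N by exact: ltnW.
have adj0 x : adjoint m.+1 mu x = 0 by apply: quad_eq0_adjoint.
(* The coefficient of x^(q^i) in the q^m-th power of the adjoint, with q^(2m) wrapped to q^0: the
   two terms of j = m meet at i = 0, those of j = 0 at i = m. *)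
pose c i := if i == 0%N then mu m + mu m ^+ (q ^ m)
  else if (i < m)%N then mu (m - i)%N ^+ (q ^ i)
  else if i == m then 2%:R * mu 0%N ^+ (q ^ m) else mu (i - m)%N ^+ (q ^ m).
have c0 : forall i, (i < n)%N -> c i = 0.
  apply: qpoly_coef_eq0 => x.
  transitivity (adjoint m.+1 mu x ^+ (q ^ m)); last by rewrite adj0 qpow0.
  rewrite adjoint_shift //.
  rewrite big_split /= [X in _ = _ + X](reindex_inj rev_ord_inj) /=.
  under [X in _ = _ + X]eq_bigr => j _ do
    rewrite subSS (subKn (leq_ord j)).
  rewrite n_def mul2n -addnn big_split_ord /= big_ord_recr [X in _ = _ + X]big_ord_recr /=.
  rewrite subnn addnn -mul2n -n_def qpow_n.
  case: (m) m_gt0 @c => // m' _ c.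
  rewrite !big_ord_recl /= subn0 addn0 expn0 !expr1.
  have -> : c 0%N = mu m'.+1 + mu m'.+1 ^+ (q ^ m'.+1) by [].
  have -> : c m'.+1 = 2%:R * mu 0%N ^+ (q ^ m'.+1) by rewrite /c /= ltnn eqxx.
  under eq_bigr => j _ do rewrite /c /= ltnS /bump /= add1n ltn_ord.
  under [X in _ + (_ + X)]eq_bigr => j _.
    rewrite /c /bump /= add1n ltnNge ltnS leq_addr /= -[X in _ == X]addn0 eqn_add2l /= addKn.
    over.
  ring.
have mu0 : forall j, (j < m)%N -> mu j = 0.
  move=> j lt_j; have := c0 (m + j)%N; rewrite n_def mul2n -addnn ltn_add2l => /(_ lt_j).
  rewrite /c addn_eq0 (gtn_eqF m_gt0) /= ltnNge leq_addr /= -[X in _ == X]addn0 eqn_add2l addKn.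
  case: eqP => [->|_] /eqP; last by rewrite expf_eq0 => /andP[_ /eqP].
  by rewrite mulf_eq0 (negPf two_neq0) expf_eq0 => /andP[_ /eqP].
by split=> //; apply: (c0 0%N).
Qed.

Hypothesis sm_neq0 : s m.-1 != 0.

Let m_gt0 : (0 < m)%N. Proof. exact: ltnW. Qed.
Let Q := quad m s.
Let B := polar m s.
Let W := radical m s.

(* The q^(m - 1)-th power of the adjoint is a polynomial of degree q^(2m - 2). *)
Lemma card_radical_le : (#|W| <= q ^ (n - 2))%N.
Proof.
pose f : {poly k} := \sum_(j < m)
  (s j ^+ (q ^ m.-1) *: 'X^(q ^ (m.-1 + j))
   + s j ^+ (q ^ (m.-1 - j)) *: 'X^(q ^ (m.-1 - j))).
have e2 : (m.-1 + m.-1 = n - 2)%N by rewrite n_def; clear -m_gt0; lia.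
have size_f : (size f <= (q ^ (n - 2)).+1)%N.
  apply: leq_trans (size_sum _ _ _) _; apply/bigmax_leqP => j _.
  have le_j : (j <= m.-1)%N by rewrite -ltnS prednK.
  apply: leq_trans (size_polyD _ _) _; rewrite geq_max -e2.
  rewrite !(leq_trans (size_scale_leq _ _)) // size_polyXn ltnS leq_exp2l ?q_gt1 //.
    by rewrite (leq_trans (leq_subr _ _)) ?leq_addr.
  by rewrite leq_add2l.
have f0 : f != 0.
  apply: contraNneq sm_neq0 => f0; have := congr1 (fun g : {poly k} => g`_(q ^ (n - 2))) f0.
  have lt_m : (m.-1 < m)%N by rewrite prednK.
  rewrite coef0 coef_sum (bigD1 (Ordinal lt_m)) //= big1 => [|j neq_j]; last first.
    rewrite coefD !coefZ !coefXn !eqn_exp2l ?q_gt1 // -e2 eqn_add2l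
      (_ : (m.-1 == j) = false); last first.
      by apply/negP => /eqP ij; case/eqP: neq_j; apply: val_inj.
    rewrite gtn_eqF ?mulr0 ?addr0 //; clear -m_ge2; lia.
  rewrite coefD !coefZ !coefXn !eqn_exp2l ?q_gt1 // -e2 eqxx subnn gtn_eqF; last first.
    by clear -m_ge2; lia.
  by rewrite mulr0 mulr1 !addr0 => /eqP; rewrite expf_eq0 => /andP[].
rewrite -ltnS; apply: leq_trans size_f; apply: leq_ltn_trans (card_roots_lt f0).
apply: subset_leq_card; apply/fintype.subsetP => x; rewrite !inE => /eqP x0.
rewrite /root /f horner_sum; apply/eqP.
transitivity (adjoint m s x ^+ (q ^ m.-1)); last by rewrite x0 qpow0.
rewrite adjoint_shift ?prednK //; last by rewrite n_def; clear; lia.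
by apply: eq_bigr => j _; rewrite hornerD !hornerZ !hornerXn.
Qed.

Lemma radical_proper (D : {set k}) : (q ^ n.-1 <= #|D|)%N -> ~ {subset D <= W}.
Proof.
move=> le_D DW; have : (q ^ n.-1 <= q ^ (n - 2))%N.
  apply: leq_trans le_D (leq_trans _ card_radical_le).
  by apply: subset_leq_card; apply/fintype.subsetP.
by rewrite leq_exp2l ?q_gt1 // n_def; clear -m_ge2; lia.
Qed.

Definition twist c x := x ^+ q + c * x.

Lemma twistB c : {morph twist c : x z / x - z}.
Proof. by move=> x z; rewrite /twist -[q]expn1 qpowB; ring. Qed.

Lemma twistZ c a x : a \in Fq -> twist c (a * x) = a * twist c x.
Proof. by rewrite inE /twist => /eqP aq; rewrite exprMn aq; ring. Qed.

(* The coefficient of w^(1 + q^j) in Q(x^q + c x), where w = x^q, after moving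
   each term to the form a w^(1 + q^j) by the invariance of the trace. *)
Definition twist_coef c j :=
  (if (j < m)%N then c ^+ (q ^ j.+1 + q) * s j ^+ q + s j else 0)
  + (if (0 < j)%N then c ^+ q * s j.-1 ^+ q else 0)
  + (if (j.+1 < m)%N then c ^+ (q ^ j.+1) * s j.+1 else 0)
  + (if j == 1%N then c ^+ q * s 0%N ^+ q else 0).

Let sum_recl M (f : nat -> k) : (0 < M)%N ->
  \sum_(i < M) f i = f 0%N + \sum_(i < M.-1) f i.+1.
Proof. by case: M => // M _; rewrite big_ord_recl. Qed.

Let sum_split M (a b d u : nat -> k) g : (1 < M)%N ->
  \sum_(j < M.+1) ((if (j < M)%N then a j else 0) + (if (0 < j)%N then b j.-1 else 0)
     + (if (j.+1 < M)%N then d j.+1 else 0) + (if j == 1%N :> nat then g else 0)) * u j =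
  \sum_(j < M) a j * u j + \sum_(j < M) b j * u j.+1
  + \sum_(j < M.-1) d j.+1 * u j + g * u 1%N.
Proof.
case: M => [|M] // lt_M; under eq_bigr do rewrite !mulrDl; rewrite !big_split /=.
congr (_ + _ + _ + _).
- rewrite big_ord_recr /= ltnn mul0r addr0.
  by apply: eq_bigr => j _; rewrite ltn_ord.
- by rewrite big_ord_recl /= mul0r add0r.
- rewrite !big_ord_recr /= !ltnS ltnn ltnNge leqnSn /= !mul0r !addr0.
  by apply: eq_bigr => j _; rewrite ltnS ltn_ord.
rewrite (bigD1 (Ordinal (ltnW (lt_M : (1 < M.+1)%N) : (1 < M.+2)%N))) //= big1 ?addr0 // => j neq_j.
rewrite (_ : (_ == _) = false) ?mul0r //.
by apply/negP => /eqP j1; case/eqP: neq_j; apply: val_inj.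
Qed.

Lemma quad_twist c x : Q (twist c x) = quad m.+1 (twist_coef c) (x ^+ q).
Proof.
pose w := x ^+ q.
have -> : Q (twist c x) = Tr (\sum_(i < m) s i * (w * w ^+ (q ^ i)))
    + Tr (\sum_(i < m) s i * c ^+ (q ^ i) * (w * x ^+ (q ^ i)))
    + Tr (\sum_(i < m) c * s i * (x * w ^+ (q ^ i)))
    + Tr (\sum_(i < m) c * s i * c ^+ (q ^ i) * (x * x ^+ (q ^ i))).
  rewrite /Q /quad -!TrD -!big_split /= /qlin mulr_sumr; congr Tr.
  by apply: eq_bigr => i _; rewrite /twist -/w qpowD exprMn; ring.
have wq i : x ^+ (q ^ i.+1) = w ^+ (q ^ i) by rewrite expnS exprM.
have powq a i : (a ^+ (q ^ i)) ^+ q = a ^+ (q ^ i.+1) by rewrite -exprM -expnSr.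
have Trq (I : finType) (f : I -> k) : Tr (\sum_i f i) = Tr (\sum_i f i ^+ q).
  by rewrite -Tr_qpow1 -[q in LHS]expn1 qpow_sum expn1.
have -> : Tr (\sum_(i < m) c * s i * (x * w ^+ (q ^ i))) =
          Tr (\sum_(i < m) c ^+ q * s i ^+ q * (w * w ^+ (q ^ i.+1))).
  by rewrite Trq; congr Tr; apply: eq_bigr => i _; rewrite !exprMn -/w powq.
have -> : Tr (\sum_(i < m) c * s i * c ^+ (q ^ i) * (x * x ^+ (q ^ i))) =
          Tr (\sum_(i < m) c ^+ q * s i ^+ q * c ^+ (q ^ i.+1) * (w * w ^+ (q ^ i))).
  by rewrite Trq; congr Tr; apply: eq_bigr => i _; rewrite !exprMn -/w !powq wq.
(* For i = 0 there is no w^(q^(i - 1)): instead (w x)^q = w^(1 + q), which causes the extra summand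
   of [twist_coef] at j = 1. *)
have -> : Tr (\sum_(i < m) s i * c ^+ (q ^ i) * (w * x ^+ (q ^ i))) =
    Tr (\sum_(i < m.-1) s i.+1 * c ^+ (q ^ i.+1) * (w * w ^+ (q ^ i)))
    + Tr (s 0%N ^+ q * c ^+ q * (w * w ^+ q)).
  rewrite (sum_recl (fun i => s i * c ^+ (q ^ i) * (w * x ^+ (q ^ i)))) // addrC TrD.
  congr (_ + _); first by congr Tr; apply: eq_bigr => i _; rewrite wq.
  by rewrite -Tr_qpow1 /= expn0 !expr1 !exprMn -/w; congr Tr; ring.
rewrite /quad /qlin mulr_sumr -/w.
under [in RHS]eq_bigr => j _ do rewrite mulrCA.
rewrite (sum_split (fun j => c ^+ (q ^ j.+1 + q) * s j ^+ q + s j) (fun j => c ^+ q * s j ^+ q)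
  (fun j => c ^+ (q ^ j) * s j) (fun j => w * w ^+ (q ^ j))) //.
have -> : \sum_(i < m) (c ^+ (q ^ i.+1 + q) * s i ^+ q + s i) * (w * w ^+ (q ^ i)) =
    \sum_(i < m) s i * (w * w ^+ (q ^ i))
    + \sum_(i < m) c ^+ q * s i ^+ q * c ^+ (q ^ i.+1) * (w * w ^+ (q ^ i)).
  by rewrite -big_split; apply: eq_bigr => i _ /=; rewrite exprD; ring.
under [X in _ = Tr (_ + X + _)]eq_bigr => i _ do rewrite [c ^+ _ * s _]mulrC.
by rewrite -!TrD /= expn1; congr Tr; ring.
Qed.

Lemma quad_twist_eq0 c : (forall x, Q (twist c x) = 0) <->
  (forall j, (j < m)%N -> twist_coef c j = 0)
  /\ c * s m.-1 + (c * s m.-1) ^+ (q ^ m) = 0.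
Proof.
have coef_m : twist_coef c m = (c * s m.-1) ^+ q.
  rewrite /twist_coef ltnn m_gt0 ltnNge leqnSn (gtn_eqF m_ge2) add0r !addr0.
  by rewrite exprMn.
have powD a : a ^+ q + (a ^+ q) ^+ (q ^ m) = (a + a ^+ (q ^ m)) ^+ q.
  by rewrite -[q in RHS]expn1 qpowD expn1 -!exprM mulnC.
have powq0 (a : k) : a ^+ q = 0 <-> a = 0.
  split=> [/eqP|->]; first by rewrite expf_eq0 => /andP[_ /eqP].
  by rewrite expr0n gtn_eqF.
rewrite -[X in _ <-> _ /\ X]powq0 -powD -coef_m -quad_eq0.
split=> Q0 x; last by rewrite quad_twist.
by have [z <-] := qpow_surj 1 x; rewrite expn1 -quad_twist.
Qed.

Definition zeros := [set x | Q x == 0].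

Let W_quad x : x \in W -> Q x = 0.
Proof.
move=> /(radicalP s le_mn) xW; have := polar_diag m s x; rewrite xW => /esym/eqP.
by rewrite mulf_eq0 (negPf two_neq0) => /eqP.
Qed.

Let r := (q ^ (n - 2))%N.
Let pow_n1 : (q ^ n.-1 = q * r)%N.
Proof. by rewrite -expnS; congr expn; rewrite n_def; clear -m_ge2; lia. Qed.
Let pow_n : (q ^ n = q * (q * r))%N. Proof. by rewrite -pow_n1 -expnS prednK. Qed.
Let r_gt0 : (0 < r)%N. Proof. by rewrite expn_gt0 q_gt0. Qed.

(** With k = I + Fq x0, Q (x + c x0) = c (B x x0 + c Q x0) for x in I. For c = 0 all of I counts;
    each of the q - 1 other c contributes one fibre, of size q^(n - 2), of the functional B _ x0
    from I onto Fq. *)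
Lemma card_zeros_hyperplane (I : {set k}) :
  (forall x z, x \in I -> z \in I -> x - z \in I) ->
  (forall c x, c \in Fq -> x \in I -> c * x \in I) ->
  #|I| = (q ^ n.-1)%N -> (forall x, x \in I -> Q x = 0) ->
  #|zeros| = (q ^ n.-1 + q.-1 * q ^ (n - 2))%N.
Proof.
move=> IB IZ cardI IQ.
have ID x z : x \in I -> z \in I -> x + z \in I.
  by move=> xI zI; rewrite -[z]opprK -[X in _ - X]mulN1r IB // IZ // FqN ?Fq1.
have [x0 x0I] : exists x0, x0 \notin I.
  apply/existsP; rewrite -negb_forall; apply/negP => /forallP allI.
  have : #|I| = #|k| by apply: eq_card => x; rewrite allI.
  rewrite cardI card_k => /eqP; rewrite eqn_exp2l ?q_gt1 // => /eqP.
  by move: n_gt0; clear; lia.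
pose g (u : k * k) := u.2 + u.1 * x0.
have g_inj : {in finset.setX Fq I &, injective g} by exact: card_span.
have g_surj : g @: finset.setX Fq I = [set: k].
  apply/eqP; rewrite eqEcard finset.subsetT card_in_imset // cardsX card_Fq cardI.
  by rewrite cardsT card_k /= -expnS prednK.
have II x z : x \in I -> z \in I -> B x z = 0.
  by move=> xI zI; have := quadD m s x z; rewrite -/Q -/B !IQ ?ID // !add0r.
(* I is orthogonal to itself and spans k with x0; if it were also orthogonal to x0, it would lie in
   the radical, which is too small. *)
have [i0 i0I Bi0] : exists2 i0, i0 \in I & B i0 x0 != 0.
  apply: contrapT => noi; apply: (@radical_proper I); first by rewrite cardI.
  move=> i iI; apply/(radicalP s le_mn) => z.
  have : z \in g @: finset.setX Fq I by rewrite g_surj inE.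
  case/imsetP => -[c x] /finset.setXP[cF xI] ->; rewrite polarDr polarZr // -/B II // add0r.
  have -> : B i x0 = 0; last by rewrite mulr0.
  by apply/eqP; apply: contrapT => /negP Bi; apply: noi; exists i.
pose f x := B x x0.
have fB : {morph f : x z / x - z} by move=> x z; apply: polarBl.
have f_onto t : t \in Fq -> exists2 i, i \in I & f i = t.
  move=> tF; exists (t / f i0 * i0).
    by apply: IZ => //; rewrite FqM // FqV // Tr_Fq.
  by rewrite /f /B polarZl ?divfK // FqM // FqV // Tr_Fq.
have imf : f @: I = Fq.
  apply/finset.setP => t; apply/imsetP/idP => [[i _ ->]|/f_onto[i iI <-]]; first exact: Tr_Fq.
  by exists i.
have cardker : #|[set x in I | f x == 0]| = r.
  have := card_additive_image fB IB; rewrite imf card_Fq cardI pow_n1 => /eqP.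
  by rewrite eqn_pmul2l // => /eqP.
have card_fiber t : t \in Fq -> #|[set x in I | f x == t]| = r.
  case/f_onto => i iI <-; rewrite -cardker -[RHS](card_imset _ (@addrI _ i)).
  apply: eq_card => x; rewrite [LHS]inE; apply/andP/imsetP => [[xI /eqP fx]|[z]].
    exists (x - i); last by rewrite addrC subrK.
    by rewrite inE IB // fB fx subrr eqxx.
  rewrite inE => /andP[zI /eqP fz] ->; split; first exact: ID.
  by rewrite /f /B polarDl [polar m s z x0]fz addr0.
have Qg c x : c \in Fq -> x \in I -> Q (x + c * x0) = c * (f x + c * Q x0).
  move=> cF xI; rewrite /Q quadD quadZ // polarZr // [quad m s x]IQ // /f /B /Q; ring.
have -> : #|zeros| = #|[pred u : k * k | [&& u.1 \in Fq, u.2 \in I & Q (u.2 + u.1 * x0) == 0]]|.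
  have -> : zeros = g @: [set u in finset.setX Fq I | Q (g u) == 0].
    apply/finset.setP => x; rewrite inE; apply/idP/imsetP => [Qx|[u]].
      have : x \in g @: finset.setX Fq I by rewrite g_surj inE.
      by case/imsetP => u uI xE; exists u => //; rewrite inE uI -xE.
    by rewrite inE => /andP[_ Qu] ->.
  rewrite card_in_imset; last first.
    by move=> u v; rewrite inE => /andP[uI _]; rewrite inE => /andP[vI _]; exact: g_inj.
  by apply: eq_card => u; rewrite !inE -andbA.
rewrite (card_pairs (fun c x => [&& c \in Fq, x \in I & Q (x + c * x0) == 0])).
rewrite (bigD1 0) //=; congr (_ + _)%N.
  rewrite -cardI; apply: eq_card => x; rewrite [LHS]inE Fq0 mul0r addr0 /=.
  by case: (boolP (x \in I)) => //= xI; rewrite IQ ?eqxx.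
transitivity (\sum_(c in Fq :\ 0%R) r)%N; last first.
  rewrite sum_nat_const; congr (_ * _)%N; have := card_Fq.
  by rewrite (cardsD1 0) Fq0 => <-.
rewrite [RHS](eq_bigl (fun c => (c != 0) && (c \in Fq))); last first.
  by move=> c; rewrite finset.in_setD1.
rewrite [RHS]big_mkcondr /=; apply: eq_bigr => c c0; case: ifP => cF; last first.
  by apply: eq_card0 => x; rewrite [LHS]inE.
rewrite -(card_fiber (- (c * Q x0))); last by rewrite FqN // FqM // Tr_Fq.
apply: eq_card => x; rewrite [LHS]inE [RHS]inE /=; case: (boolP (x \in I)) => //= xI.
by rewrite Qg // mulf_eq0 (negPf c0) addr_eq0.
Qed.

Lemma card_zeros_twist c : (forall x, Q (twist c x) = 0) ->
  #|zeros| = (q ^ n.-1 + q.-1 * q ^ (n - 2))%N.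
Proof.
move=> Qc; pose ker := [set x in [set: k] | twist c x == 0].
have twist0 : twist c 0 = 0 by rewrite -{1}(subrr 0) twistB subrr.
(* Otherwise the twist would permute k, Q would vanish identically, and the radical would be all of
   k. *)
have [x1 x10 Hx1] : exists2 x1, x1 != 0 & twist c x1 = 0.
  apply: contrapT => nox; have tw_inj : injective (twist c).
    move=> x z exz; apply/eqP; rewrite -subr_eq0; apply: contrapT => /negP xz.
    by apply: nox; exists (x - z); rewrite // twistB exz subrr.
  have Q0 z : Q z = 0 by rewrite -(f_invF tw_inj z).
  apply: (@radical_proper [set: k]).
    by rewrite cardsT card_k leq_exp2l ?q_gt1 // leq_pred.
  by move=> x _; rewrite inE quad_eq0_adjoint.
(* The ratio of any kernel element to x1 is fixed by the power q, so the kernel is the line Fq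
   x1. *)
have card_ker : #|ker| = q.
  rewrite -[RHS]card_Fq -[RHS](card_imset _ (mulIf x10)); apply: eq_card => x.
  have e1 : x1 ^+ q = - (c * x1) by apply/eqP; rewrite -addr_eq0 -/(twist c x1) Hx1.
  rewrite inE finset.in_setT /=; apply/eqP/imsetP => [|[a aF ->]];
    last by rewrite twistZ ?Hx1 ?mulr0.
  move=> Hx; exists (x / x1); last by rewrite divfK.
  have [c0|c0] := eqVneq c 0.
    by move: e1 => /eqP; rewrite c0 mul0r oppr0 expf_eq0 (negPf x10) andbF.
  have : c * x1 * (x / x1 - (x / x1) ^+ q) = 0.
    rewrite -[RHS]Hx; have -> : twist c x = twist c (x / x1 * x1) by rewrite divfK.
    by rewrite /twist [in RHS]exprMn e1; ring.
  move=> /eqP; rewrite !mulf_eq0 (negPf c0) (negPf x10) /= subr_eq0 eq_sym => eq1.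
  by rewrite inE.
apply: (@card_zeros_hyperplane (twist c @: [set: k])).
- by move=> _ _ /imsetP[x _ ->] /imsetP[z _ ->]; rewrite -twistB imset_f.
- by move=> a _ aF /imsetP[x _ ->]; rewrite -twistZ // imset_f.
- have := card_additive_image (D := [set: k]) (twistB c) (fun _ _ _ _ => finset.in_setT _).
  rewrite -/ker card_ker cardsT card_k pow_n -pow_n1 mulnC => /eqP.
  by rewrite eqn_pmul2r // => /eqP.
- by move=> _ /imsetP[x _ ->].
Qed.

Let level t := [set x | Q x == t].

(* B(x - z, x + z) = 2 (Q x - Q z) *)
Lemma card_radical_pairs :
  #|[pred u : k * k | Q u.1 == Q u.2]| =
  (#|W| * q ^ n + (q ^ n - #|W|) * q ^ n.-1)%N.
Proof.
pose phi (u : k * k) := (u.1 - u.2, u.1 + u.2).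
pose psi (u : k * k) := ((u.1 + u.2) / 2%:R, (u.2 - u.1) / 2%:R).
have phiK : cancel phi psi.
  by move=> [x z]; rewrite /phi /psi /=; congr pair; field.
have psiK : cancel psi phi.
  by move=> [x z]; rewrite /phi /psi /=; congr pair; field.
have Bphi x z : B (x - z) (x + z) = 2%:R * (Q x - Q z).
  rewrite /B polarBl !polarDr (polarC _ _ z x) !polar_diag /Q; ring.
transitivity #|[pred u : k * k | B u.1 u.2 == 0]|.
  rewrite -(fintype.card_image (can_inj phiK)); apply: eq_card => u; rewrite [RHS]inE.
  apply/fintype.imageP/idP => [[v]|Bu].
    by rewrite inE => /eqP Qv ->; rewrite /phi /= Bphi Qv subrr mulr0.
  exists (psi u); last by rewrite psiK.
  move: Bu; rewrite -{1 2}(psiK u) /phi /= Bphi mulf_eq0 (negPf two_neq0) subr_eq0.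
  by rewrite inE.
rewrite (card_pairs (fun x z => B x z == 0)) (bigID (mem W)) /=; congr (_ + _)%N.
  rewrite -sum_nat_const; apply: eq_bigr => x /(radicalP s le_mn) xW.
  by rewrite -card_k; apply: eq_card => z; rewrite inE /B xW eqxx.
have <- : #|~: W| = (q ^ n - #|W|)%N by rewrite cardsCs finset.setCK card_k.
rewrite -sum_nat_const; apply: eq_big => x; first by rewrite finset.in_setC.
rewrite inE => Lx; rewrite -(card_orthogonal Lx); apply: eq_card => z.
by rewrite !inE /B polarE.
Qed.

Lemma card_level_pairs :
  #|[pred u : k * k | Q u.1 == Q u.2]| = (\sum_(t in Fq) #|level t| ^ 2)%N.
Proof.
rewrite (card_pairs (fun x z => Q x == Q z)).
rewrite (partition_big Q (mem Fq)) => [|x _]; last exact: Tr_Fq.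
apply: eq_bigr => t _; rewrite expnS expn1 -sum_nat_const.
apply: eq_big => x; first by rewrite inE.
by move=> /= /eqP <-; apply: eq_card => z; rewrite !inE eq_sym.
Qed.

Lemma sum_card_level : (\sum_(t in Fq) #|level t| = q ^ n)%N.
Proof.
rewrite -card_k -[RHS]sum1_card [RHS](partition_big Q (mem Fq)) => [|x _]; last exact: Tr_Fq.
by apply: eq_bigr => t _; rewrite sum1_card; apply: eq_card => x; rewrite !inE.
Qed.

Lemma card_radical_ge : #|zeros| = (q ^ n.-1 + q.-1 * q ^ (n - 2))%N -> (r <= #|W|)%N.
Proof.
move=> cardZ; have qE : q = q.-1.+1 by rewrite prednK.
have a_gt0 : (0 < q.-1)%N by rewrite -ltnS -qE q_gt1.
have level0 : level 0 = zeros by [].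
have sumN := sum_card_level; rewrite (bigD1 0%R) ?Fq0 //= level0 in sumN.
have sumS := card_radical_pairs; rewrite card_level_pairs (bigD1 0%R) ?Fq0 //= level0 in sumS.
have cardF0 : (\sum_(t | (t \in Fq) && (t != 0%R)) 1 = q.-1)%N.
  rewrite sum1_card -card_Fq (cardsD1 0%R) Fq0 /=; apply: eq_card => t.
  by rewrite finset.in_setD1 andbC.
have le_W : (#|W| <= q ^ n)%N by rewrite -card_k max_card.
apply: (extremal_radical_arith a_gt0 r_gt0 (w := #|W|) (X := (q ^ n - #|W|)%N)
  (Z := #|zeros|) (N := (\sum_(t in Fq | t != 0%R) #|level t|)%N)
  (S := (\sum_(t in Fq | t != 0%R) #|level t| ^ 2)%N) _ _ _ _ _); rewrite -?qE.
- by rewrite subnK // pow_n.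
- by rewrite cardZ pow_n1.
- by rewrite sumN pow_n.
(* Cauchy-Schwarz in the form 2 u v <= u^2 + v^2, with u = q^(n - 2) (q - 1) and v the size of a
   level, summed over the q - 1 nonzero levels. *)
- rewrite big_distrr /= big_distrr /= -[X in (_ + X * _)%N]cardF0 big_distrl -big_split /=.
  by apply: leq_sum => t _; rewrite mul1n addnC; apply: nat_Cauchy.
- by rewrite -pow_n -pow_n1.
Qed.

Lemma exists_twist : #|zeros| = (q ^ n.-1 + q.-1 * q ^ (n - 2))%N ->
  exists2 c, c != 0 & forall x, Q (twist c x) = 0.
Proof.
move=> cardZ; have cardW : #|W| = r.
  by apply/eqP; rewrite eqn_leq card_radical_le card_radical_ge.
(* There are more than q^(n - 2) zeros, so one lies outside the radical; with the radical it spans a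
   hyperplane of zeros, the vectors orthogonal to a. *)
have [x0 Qx0 x0W] : exists2 x0, Q x0 = 0 & x0 \notin W.
  apply: contrapT => nox; have : zeros \subset W.
    apply/fintype.subsetP => x; rewrite inE => /eqP Qx; apply: contrapT => /negP xW.
    by apply: nox; exists x.
  move/subset_leq_card; rewrite cardZ cardW pow_n1 leqNgt => /negP; apply.
  by apply: ltn_addr; rewrite ltn_Pmull ?q_gt1.
pose a := adjoint m s x0; have a0 : a != 0 by move: x0W; rewrite inE.
have oP v : v \in orthogonal a -> Q v = 0.
  pose g (u : k * k) := u.2 + u.1 * x0.
  have sub_g : g @: finset.setX Fq W \subset orthogonal a.
    apply/fintype.subsetP => _ /imsetP[[c w] /finset.setXP[cF /(radicalP s le_mn) wW] ->].
    rewrite inE /a -polarE // polarDr polarC wW polarZr // polar_diag -/Q Qx0.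
    by rewrite !mulr0 addr0.
  have : g @: finset.setX Fq W == orthogonal a.
    rewrite eqEcard sub_g card_orthogonal // card_in_imset; last first.
      by apply: card_span x0W; [exact: radicalB | exact: radicalZ].
    by rewrite cardsX card_Fq cardW pow_n1 /=.
  move=> /eqP <- /imsetP[[c w] /finset.setXP[cF wW] ->]; rewrite /Q quadD quadZ // -/Q Qx0.
  by rewrite W_quad // (radicalP s le_mn _ wW) mulr0 !addr0.
(* With b^q = a and c = - b / a, a (x^q + c x) = (b x)^q - b x, which has trace 0. *)
have [b bq] := qpow_surj 1 a; rewrite expn1 in bq.
have b0 : b != 0.
  by apply: contraNneq a0 => b0; rewrite -bq b0 expr0n gtn_eqF.
exists (- (b / a)); first by rewrite oppr_eq0 mulf_neq0 // invr_eq0.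
move=> x; apply: oP; rewrite inE /twist mulrDl TrD -(Tr_qpow1 (_ * x * a)).
have -> : - (b / a) * x * a = - (b * x) by field.
rewrite -[q in X in _ + X]expn1 qpowN expn1 exprMn bq -TrD mulrC subrr Tr0 //.
Qed.

(** The coefficient of index i - 1 is the equation for s i, and that of index m - 1 the last
    equation, without a next s. At index 1 the term in s 0 occurs twice; for m = 2 this index is
    also the last one, whence the factor 2 there. *)
Lemma twist_coef_equations c :
  (forall j, (j < m)%N -> twist_coef c j = 0) <->
  [/\ c ^+ q * s 1%N = - (c ^+ (2 * q) * s 0%N ^+ q + s 0%N),
      (2 < m)%N ->
        c ^+ (q ^ 2) * s 2%N =
          - (2%:R * c ^+ q * s 0%N ^+ q + c ^+ (q ^ 2 + q) * s 1%N ^+ q + s 1%N),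
      forall i : nat, (3 <= i < m)%N ->
        c ^+ (q ^ i) * s i =
          - (c ^+ q * s (i - 2)%N ^+ q + c ^+ (q ^ i + q) * s (i - 1)%N ^+ q + s (i - 1)%N)
    & (if m == 2%N then 2%:R else 1) * c ^+ q * s (m - 2)%N ^+ q
        + c ^+ (q ^ m + q) * s (m - 1)%N ^+ q + s (m - 1)%N = 0].
Proof.
have opp_eq (a b : k) : a = - b <-> b + a = 0.
  by split=> [->|ba]; [rewrite subrr | apply/eqP; rewrite -addr_eq0 addrC ba].
have coef0 : twist_coef c 0 = c ^+ (2 * q) * s 0%N ^+ q + s 0%N + c ^+ q * s 1%N.
  by rewrite /twist_coef m_gt0 m_ge2 /= expn1 addnn mul2n !addr0.
have coef1 : (2 < m)%N -> twist_coef c 1 =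
    2%:R * c ^+ q * s 0%N ^+ q + c ^+ (q ^ 2 + q) * s 1%N ^+ q + s 1%N + c ^+ (q ^ 2) * s 2%N.
  by move=> m_gt2; rewrite /twist_coef m_ge2 m_gt2 /=; ring.
have coefi i : (2 < i < m)%N -> twist_coef c i.-1 =
    c ^+ q * s (i - 2)%N ^+ q + c ^+ (q ^ i + q) * s (i - 1)%N ^+ q + s (i - 1)%N
    + c ^+ (q ^ i) * s i.
  case: i => [|[|[|i]]] // /andP[_ lt_i].
  by rewrite /twist_coef /= lt_i (ltnW lt_i) /= !subSS !subn0; ring.
have coefm : twist_coef c m.-1 =
    (if m == 2%N then 2%:R else 1) * c ^+ q * s (m - 2)%N ^+ q
    + c ^+ (q ^ m + q) * s (m - 1)%N ^+ q + s (m - 1)%N.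
  have [M mE] : exists M, m = M.+2 by exists (m - 2)%N; move: m_ge2; clear; lia.
  rewrite /twist_coef mE /= ltnSn ltnn !subSS !subn0 !eqSS.
  by case: eqP => [->|_]; ring.
split=> [coef|[eq1 eq2 eqi eqm] j lt_j].
  split; first by apply/opp_eq; rewrite -coef0 coef.
  - by move=> m_gt2; apply/opp_eq; rewrite -coef1 ?coef.
  - move=> i lt_i; apply/opp_eq; rewrite -coefi ?coef //.
    by case/andP: lt_i => _ /(leq_ltn_trans (leq_pred i)).
  - by rewrite -coefm coef // prednK.
have [jm|jm] := eqVneq j m.-1; first by rewrite jm coefm.
have lt_j1 : (j.+1 < m)%N by move: lt_j jm; clear; lia.
case: j lt_j jm lt_j1 => [|[|j]] _ _ lt_j; first by rewrite coef0; apply/opp_eq.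
  by rewrite coef1 //; apply/opp_eq/eq2.
by rewrite (coefi j.+3) //; apply/opp_eq/eqi.
Qed.

Lemma num_curve_points_zeros (S : {poly k}) : S = \sum_(i < m) s i *: 'X^(q ^ i) ->
  num_curve_points q S = (#|zeros| * q).+1.
Proof.
move=> S_def; rewrite /num_curve_points; congr _.+1.
rewrite (card_pairs (fun x z => z ^+ q - z == x * S.[x])).
have hS x : Tr (x * S.[x]) = Q x.
  rewrite S_def horner_sum; congr (Tr (x * _)).
  by apply: eq_bigr => i _; rewrite hornerZ hornerXn.
rewrite -sum_nat_const [RHS]big_mkcond /=; apply: eq_bigr => x _.
by rewrite card_artin_fiber hS inE.
Qed.

Lemma card_zeros_extremal :
  #|zeros| = (q ^ n.-1 + q.-1 * q ^ (n - 2))%N <->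
  exists c : k, [/\ c != 0, forall j, (j < m)%N -> twist_coef c j = 0
    & c * s m.-1 + (c * s m.-1) ^+ (q ^ m) = 0].
Proof.
split=> [/exists_twist[c c0 /quad_twist_eq0[coef eqm]]|[c [_ coef eqm]]]; first by exists c.
by apply: (@card_zeros_twist c); apply/quad_twist_eq0.
Qed.

End Curve.

End Trace.

(** * The maximality criterion *)

Lemma is_genus_uniq (k : fieldType) (K : fieldExtType (ratfun k)) (g h : nat) :
  is_genus K g -> is_genus K h -> g = h.
Proof.
move=> [g_max [D divD eD]] [h_max [E divE eE]]; apply/eqP.
by rewrite eqn_leq -!lez_nat -{1}eD -{2}eE h_max // g_max.
Qed.

Theorem theorem3 (p e q m : nat) (k : finFieldType) (s : nat -> k)
    (S : {poly k}) (K : fieldExtType (ratfun k)) (y : K)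
    (p_prime : prime p) (p_odd : odd p) (e_gt0 : (0 < e)%N)
    (q_def : q = (p ^ e)%N) (m_ge2 : (2 <= m)%N)
    (card_k : #|k| = (q ^ (2 * m))%N)
    (S_def : S = \sum_(i < m) s i *: 'X^(q ^ i))
    (s_neq0 : s 0%N * s (m - 1)%N != 0)
    (K_def : is_curve_function_field q S y) :
  is_maximal K (num_curve_points q S) <->
  exists c : k,
    [/\ c != 0,
        c ^+ q * s 1%N = - (c ^+ (2 * q) * s 0%N ^+ q + s 0%N),
        (2 < m)%N ->
          c ^+ (q ^ 2) * s 2%N =
            - (2%:R * c ^+ q * s 0%N ^+ q + c ^+ (q ^ 2 + q) * s 1%N ^+ q
               + s 1%N),
        forall i : nat, (3 <= i < m)%N ->
          c ^+ (q ^ i) * s i =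
            - (c ^+ q * s (i - 2)%N ^+ q
               + c ^+ (q ^ i + q) * s (i - 1)%N ^+ q + s (i - 1)%N)
      & (if m == 2%N then 2%:R else 1) * c ^+ q * s (m - 2)%N ^+ q
          + c ^+ (q ^ m + q) * s (m - 1)%N ^+ q + s (m - 1)%N = 0
        /\ c * s (m - 1)%N + (c * s (m - 1)%N) ^+ (q ^ m) = 0].
Proof.
have n_gt0 : (0 < 2 * m)%N by rewrite muln_gt0 /= ltnW.
have q1 : (1 < q)%N := q_gt1 p_prime e_gt0 q_def.
have s1 : s m.-1 != 0 by move: s_neq0; rewrite mulf_eq0 negb_or subn1 => /andP[].
have two_neq0 : 2%:R != 0 :> k.
  rewrite -(dvdn_pcharf (pchar_k p_prime q_def card_k)) gtnNdvd //.
  by case: (p) p_prime p_odd => [|[|[|]]].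
have powq (x : k) : (x ^+ (q ^ (2 * m).-1)) ^+ q = x.
  by rewrite -exprM -expnSr prednK // -card_k expf_card.
have q_odd : odd q by rewrite q_def oddX p_odd orbT.
have size_S : size S = (q ^ m.-1).+1 /\ lead_coef S = s m.-1.
  have [M mE] : exists M, m = M.+1 by exists m.-1; rewrite prednK // ltnW.
  rewrite S_def mE in s1 *; rewrite big_ord_recr /= in s1 *.
  set f := (X in X + _).
  have size_f : (size f < size (s M *: 'X^(q ^ M)))%N.
    rewrite size_scale // size_polyXn ltnS; apply: leq_trans (size_sum _ _ _) _.
    apply/bigmax_leqP => i _; apply: leq_trans (size_scale_leq _ _) _.
    by rewrite size_polyXn ltn_exp2l.
  rewrite addrC size_polyDl // lead_coefDl // size_scale // size_polyXn.
  by rewrite lead_coefZ lead_coefXn mulr1.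
have [size_S1 lead_S] := size_S; have S0 : S != 0 by rewrite -size_poly_eq0 size_S1.
have genus_K : is_genus K (q ^ (m - 2) * 'C(q, 2)).
  have [K_gen y_eq] := K_def.
  (* deg (x S) = q q^(m - 2) + 1, so d1 = q^(m - 2); the power q^(2m - 1) of the leading coefficient
     is a q-th root of it. *)
  apply: (@artin_schreier_genus k K y p (e * (2 * m)) e q _ ('X * S)
    (s m.-1 ^+ (q ^ (2 * m).-1))) => //.
  - by rewrite card_k q_def -expnM.
  - rewrite [_ * S]mulrC size_mulX // size_S1 -expnS; congr ((q ^ _).+2).
    by move: m_ge2; clear; lia.
  - by rewrite powq lead_coefM lead_coefX mul1r.
pose Z := #|zeros q (2 * m) m s|.
have Cq2 : (2 * 'C(q, 2) = q * q.-1)%N.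
  by rewrite bin2odd // mulnCA mul2n halfK; case: (q) q_odd => // b /= /negPf ->; rewrite subn0.
have pow_r : (q ^ (m - 2) * q ^ m = q ^ (2 * m - 2))%N.
  by rewrite -expnD; congr expn; move: m_ge2; clear; lia.
have pow_n1 : (q ^ (2 * m).-1 = q * q ^ (2 * m - 2))%N.
  by rewrite -expnS; congr expn; move: m_ge2; clear; lia.
have pow_n : (q ^ (2 * m) = q * (q * q ^ (2 * m - 2)))%N.
  by rewrite -pow_n1 -expnS prednK.
(* As 2 g q^m = q (q - 1) q^(2m - 2), dropping the point at infinity and cancelling q turns the
   point count into a count of zeros. *)
have maxE : is_maximal K (Z * q).+1 <->
    Z = (q ^ (2 * m).-1 + q.-1 * q ^ (2 * m - 2))%N.
  transitivity ((Z * q).+1%:R = #|k|%:R + 1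
      + 2%:R * (q ^ (m - 2) * 'C(q, 2))%:R * sqrtC #|k|%:R :> algC).
    split=> [[g genus_g]|]; last by exists (q ^ (m - 2) * 'C(q, 2))%N.
    by rewrite (is_genus_uniq genus_g genus_K).
  have -> : sqrtC #|k|%:R = (q ^ m)%:R :> algC.
    by rewrite card_k mulnC expnM natrX sqrCK ?ler0n.
  rewrite -!natrM natr1 -natrD card_k pow_n pow_n1 -pow_r.
  have -> : (2 * (q ^ (m - 2) * 'C(q, 2)) * q ^ m)%N = (q * (q.-1 * (q ^ (m - 2) * q ^ m)))%N.
    by rewrite [RHS]mulnA -Cq2; ring.
  rewrite addSn -mulnDr mulnC; split=> [/eqP|->//].
  by rewrite eqr_nat eqSS eqn_pmul2l ?(ltnW q1) // => /eqP.
rewrite (num_curve_points_zeros p_prime e_gt0 q_def n_gt0 card_k S_def) maxE.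
rewrite (card_zeros_extremal p_prime e_gt0 q_def n_gt0 card_k m_ge2) // !subn1.
split=> [[c [c0 coef eqm]]|[c [c0 eq1 eq2 eqi [eqm eqn]]]]; exists c.
  by have [] := (twist_coef_equations q s m_ge2 c).1 coef; rewrite subn1.
by split=> //; apply/twist_coef_equations => //; split=> //; rewrite subn1.
Qed.
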